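(* Let $I=[0,\infty)$ or $I=(0,\infty)$ and let $X$ be a standard process on $I$ (with lifetime $\zeta$, possibly finite) with no negative jumps. Suppose that $$\lim_{b \to \infty}\lim_{x \to \infty}\mathbb{P}_{x}[\tau_{b}^{-} \leq t] = 1 \quad \text{for every } t > 0,$$ and that the following hold: (i) for every $f \in C$ and $q > 0$, $R^{(q)}f \in C$; (ii) for every $f \in C$ and $x \in I$, $\lim_{q \to \infty} qR^{(q)}f(x) =f(x)$. Then there exists a Feller semigroup $(\bar{p}_{t})_{t \geq 0}$ on $C_{\infty}(I')$ such that $\bar{p}_{t}f(x) = \mathbb{E}_{x}[f(X_{t})]$ for all $f \in C_{\infty}(I')$, $x \in I$ and $t\ge 0$. Moreover, any associated Hunt process $Y=(\Omega', \mathcal{F}', \mathcal{F}'_{t}, Y_t, \theta'_{t}, \mathbb{P}'_{x})$ on $I' \cup \{\partial'\}$ with cemetery $\partial'$ satisfies $$\mathbb{P}'_{\infty}[Y_{t} \in I \cup \{ \partial' \} \ \text{for every } t > 0] = 1.$$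
   Context: $X=(\Omega,\mathcal F,\mathcal F_t,X_t,\theta_t,\mathbb P_x)$ is a standard process in the sense of Blumenthal--Getoor (a normal, right-continuous strong Markov process with left limits and quasi-left-continuity on $[0,\zeta)$), with state space $I$, cemetery $\partial$ and lifetime $\zeta$. Every measurable function $f$ on $I$ is extended by $f(\partial)=0$. For a set $A$, $\tau_A:=\inf\{t>0\mid X_t\in A\}$; $\tau_x:=\tau_{\{x\}}$, $\tau_x^-:=\tau_{I\cap[-\infty,x]}$. ''No negative jumps'' means $\mathbb P_z[\tau_x^-<\tau_y]=0$ for all $x,y,z\in I$ with $x<y<z$. The limits in the displayed hypothesis exist by monotonicity. The $q$-resolvent ($q>0$) is $R^{(q)}f(x):=\mathbb E_x\left[\int_0^\infty e^{-qt}f(X_t)\,dt\right]$. $C$ is the space of bounded continuous functions $f:I\to\mathbb R$ which, when $0\notin I$, also satisfy $\lim_{x\to0}f(x)=0$; it carries the supremum norm. $I':=I\cup\{\infty\}$ is endowed with the usual topology (so $I'=(0,\infty]$ or $[0,\infty]$), and $\partial'$ is added to $I'$ as an isolated point. For a topological space $S$, $C_\infty(S)$ is the space of continuous functions on $S$ vanishing at infinity. A Feller semigroup on $C_\infty(I')$ is a strongly continuous positive contraction semigroup on $C_\infty(I')$. *)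

(* Defs.v *)
From HB Require Import structures.
From mathcomp Require Import all_boot all_order all_algebra.
From mathcomp Require Import all_classical all_reals all_analysis.
From mathcomp Require Import measurable_realfun.

Set Implicit Arguments.
Unset Strict Implicit.
Unset Printing Implicit Defensive.

Import Order.TTheory GRing.Theory Num.Theory.
Import numFieldNormedType.Exports.

Local Open Scope classical_set_scope.
Local Open Scope ring_scope.

(* A state space E with a cemetery adjoined is [option E]; [None] is the
   cemetery. *)

Section cemetery.
Context (E : topologicalType).

(* The sigma-algebra on [option E] generated by the Borel sets of E. *)
Definition cem_borel : set (set (option E)) :=
  [set B | <<s @open E >> (Some @^-1` B)].

Definition cem_space := g_sigma_algebraType cem_borel.

(* Neighbourhoods in [option E], where [cem] is the filter of neighbourhoods
   of the cemetery; the two topologies on [option E] in use differ only there. *)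
Definition cem_nbhs (cem : set_system (option E)) (x : option E) :
    set_system (option E) :=
  if x is Some y then Some @ nbhs y else cem.

Definition isolated_cem : set_system (option E) := principal_filter None.

(* Blumenthal and Getoor's convention: the cemetery is the point at infinity
   of E if E is not compact, and is isolated if E is compact. When E is not
   compact this matters for Hunt processes: a process whose paths tend to
   infinity in E at the lifetime is quasi-left-continuous there for this
   topology, and not for an isolated cemetery. *)
Definition infinity_cem : set_system (option E) :=
  @nbhs _ (one_point_compactification E) None.

(* Extension of functions by 0 at the cemetery. *)
Definition cem_ext (R : realType) (f : E -> R) (x : option E) : R :=
  if x is Some y then f y else 0.

End cemetery.

Section process.
Context (d : measure_display) (Omega : measurableType d) (R : realType)
  (E : topologicalType).

(* Times are real numbers; only the values at times [0 <= t] matter. *)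
Record process_data := ProcessData {
  filtration : R -> set (set Omega);
  position : R -> Omega -> option E;
  translation : R -> Omega -> Omega;
  law : option E -> probability Omega R }.

Variable X : process_data.

(* The value of the path at a possibly infinite time: X_oo is the cemetery. *)
Definition position_at (t : \bar R) (w : Omega) : option E :=
  if t is r%:E then position X r w else None.

Definition lifetime (w : Omega) : \bar R :=
  ereal_inf (EFin @` [set t | 0 <= t /\ position X t w = None]).

Definition hitting_time (A : set E) (w : Omega) : \bar R :=
  ereal_inf (EFin @` [set t | 0 < t /\ (Some @` A) (position X t w)]).

Definition stopping_time (T : Omega -> \bar R) : Prop :=
  (forall w, 0 <= T w)%E /\
  (forall t : R, 0 <= t -> filtration X t [set w | (T w <= t%:E)%E]).

Definition stopped_events (T : Omega -> \bar R) : set (set Omega) :=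
  [set A | measurable A /\
    forall t : R, 0 <= t -> filtration X t (A `&` [set w | (T w <= t%:E)%E])].

Definition almost_surely (Q : Omega -> Prop) : Prop :=
  exists N : set Omega, [/\ measurable N, forall x, law X x N = 0%E
    & forall w, ~ N w -> Q w].

(* N is null for P^mu = \int P_x mu(dx). *)
Definition initial_null (mu : probability (cem_space E) R) (N : set Omega) :
    Prop :=
  exists B : set Omega, [/\ measurable B, N `<=` B
    & mu.-negligible [set x | law X x B != 0%E]].

Record markov_process : Prop := MarkovProcess {
  filtration_sigma_algebra : forall t : R, 0 <= t ->
    sigma_algebra [set: Omega] (filtration X t);
  filtration_measurable : forall t : R, 0 <= t ->
    filtration X t `<=` measurable;
  filtration_nondecreasing : forall s t : R, 0 <= s -> s <= t ->
    filtration X s `<=` filtration X t;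
  coord_adapted : forall t : R, 0 <= t -> forall B, cem_borel B ->
    filtration X t (position X t @^-1` B);
  coord_absorbed : forall (s t : R) w, 0 <= s -> s <= t ->
    position X s w = None -> position X t w = None;
  law_measurable : forall t : R, 0 <= t -> forall B, cem_borel B ->
    measurable_fun [set: cem_space E]
      (fun x : cem_space E => law X x (position X t @^-1` B));
  coord_translation : forall (s t : R) w, 0 <= s -> 0 <= t ->
    position X s (translation X t w) = position X (t + s) w;
  markov_property : forall x (s t : R) A B, 0 <= s -> 0 <= t ->
    filtration X t A -> cem_borel B ->
    law X x (A `&` position X (t + s) @^-1` B) =
    (\int[law X x]_(w in A) law X (position X t w) (position X s @^-1` B))%E }.

Definition normal_process : Prop :=
  forall x, law X x [set w | position X 0 w = x] = 1%E.

Definition filtration_right_continuous : Prop :=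
  forall t : R, 0 <= t -> forall A,
    (forall s, t < s -> filtration X s A) -> filtration X t A.

(* Completeness with respect to the family of the P^mu, mu ranging over the
   probability measures on the Borel sets of [option E]. *)
Definition filtration_complete : Prop :=
  forall t : R, 0 <= t -> forall A : set Omega,
    (forall mu : probability (cem_space E) R,
      exists2 A', filtration X t A' &
        initial_null mu ((A `\` A') `|` (A' `\` A))) ->
    filtration X t A.

Definition strong_markov : Prop :=
  forall T, stopping_time T ->
    (forall B, cem_borel B ->
      stopped_events T [set w | B (position_at (T w) w)]) /\
    (forall x (t : R) A B, 0 <= t -> stopped_events T A -> cem_borel B ->
      law X x (A `&` [set w | B (position_at (T w + t%:E)%E w)]) =
      (\int[law X x]_(w in A)
         law X (position_at (T w) w) (position X t @^-1` B))%E).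

Variable cem : set_system (option E).

Definition right_continuous_paths : Prop :=
  almost_surely (fun w => forall t : R, 0 <= t ->
    position X s w @[s --> t^'+] `=>` cem_nbhs cem (position X t w)).

Definition left_limits_before_lifetime : Prop :=
  almost_surely (fun w => forall t : R, 0 < t -> (t%:E < lifetime w)%E ->
    exists l, position X s w @[s --> t^'-] `=>` cem_nbhs cem l).

(* X_{T_n} tends to X_T almost surely on {T < S}, for all stopping times
   T_n increasing to T. *)
Definition quasi_left_continuous_before (S : Omega -> \bar R) : Prop :=
  forall T : nat -> Omega -> \bar R,
    (forall n, stopping_time (T n)) ->
    (forall w, {homo T^~ w : m n / (m <= n)%N >-> (m <= n)%E}) ->
    let Tlim w := ereal_sup (range (T^~ w)) in
    almost_surely (fun w => (Tlim w < S w)%E ->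
      position_at (T n w) w @[n --> \oo] `=>`
        cem_nbhs cem (position_at (Tlim w) w)).

(* Blumenthal and Getoor, Markov Processes and Potential Theory, I.9.2. *)
Record standard_process : Prop := StandardProcess {
  standard_markov : markov_process;
  standard_normal : normal_process;
  standard_right_continuous_filtration : filtration_right_continuous;
  standard_complete_filtration : filtration_complete;
  standard_right_continuous_paths : right_continuous_paths;
  standard_left_limits : left_limits_before_lifetime;
  standard_strong_markov : strong_markov;
  standard_quasi_left_continuous : quasi_left_continuous_before lifetime }.

Definition hunt_process : Prop :=
  standard_process /\ quasi_left_continuous_before (fun=> +oo%E).

Definition discounted_integral (q : R) (f : E -> R) (w : Omega) : R :=
  \int[lebesgue_measure]_(t in `[0, +oo[)
    (expR (- (q * t)) * cem_ext f (position X t w)).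

Definition resolvent (q : R) (f : E -> R) (x : E) : R :=
  fine ('E_(law X (Some x))[discounted_integral q f])%E.

End process.

Section feller.
Context (R : realType) (S : topologicalType).
Implicit Types (f g : S -> R) (p : R -> (S -> R) -> (S -> R)).

Definition sup_norm f : R := sup (range (fun x => `|f x|)).

Definition C_infty : set (S -> R) :=
  [set f | continuous f /\
    forall e : R, 0 < e -> exists2 K : set S, compact K &
      forall x, ~ K x -> `|f x| < e].

Record feller_semigroup p : Prop := FellerSemigroup {
  feller_stable : forall (t : R) f, 0 <= t -> C_infty f -> C_infty (p t f);
  feller_linear : forall (t a : R) f g, 0 <= t -> C_infty f -> C_infty g ->
    p t (fun x => a * f x + g x) = (fun x => a * p t f x + p t g x);
  feller_id : forall f, C_infty f -> p 0 f = f;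
  feller_add : forall (s t : R) f, 0 <= s -> 0 <= t -> C_infty f ->
    p (s + t) f = p s (p t f);
  feller_positive : forall (t : R) f, 0 <= t -> C_infty f ->
    (forall x, 0 <= f x) -> forall x, 0 <= p t f x;
  feller_contraction : forall (t : R) f, 0 <= t -> C_infty f ->
    sup_norm (p t f) <= sup_norm f;
  feller_strongly_continuous : forall f, C_infty f ->
    sup_norm (fun x => p t f x - f x) @[t --> 0^'+] --> 0 }.

(* The transition semigroup of Y on C_infty(S) is p. *)
Definition associated d (Omega : measurableType d)
    (Y : process_data Omega R S) p : Prop :=
  forall (t : R) f x, 0 <= t -> C_infty f ->
    (p t f x)%:E = 'E_(law Y (Some x))[fun w => cem_ext f (position Y t w)]%E.

End feller.

Section half_line.
Context (R : realType) (I : set R).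

(* The trace on I of a filter on R. *)
Definition trace_filter (F : set_system R) : set_system I :=
  [set A | F [set y | forall x : I, set_val x = y -> A x]].

(* The space C: continuity and boundedness on I, and limit 0 at 0 when 0 is
   not in I. *)
Definition space_C : set (I -> R) :=
  [set f | [/\ continuous f, exists M, forall x, `|f x| <= M
    & ~ I 0 -> f x @[x --> trace_filter (nbhs (0 : R))] --> (0 : R)]].

(* I' = I U {oo}, with the topology of a subset of the extended line. *)
Definition I_infty : set (\bar R) := EFin @` I `|` [set +oo%E].

Lemma I_infty_fin (x : I) : (set_val x)%:E \in I_infty.
Proof. by apply/mem_set; left; exists (set_val x) => //; exact: set_valP. Qed.

Lemma I_infty_oo : +oo%E \in I_infty.
Proof. by apply/mem_set; right. Qed.

Definition to_I_infty (x : I) : I_infty := exist _ (set_val x)%:E (I_infty_fin x).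

Definition point_infty : I_infty := exist _ +oo%E I_infty_oo.

Context (d : measure_display) (Omega : measurableType d).
Variable X : process_data Omega R I.

Definition tau (x : I) : Omega -> \bar R := hitting_time X [set x].

Definition tau_minus (x : I) : Omega -> \bar R :=
  hitting_time X [set y : I | set_val y <= set_val x].

Definition no_negative_jumps : Prop :=
  forall x y z : I, set_val x < set_val y -> set_val y < set_val z ->
    law X (Some z) [set w | (tau_minus x w < tau y w)%E] = 0%E.

Definition comes_down_from_infinity : Prop :=
  forall t : R, 0 < t ->
    lim (law X (Some x) [set w | (tau_minus b w <= t%:E)%E]
           @[x --> trace_filter +oo])
      @[b --> trace_filter +oo] --> 1%E.

End half_line.

(* Main.v *)
Require Import Defs.
From HB Require Import structures.
From mathcomp Require Import all_boot all_order all_algebra.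
From mathcomp Require Import all_classical all_reals all_analysis.
From mathcomp Require Import measurable_realfun.
From mathcomp Require Import ring lra.

Set Implicit Arguments.
Unset Strict Implicit.
Unset Printing Implicit Defensive.

Import Order.TTheory GRing.Theory Num.Theory.
Import numFieldNormedType.Exports.

Local Open Scope classical_set_scope.
Local Open Scope ring_scope.

(* Since X has no negative jumps, it passes through every level on its way down,
   and since it comes down from infinity, it does so quickly from far away. By the
   strong Markov property at the passage through a large level c, R^q f(x) is close
   to R^q f(c) for all large x; hence R^q f has a limit at infinity, and q R^q f
   converges to f pointwise on I' as q -> oo.

   Differences of supermedian functions in C_infty(I') form a lattice that contains
   the functions R^q f, so it is dense by Stone's theorem. On a supermedian function
   the transition operators P_t of X are strongly continuous as t -> 0, by Dini's
   theorem; hence they are so on all of C_infty(I'). If T is the maximum of N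
   independent exponential times, E[P_T f] is a linear combination of resolvents, and
   T concentrates at t for suitable rates, so P_t f is a uniform limit of functions
   that extend continuously to I'.

   For the Hunt process Y started at infinity, the resolvents of functions tending to
   the indicator of infinity tend to 0, so Y_s is almost surely not at infinity for
   some arbitrarily small s. From then on Y has the finite-dimensional distributions
   of X until its death. By quasi-left-continuity X stays in a compact subset of I up
   to any time at which it is alive, so Y keeps away from infinity on fine time grids,
   and by right-continuity at all times. *)

(** * Integrals of bounded functions *)

(** Hypotheses (i) and (ii) concern resolvents only, and the convergence in (ii) is pointwise;
    continuity of P_t f and strong continuity are statements in the sup norm. The lattice of
    supermedian differences bridges this gap: Stone's theorem asks for approximation at two points
    at a time, and Dini's theorem turns pointwise into uniform convergence. At infinity there is no
    process to evaluate, so every estimate there is read off a far level c of I and holds uniformly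
    over all x far above c. For Y the difficulty is that its paths live on another space: only its
    transition function is tied to X. A path property of X therefore has to be passed to Y as a
    bound on expectations of finite products of cut-offs along time grids, uniform in the mesh.
    Survival up to the end of the grid is part of the event, because a path of X may leave every
    compact set at its lifetime, where quasi-left-continuity before the lifetime says nothing. If I
    = (0,oo), constants are not in C_infty(I'), so cut-offs must also vanish at 0. *)

Section continuous_real_functions.
Context (E : topologicalType) (R : realType).
Implicit Types (f g : E -> R).

Lemma continuous_fcst (a : R) : continuous (fun _ : E => a).
Proof. by move=> x; exact: cvg_cst. Qed.

Lemma continuous_fD f g : continuous f -> continuous g -> continuous (fun x => f x + g x).
Proof. by move=> cf cg x; apply: cvgD; [exact: cf|exact: cg]. Qed.

Lemma continuous_fB f g : continuous f -> continuous g -> continuous (fun x => f x - g x).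
Proof. by move=> cf cg x; apply: cvgB; [exact: cf|exact: cg]. Qed.

Lemma continuous_fM f g : continuous f -> continuous g -> continuous (fun x => f x * g x).
Proof. by move=> cf cg x; apply: cvgM; [exact: cf|exact: cg]. Qed.

Lemma continuous_fnorm f : continuous f -> continuous (fun x => `|f x|).
Proof. by move=> cf x; apply: cvg_norm; exact: cf. Qed.

Lemma continuous_fmin f g : continuous f -> continuous g ->
  continuous (fun x => Num.min (f x) (g x)).
Proof.
by move=> cf cg x; apply: (@continuous_min _ _ f g x); [exact: cf|exact: cg].
Qed.

Lemma continuous_fmax f g : continuous f -> continuous g ->
  continuous (fun x => Num.max (f x) (g x)).
Proof.
by move=> cf cg x; apply: (@continuous_max _ _ f g x); [exact: cf|exact: cg].
Qed.

End continuous_real_functions.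

Section bounded_integrals.
Context d (T : measurableType d) (R : realType).
Implicit Types (f g : T -> R).

(** Bounded measurable functions: on a probability space the real-valued integral is linear and
    monotone on this class without integrability side conditions. *)
Definition bmf f := measurable_fun [set: T] f /\ exists M, forall x, `|f x| <= M.

Lemma bmf_measurable f : bmf f -> measurable_fun [set: T] f.
Proof. by case. Qed.

Lemma bmf_cst (a : R) : bmf (fun=> a).
Proof. by split; [exact: measurable_cst | exists `|a|]. Qed.

Lemma bmfD f g : bmf f -> bmf g -> bmf (fun x => f x + g x).
Proof.
move=> [mf [M hM]] [mg [M' hM']]; split; first exact: measurable_funD.
by exists (M + M') => x; rewrite (le_trans (ler_normD _ _))// lerD.
Qed.

Lemma bmfN f : bmf f -> bmf (fun x => - f x).
Proof.
move=> [mf [M hM]]; split; first exact: measurableT_comp.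
by exists M => x; rewrite normrN.
Qed.

Lemma bmfB f g : bmf f -> bmf g -> bmf (fun x => f x - g x).
Proof. by move=> bf bg; apply: bmfD => //; exact: bmfN. Qed.

Lemma bmfM f g : bmf f -> bmf g -> bmf (fun x => f x * g x).
Proof.
move=> [mf [M hM]] [mg [M' hM']]; split; first exact: measurable_funM.
by exists (M * M') => x; rewrite normrM ler_pM.
Qed.

Lemma bmfZ (a : R) f : bmf f -> bmf (fun x => a * f x).
Proof. by apply: bmfM; exact: bmf_cst. Qed.

Lemma bmf_indic (A : set T) : measurable A -> bmf (fun x => (x \in A)%:R).
Proof.
move=> mA; split; first exact: measurable_indic.
by exists 1 => x; case: (_ \in _); rewrite /= ?normr1 ?normr0.
Qed.

Lemma bmf_sum n (F : nat -> T -> R) :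
  (forall k, bmf (F k)) -> bmf (fun x => \sum_(k < n) F k x).
Proof.
move=> bF; elim: n => [|n IH].
  by under eq_fun do rewrite big_ord0; exact: bmf_cst.
by under eq_fun do rewrite big_ord_recr; exact: bmfD.
Qed.

Variable P : probability T R.

Lemma bmf_integrable f : bmf f -> P.-integrable [set: T] (EFin \o f).
Proof.
move=> [mf [M hM]]; apply: measurable_bounded_integrable => //.
  by rewrite (le_lt_trans (probability_le1 P measurableT))// ltry.
exists M; split; first exact: num_real.
by move=> y My x _; exact: le_trans (hM x) (ltW My).
Qed.

Lemma Ex_D f g : bmf f -> bmf g ->
  \int[P]_x (f x + g x) = \int[P]_x f x + \int[P]_x g x.
Proof. by move=> bf bg; apply: RintegralD => //; exact: bmf_integrable. Qed.

Lemma Ex_Z (a : R) f : bmf f -> \int[P]_x (a * f x) = a * \int[P]_x f x.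
Proof. by move=> bf; apply: RintegralZl => //; exact: bmf_integrable. Qed.

Lemma Ex_B f g : bmf f -> bmf g ->
  \int[P]_x (f x - g x) = \int[P]_x f x - \int[P]_x g x.
Proof. by move=> bf bg; apply: RintegralB => //; exact: bmf_integrable. Qed.

Lemma Ex_N f : bmf f -> \int[P]_x (- f x) = - \int[P]_x f x.
Proof.
move=> bf; rewrite -mulN1r -Ex_Z//.
by apply: eq_Rintegral => x _; rewrite mulN1r.
Qed.

Lemma Ex_cst (a : R) : \int[P]_x a = a.
Proof. by rewrite Rintegral_cst// [X in fine X](probability_setT P) mulr1. Qed.

Lemma Ex_le f g : bmf f -> bmf g -> (forall x, f x <= g x) ->
  \int[P]_x f x <= \int[P]_x g x.
Proof. by move=> bf bg fg; apply: le_Rintegral => //; exact: bmf_integrable. Qed.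

Lemma Ex_le_cst f (a : R) : bmf f -> (forall x, f x <= a) -> \int[P]_x f x <= a.
Proof. by move=> bf fa; rewrite -[leRHS]Ex_cst Ex_le//; exact: bmf_cst. Qed.

Lemma Ex_ge_cst f (a : R) : bmf f -> (forall x, a <= f x) -> a <= \int[P]_x f x.
Proof. by move=> bf fa; rewrite -[leLHS]Ex_cst Ex_le//; exact: bmf_cst. Qed.

Lemma Ex_norm f (a : R) : bmf f -> (forall x, `|f x| <= a) -> `|\int[P]_x f x| <= a.
Proof.
move=> bf fa; rewrite ler_norml Ex_ge_cst//= ?Ex_le_cst// => x.
  by rewrite (le_trans (ler_norm _))// fa.
by rewrite lerNl (le_trans _ (fa x))// -normrN ler_norm.
Qed.

Lemma Ex_sum n (F : nat -> T -> R) : (forall k, bmf (F k)) ->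
  \int[P]_x (\sum_(k < n) F k x) = \sum_(k < n) \int[P]_x F k x.
Proof.
move=> bF; elim: n => [|n IH].
  by under eq_Rintegral do rewrite big_ord0; rewrite Ex_cst big_ord0.
under eq_Rintegral do rewrite big_ord_recr/=.
by rewrite Ex_D// ?IH ?big_ord_recr//; exact: bmf_sum.
Qed.

Lemma Ex_indic (A : set T) : measurable A ->
  \int[P]_x (x \in A)%:R = fine (P A).
Proof.
move=> mA; rewrite /Rintegral.
rewrite (_ : (fun x => (x \in A)%:R%:E) = (EFin \o \1_A))//.
by rewrite integral_indic// setIT.
Qed.

Lemma expectation_Ex f : bmf f -> ('E_P[f] = (\int[P]_x f x)%:E)%E.
Proof.
move=> bf; rewrite unlock /Rintegral fineK//.
by apply: integrable_fin_num => //; exact: bmf_integrable.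
Qed.

Lemma Ex_dominated (F : nat -> T -> R) f (M : R) :
  (forall n, measurable_fun [set: T] (F n)) -> (forall n x, `|F n x| <= M) ->
  (forall x, F n x @[n --> \oo] --> f x) ->
  bmf f /\ \int[P]_x F n x @[n --> \oo] --> \int[P]_x f x.
Proof.
move=> mF hM hf.
have mf : measurable_fun [set: T] f.
  by apply: (measurable_fun_cvg mF) => x _; exact: hf.
have bf : bmf f.
  split=> //; exists M => x.
  have /cvg_norm := hf x => hfx; rewrite -(cvg_lim _ hfx)//.
  apply: limr_le; first by apply/cvg_ex; exists `|f x|.
  by near=> n; exact: hM.
split=> //; apply: fine_cvg; rewrite fineK; last first.
  by apply: integrable_fin_num => //; exact: bmf_integrable.
have := @dominated_convergence _ _ _ P setT measurableT
  (fun n => EFin \o F n) (EFin \o f) (fun=> M%:E).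
case.
- by move=> n; exact/measurable_EFinP.
- exact/measurable_EFinP.
- by apply: aeW => x _; apply: cvg_EFin; [exact: nearW|exact: hf].
- by exact: (bmf_integrable (bmf_cst M)).
- by apply: aeW => x n _ /=; rewrite lee_fin.
- by [].
Unshelve. all: by end_near. Qed.

Lemma Ex_ae (N : set T) f g : measurable N -> P N = 0%E ->
  measurable_fun [set: T] f -> measurable_fun [set: T] g ->
  (forall x, ~ N x -> f x = g x) -> \int[P]_x f x = \int[P]_x g x.
Proof.
move=> mN N0 mf mg fg; congr fine; apply: ae_eq_integral => //.
- exact/measurable_EFinP.
- exact/measurable_EFinP.
- by exists N; split=> // x /= h; apply: contrapT => /fg fgx; apply: h => _; rewrite fgx.
Qed.

End bounded_integrals.

Lemma bmf_comp d d' (T : measurableType d) (T' : measurableType d') (R : realType)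
    (f : T' -> R) (g : T -> T') :
  bmf f -> measurable_fun [set: T] g -> bmf (fun x => f (g x)).
Proof.
move=> [mf [M hM]] mg; split; first exact: measurableT_comp.
by exists M => x.
Qed.

Lemma Ex_Fubini d d' (T : measurableType d) (T' : measurableType d') (R : realType)
    (P : probability T R) (Q : probability T' R) (h : T * T' -> R) : bmf h ->
  [/\ bmf (fun x => \int[Q]_y h (x, y)),
      bmf (fun y => \int[P]_x h (x, y)) &
      \int[P]_x \int[Q]_y h (x, y) = \int[Q]_y \int[P]_x h (x, y)].
Proof.
move=> bh.
have [mh [M hM]] := bh.
have bh1 x : bmf (fun y => h (x, y)).
  by apply: bmf_comp bh _; exact: measurable_pair1.
have bh2 y : bmf (fun x => h (x, y)).
  by apply: (@bmf_comp _ _ _ _ _ h (fun x => (x, y))) => //; exact: measurable_pair2.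
have ih : (P \x Q)%E.-integrable setT (EFin \o h).
  apply/integrable12ltyP; first exact/measurable_EFinP.
  apply: (@le_lt_trans _ _ (\int[P]_x (M%:E))%E).
    apply: ge0_le_integral => //.
    - by move=> x _; exact: integral_ge0.
    - apply: (measurable_fun_fubini_tonelli_F (fun z => `|(h z)%:E|%E)) => //.
      by apply: measurableT_comp => //; exact/measurable_EFinP.
    - move=> x _; apply: (@le_trans _ _ (\int[Q]_y (M%:E))%E).
        apply: ge0_le_integral => //.
        + apply: measurableT_comp => //; apply/measurable_EFinP.
          by case: (bh1 x).
        + by move=> y _ /=; rewrite lee_fin.
      by rewrite integral_cst// [X in (_ * X)%E](probability_setT Q) mule1.
  by rewrite integral_cst// [X in (_ * X)%E](probability_setT P) mule1 ltry.
have e1 x : (\int[Q]_y (h (x, y))%:E)%E = (\int[Q]_y h (x, y))%:E.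
  by rewrite fineK//; apply: integrable_fin_num => //; exact: (bmf_integrable Q (bh1 x)).
have e2 y : (\int[P]_x (h (x, y))%:E)%E = (\int[P]_x h (x, y))%:E.
  by rewrite fineK//; apply: integrable_fin_num => //; exact: (bmf_integrable P (bh2 y)).
split.
- split; last by exists M => x; exact: Ex_norm.
  apply/measurable_EFinP.
  rewrite (_ : _ \o _ = (fun x => \int[Q]_y (h (x, y))%:E)%E); last exact/funext.
  exact: (measurable_fubini_F ih).
- split; last by exists M => x; exact: Ex_norm.
  apply/measurable_EFinP.
  rewrite (_ : _ \o _ = (fun y => \int[P]_x (h (x, y))%:E)%E); last exact/funext.
  exact: (measurable_fubini_G ih).
- congr fine; under eq_integral do rewrite -e1.
  under [RHS]eq_integral do rewrite -e2.
  exact: Fubini ih.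
Qed.

(** * Extension of identities from events to bounded functions *)

Section positive_functionals.
Context d (T : measurableType d) (R : realType).

(** Each side of an identity known for events, such as the Markov property, is such a functional of
    the test function. Continuity is not part of the notion, since bounded functions are uniform
    limits of simple ones. *)
Definition positive_functional (Phi : (T -> R) -> R) :=
  (forall a f g, bmf f -> bmf g ->
     Phi (fun x => a * f x + g x) = a * Phi f + Phi g) /\
  (forall f g, bmf f -> bmf g -> (forall x, f x <= g x) -> Phi f <= Phi g).

(** For y in [0,1] this is y rounded down to a multiple of 1/(n+1), written as a combination of
    indicators of level sets so that functionals can be evaluated term by term. *)
Definition indicator_mean (n : nat) (y : R) : R :=
  n.+1%:R^-1 * \sum_(k < n.+1) (k.+1%:R / n.+1%:R <= y)%R%:R.

Lemma indicator_mean_approx (n : nat) (y : R) : 0 <= y <= 1 ->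
  indicator_mean n y <= y <= indicator_mean n y + n.+1%:R^-1.
Proof.
move=> /andP[y0 y1].
have n0 : 0 < n.+1%:R :> R by [].
pose m := Num.truncn (y * n.+1%:R).
have ym0 : 0 <= y * n.+1%:R by rewrite mulr_ge0.
have mn : (m <= n.+1)%N.
  rewrite /m -[leqRHS](natrK (R := R) n.+1); apply: le_truncn.
  by rewrite -[leRHS]mul1r ler_wpM2r.
have -> : indicator_mean n y = n.+1%:R^-1 * m%:R.
  congr (_ * _); rewrite -natr_sum; congr (_%:R).
  under eq_bigr => k _.
    rewrite ler_pdivrMr// -truncn_ge_nat// -/m; over.
  rewrite -(big_mkord xpredT (fun k => nat_of_bool (k < m)%N)).
  rewrite (@big_cat_nat _ _ _ m)//=.
  rewrite (eq_big_nat _ _ (F2 := fun=> 1%N)); last by move=> i /andP[_ ->].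
  rewrite sum_nat_const_nat subn0 muln1 big_nat_cond big1 ?addn0// => i.
  by rewrite andbT => /andP[mi _]; rewrite ltnNge mi.
have /andP[h1 h2] := truncn_itv ym0.
rewrite mulrC ler_pdivrMr// h1/= -[X in _ <= _ + X]mul1r -mulrDl ler_pdivlMr//.
by rewrite natr1 ltW.
Qed.

(** For g with values in [0,1], its rounding s satisfies s <= g <= s + 1/(n+1); both functionals
    agree on s and on constants, so by monotonicity they are squeezed together on g. *)
Lemma positive_functional_eq Phi Psi :
  positive_functional Phi -> positive_functional Psi ->
  (forall A, measurable A ->
     Phi (fun x => (x \in A)%:R) = Psi (fun x => (x \in A)%:R)) ->
  forall f, bmf f -> Phi f = Psi f.
Proof.
move=> [lPhi mPhi] [lPsi mPsi] PP.
have c0 : bmf (fun _ : T => 0 : R) by exact: bmf_cst.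
have c1 : bmf (fun _ : T => 1 : R) by exact: bmf_cst.
have sc (F : (T -> R) -> R) (lF : forall a f g, bmf f -> bmf g ->
     F (fun x => a * f x + g x) = a * F f + F g) a f : bmf f ->
     F (fun x => a * f x) = a * F f.
  move=> bf; have F0 : F (fun=> 0) = 0.
    have := lF 1 _ _ c0 c0; under eq_fun do rewrite mul1r addr0.
    by rewrite mul1r => /eqP; rewrite -subr_eq0 opprD addNKr oppr_eq0 => /eqP.
  by have := lF a _ _ bf c0; under eq_fun do rewrite addr0; rewrite F0 addr0.
have dd (F : (T -> R) -> R) (lF : forall a f g, bmf f -> bmf g ->
     F (fun x => a * f x + g x) = a * F f + F g) f g : bmf f -> bmf g ->
     F (fun x => f x + g x) = F f + F g.
  by move=> bf bg; have := lF 1 _ _ bf bg; under eq_fun do rewrite mul1r; rewrite mul1r.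
have P1 : Phi (fun=> 1) = Psi (fun=> 1).
  by have := PP setT measurableT; under eq_fun do rewrite in_setT.
have sums n (F : nat -> T -> R) : (forall k, bmf (F k)) ->
    (forall k, Phi (F k) = Psi (F k)) ->
    Phi (fun x => \sum_(k < n) F k x) = Psi (fun x => \sum_(k < n) F k x).
  move=> bF eF; elim: n => [|n IH].
    under eq_fun do rewrite big_ord0.
    have -> : (fun=> 0) = (fun _ : T => 0 * (1 : R)).
      by apply/funext => x; rewrite mul0r.
    by rewrite !sc// P1.
  under eq_fun do rewrite big_ord_recr/=.
  rewrite (dd _ lPhi)//; last exact: bmf_sum.
  rewrite (dd _ lPsi)//; last exact: bmf_sum.
  by rewrite IH eF.
have P01 g : bmf g -> (forall x, 0 <= g x <= 1) -> Phi g = Psi g.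
  move=> bg g01; apply/eqP; rewrite -subr_eq0 -normr_eq0; apply/eqP/le_anti.
  rewrite normr_ge0 andbT; apply/ler_addgt0Pr => e e0; rewrite add0r.
  pose C := `|Phi (fun=> 1)| + 1.
  have C0 : 0 < C by rewrite ltr_pwDr.
  have [n ne] : exists n, n.+1%:R^-1 * C <= e.
    exists (Num.truncn (C / e)); rewrite mulrC ler_pdivrMr// mulrC -ler_pdivrMr//.
    by rewrite ltW// truncnS_gt.
  apply: le_trans ne.
  pose s x := indicator_mean n (g x).
  have bk k : bmf (fun x => (k.+1%:R / n.+1%:R <= g x)%R%:R : R).
    have mA : measurable [set x | k.+1%:R / n.+1%:R <= g x].
      rewrite -[X in measurable X]setTI.
      by apply: measurable_fun_le => //; case: bg.
    have := bmf_indic R mA.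
    by under eq_fun do rewrite mem_setE.
  have bs : bmf s by apply: bmfZ; exact: (bmf_sum _ bk).
  have es : Phi s = Psi s.
    rewrite /s /indicator_mean !sc//; try exact: (bmf_sum _ bk).
    congr (_ * _).
    apply: (sums _ (fun k x => (k.+1%:R / n.+1%:R <= g x)%R%:R)) => // k.
    have mA : measurable [set x | k.+1%:R / n.+1%:R <= g x].
      rewrite -[X in measurable X]setTI.
      by apply: measurable_fun_le => //; case: bg.
    by have := PP _ mA; under eq_fun do rewrite mem_setE.
  have bsn : bmf (fun x => n.+1%:R^-1 * 1 + s x).
    by apply: bmfD => //; exact: bmf_cst.
  have main F : positive_functional F -> F (fun=> 1) = Phi (fun=> 1) ->
      F s = Phi s -> Phi s <= F g <= Phi s + n.+1%:R^-1 * C.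
    move=> [lF mF] F1 Fs; apply/andP; split.
      by rewrite -Fs mF// => x; have /andP[] := indicator_mean_approx n (g01 x).
    apply: (@le_trans _ _ (F (fun x => n.+1%:R^-1 * 1 + s x))).
      apply: mF => // x; have /andP[_] := indicator_mean_approx n (g01 x).
      by rewrite mulr1 addrC.
    rewrite lF// F1 Fs addrC lerD2l ler_wpM2l// /C.
    by rewrite (le_trans (ler_norm _))// lerDl.
  have /andP[h1 h2] := main Phi (conj lPhi mPhi) erefl erefl.
  have /andP[h3 h4] := main Psi (conj lPsi mPsi) (esym P1) (esym es).
  move: (_ * C) h1 h2 h3 h4 => u h1 h2 h3 h4.
  by rewrite ler_norml; apply/andP; split; lra.
move=> f bf; have [mf [M hM]] := bf.
pose M' := `|M| + 1; have M0 : 0 < M' by rewrite ltr_pwDr.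
have fM x : - M' <= f x <= M'.
  rewrite -ler_norml (le_trans (hM x))// (le_trans (ler_norm _))//.
  by rewrite lerDl.
(* With this scaling a f + 1/2 takes values in [0,1]. *)
pose a := (2 * M')^-1; have a0 : 0 < a by rewrite invr_gt0 mulr_gt0.
have bh : bmf (fun _ : T => 2^-1 : R) by exact: bmf_cst.
have eg : Phi (fun x => a * f x + 2^-1) = Psi (fun x => a * f x + 2^-1).
  apply: P01 => [|x]; first by apply: bmfD => //; exact: bmfZ.
  have /andP[f1 f2] := fM x.
  have aM : a * M' = 2^-1 by rewrite /a; field; rewrite gt_eqF.
  have := ler_wpM2l (ltW a0) f1; have := ler_wpM2l (ltW a0) f2.
  by rewrite mulrN aM => ? ?; lra.
have eh : Phi (fun=> 2^-1) = Psi (fun=> 2^-1).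
  have -> : (fun=> 2^-1) = (fun _ : T => 2^-1 * (1 : R)).
    by apply/funext => x; rewrite mulr1.
  by rewrite !sc// P1.
move: eg; rewrite lPhi// lPsi// eh => /addIr.
by apply: mulfI; rewrite gt_eqF.
Qed.

Lemma Ex_positive_functional (P : probability T R) :
  positive_functional (fun f => \int[P]_x f x).
Proof.
split=> [a f g bf bg|f g bf bg fg]; last exact: Ex_le.
by rewrite Ex_D ?Ex_Z//; exact: bmfZ.
Qed.

End positive_functionals.

Lemma bmf_ge (R : realType) (a : R) : bmf (fun t : measurableTypeR R => (a <= `|t|)%R%:R : R).
Proof.
have mA : measurable [set t : measurableTypeR R | a <= `|t|].
  rewrite -[X in measurable X]setTI.
  by apply: measurable_fun_le => //; exact: measurableT_comp.
by have := bmf_indic R mA; under eq_fun do rewrite mem_setE.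
Qed.

(** * Exponential times *)

Section exponential_law.
Context {R : realType}.
Local Notation leb := (@lebesgue_measure R).
Implicit Types (f phi : measurableTypeR R -> R) (q : R).

(** The Dirac mass makes this a probability for every real q, so that no proof of positivity is
    carried along. The law lives on the whole line; integrands are written with [|t|], which is an
    admissible time at every point and not just almost everywhere. *)
Definition explaw q : probability (measurableTypeR R) R :=
  match pselect (0 < q) with
  | left q0 =>
      exponential_distribution_exponential_prob__canonical__probability_measure_Probability q0
  | right _ => dirac (0 : measurableTypeR R)
  end.

Lemma explawE q A : 0 < q ->
  explaw q A = (\int[leb]_(x in A) (exponential_pdf q x)%:E)%E.
Proof. by move=> q0; rewrite /explaw; case: pselect. Qed.

Lemma integrable_pdfM q f : 0 < q -> bmf f ->
  leb.-integrable setT (EFin \o (fun t => exponential_pdf q t * f t)).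
Proof.
move=> q0 [mf [M hM]].
have mg := measurable_exponential_pdf q.
apply: (@le_integrable _ _ _ leb setT measurableT _
  (EFin \o (fun t => M * exponential_pdf q t))).
- by apply/measurable_EFinP; exact: measurable_funM.
- move=> t _ /=; rewrite lee_fin !normrM mulrC.
  have p0 := exponential_pdf_ge0 (ltW q0) t.
  by rewrite ler_wpM2r// (le_trans (hM t))// ler_norm.
- have := @integrable_exponential_pdf R q q0.
  by move=> /(integrableZl measurableT M); under eq_fun do rewrite /= -EFinM.
Qed.

Lemma explaw_integral q f : 0 < q -> bmf f ->
  \int[explaw q]_t f t = \int[leb]_t (exponential_pdf q t * f t).
Proof.
move=> q0; apply: (@positive_functional_eq _ _ _ (fun f => \int[explaw q]_t f t)
  (fun f => \int[leb]_t (exponential_pdf q t * f t))).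
- exact: Ex_positive_functional.
- split=> [a f' g bf bg|f' g bf bg fg].
    rewrite -RintegralZl//; last exact: integrable_pdfM.
    rewrite -RintegralD//; last 2 first.
    + have := integrableZl measurableT a (integrable_pdfM q0 bf).
      by under eq_fun do rewrite /= -EFinM.
    + exact: integrable_pdfM.
    by apply: eq_Rintegral => t _; ring.
  apply: le_Rintegral => //; try exact: integrable_pdfM.
  by move=> t _; rewrite ler_wpM2l// exponential_pdf_ge0// ltW.
- move=> A mA; rewrite Ex_indic// explawE// integral_mkcond; congr fine.
  apply: eq_integral => t _; rewrite patchE.
  by case: ifPn => tA; rewrite ?mulr1 ?mulr0.
Qed.

Lemma lebesgue_translation (s : R) (A : set (measurableTypeR R)) : measurable A ->
  leb ((fun t => s + t) @^-1` A) = leb A.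
Proof.
move=> mA.
pose sh : measurableTypeR R -> measurableTypeR R := fun t => s + t.
have mD : measurable_fun [set: measurableTypeR R] sh by apply: measurable_funD.
apply/esym.
pose nu : {measure set (measurableTypeR R) -> \bar R} := pushforward leb sh.
rewrite [RHS](_ : _ = nu mD A)//.
apply: lebesgue_measure_unique => // X [[a b] /= _ <-].
rewrite /nu /= /pushforward.
have -> : (fun t => s + t) @^-1` `]a, b] = `]a - s, b - s]%classic.
  by apply/seteqP; split=> t /=; rewrite !in_itv/= ltrBlDl lerBrDl.
rewrite !lebesgue_measure_itv/= !lte_fin ltrD2r.
by case: ifP => // _; rewrite -!EFinB; congr EFin; ring.
Qed.

Lemma Rintegral_translation (s : R) f :
  leb.-integrable setT (EFin \o f) ->
  leb.-integrable setT (EFin \o (fun t => f (s + t))) ->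
  \int[leb]_t f (s + t) = \int[leb]_t f t.
Proof.
move=> intf intfs; congr fine.
pose sh : measurableTypeR R -> measurableTypeR R := fun t => s + t.
have mD : measurable_fun [set: measurableTypeR R] sh by apply: measurable_funD.
pose nu : {measure set (measurableTypeR R) -> \bar R} := pushforward leb sh.
transitivity (\int[nu mD]_t (f t)%:E)%E.
  rewrite (@integral_pushforward _ _ _ _ _ _ mD leb _ (EFin \o f))//.
  exact: measurable_int intf.
by apply: eq_measure_integral => B mB _; exact: lebesgue_translation.
Qed.

(** The memoryless property: the event T >= s has probability e^(-qs), and given it T - s is again
    exponential of rate q. *)
Lemma explaw_shift q (s : R) phi : 0 < q -> 0 <= s ->
  bmf (fun t : measurableTypeR R => phi `|t|) ->
  expR (- (q * s)) * \int[explaw q]_t phi (s + `|t|) =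
  \int[explaw q]_t ((s <= `|t|)%R%:R * phi `|t|).
Proof.
move=> q0 s0 bphi.
have ms : measurable_fun [set: measurableTypeR R] (fun t : measurableTypeR R => s + `|t|).
  by apply: measurable_funD => //; exact: measurableT_comp.
have bs : bmf (fun t : measurableTypeR R => phi (s + `|t|)).
  have := bmf_comp bphi ms; congr bmf; apply/funext => t.
  by rewrite ger0_norm// addr_ge0.
have bi := bmf_ge s.
have bip : bmf (fun t : measurableTypeR R => (s <= `|t|)%R%:R * phi `|t|).
  exact: bmfM.
rewrite !explaw_integral// -RintegralZl//; last exact: integrable_pdfM.
(* For t < 0 both sides vanish: the right one because of the density if s + t < 0, and because of
   the indicator if 0 <= s + t < s. *)
have eG t : expR (- (q * s)) * (exponential_pdf q t * phi (s + `|t|)) =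
    exponential_pdf q (s + t) * ((s <= `|s + t|)%R%:R * phi `|s + t|).
  have [t0|t0] := leP 0 t.
    rewrite !exponential_pdfE ?addr_ge0// !ger0_norm ?addr_ge0// lerDl t0 mul1r.
    rewrite (_ : - q * (s + t) = - (q * s) + - q * t); last by ring.
    by rewrite expRD; ring.
  rewrite lt0_exponential_pdf// mul0r mulr0.
  have [st0|st0] := ltP (s + t) 0; first by rewrite lt0_exponential_pdf// mul0r.
  by rewrite ger0_norm// lerDl leNgt t0 mul0r mulr0.
under eq_Rintegral do rewrite eG.
have := integrable_pdfM q0 bip.
move=> intG; apply: (@Rintegral_translation s
  (fun t => exponential_pdf q t * ((s <= `|t|)%R%:R * phi `|t|))) => //.
have := integrableZl measurableT (expR (- (q * s))) (integrable_pdfM q0 bs).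
by apply: eq_integrable => // t _ /=; rewrite -EFinM eG.
Qed.

Lemma explaw_tail q (s : R) : 0 < q -> 0 <= s ->
  \int[explaw q]_t (s <= `|t|)%R%:R = expR (- (q * s)).
Proof.
move=> q0 s0; have := @explaw_shift q s (fun=> 1) q0 s0 (bmf_cst _ _).
by rewrite Ex_cst mulr1 => ->; apply: eq_Rintegral => t _; rewrite mulr1.
Qed.

(** The law of rate c q has density c e^(-(c-1)qt) with respect to that of rate q. This brings
    resolvents of different rates under a single law. *)
Lemma explaw_scale q (c : R) f : 0 < q -> 1 <= c -> bmf f ->
  \int[explaw (c * q)]_t f t =
  c * \int[explaw q]_t (expR (- ((c - 1) * q * `|t|)) * f t).
Proof.
move=> q0 c1 bf; have c0 : 0 < c by rewrite (lt_le_trans _ c1).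
have be : bmf (fun t : measurableTypeR R => expR (- ((c - 1) * q * `|t|))).
  split.
    apply: measurableT_comp => //; apply: measurableT_comp => //.
    by apply: measurable_funM => //; exact: measurableT_comp.
  exists 1 => t; rewrite ger0_norm ?expR_ge0// -[leRHS]expR0 ler_expR oppr_le0.
  by rewrite !mulr_ge0// ?subr_ge0// ltW.
have bef := bmfM be bf.
rewrite !explaw_integral// ?mulr_gt0// -RintegralZl//; last exact: integrable_pdfM.
apply: eq_Rintegral => t _.
have [t0|t0] := ltP t 0; first by rewrite !lt0_exponential_pdf// !mul0r mulr0.
rewrite !exponential_pdfE// ger0_norm//.
rewrite (_ : - (c * q) * t = - q * t + - ((c - 1) * q * t)); last by ring.
by rewrite expRD; ring.
Qed.

Lemma explaw_discounted q phi : 0 < q ->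
  bmf (fun t : measurableTypeR R => phi `|t|) ->
  q * \int[leb]_(t in `[0, +oo[) (expR (- (q * t)) * phi t) =
  \int[explaw q]_t phi `|t|.
Proof.
move=> q0 bphi; rewrite explaw_integral//.
rewrite [in LHS]Rintegral_mkcond.
have eG t : q * ((fun t => expR (- (q * t)) * phi t) \_ `[0, +oo[) t =
    exponential_pdf q t * phi `|t|.
  rewrite patchE; case: ifPn => [|/negP].
    rewrite inE/= in_itv/= andbT => t0; rewrite exponential_pdfE// ger0_norm//.
    by rewrite mulNr; ring.
  rewrite inE/= in_itv/= andbT => /negP; rewrite -ltNge => t0.
  by rewrite lt0_exponential_pdf// mul0r mulr0.
rewrite -RintegralZl//; first by apply: eq_Rintegral => t _; exact: eG.
have := integrableZl measurableT (q^-1) (integrable_pdfM q0 bphi).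
by apply: eq_integrable => // t _ /=; rewrite -EFinM -eG mulKf// gt_eqF.
Qed.

End exponential_law.

(** * Joint measurability of right-continuous families *)

Section right_continuous_measurable.
Context d (T : measurableType d) (R : realType).

(** Such a family is the pointwise limit of its values at the next point of a time grid, and each
    approximation is glued from countably many measurable rectangles. *)
Lemma right_continuous_joint_measurable (phi : R -> T -> R) :
  (forall t, 0 <= t -> measurable_fun [set: T] (phi t)) ->
  (forall w t, 0 <= t -> phi s w @[s --> t^'+] --> phi t w) ->
  measurable_fun [set: measurableTypeR R * T] (fun z => phi `|z.1| z.2).
Proof.
move=> mphi cphi.
(* The shift to k+1 places the grid point strictly to the right of the time, which is what a limit
   from the right requires. *)
pose g (n k : nat) : R := k.+1%:R / n.+1%:R.
pose k (n : nat) (t : R) := Num.truncn (`|t| * n.+1%:R).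
pose F (n : nat) (z : measurableTypeR R * T) := phi (g n (k n z.1)) z.2.
apply: (@measurable_fun_cvg _ _ _ _ F).
  move=> n _ B mB; rewrite setTI.
  have -> : F n @^-1` B = \bigcup_j ([set t : measurableTypeR R | k n t = j] `*`
      (phi (g n j) @^-1` B)).
    apply/seteqP; split=> [[t w] /= Ftw|[t w] [j _ [/= <-]]//].
    by exists (k n t).
  apply: bigcupT_measurable => j; apply: measurableX; last first.
    by rewrite -[X in measurable X]setTI; apply: mphi => //; rewrite divr_ge0.
  have -> : [set t : measurableTypeR R | k n t = j] =
      [set t : measurableTypeR R | j%:R <= `|t| * n.+1%:R] `&`
      [set t : measurableTypeR R | `|t| * n.+1%:R < j.+1%:R].
    apply/seteqP; split=> t /=.
      by move=> /eqP; rewrite /k truncn_eq ?mulr_ge0// => /andP.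
    by move=> [h1 h2]; apply/eqP; rewrite /k truncn_eq ?mulr_ge0// h1.
  have ma : measurable_fun [set: measurableTypeR R]
      (fun t : measurableTypeR R => `|t| * n.+1%:R).
    by apply: measurable_funM => //; exact: measurableT_comp.
  apply: measurableI.
    by rewrite -[X in measurable X]setTI; apply: measurable_fun_le.
  rewrite (_ : [set t | _] = ~` [set t : measurableTypeR R | j.+1%:R <= `|t| * n.+1%:R]).
    apply: measurableC; rewrite -[X in measurable X]setTI.
    exact: measurable_fun_le.
  by apply/seteqP; split=> t /=; rewrite ltNge => /negP.
move=> [t w] _ /=.
have [+ _] := cvg_at_rightP (phi^~ w) `|t| (phi `|t| w).
move=> /(_ (cphi w _ (normr_ge0 t)) (fun n => g n (k n t))); apply; split.
  by move=> n; rewrite /g ltr_pdivlMr// truncnS_gt.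
apply/cvgrPdist_le => e e0; near=> n.
have h1 : `|t| < g n (k n t) by rewrite /g ltr_pdivlMr// truncnS_gt.
rewrite [`|_ - _|]ler0_norm ?subr_le0 ?(ltW h1)// opprB lerBlDl.
have : (k n t)%:R <= `|t| * n.+1%:R by rewrite /k truncn_le mulr_ge0.
rewrite -ler_pdivrMr// => h2.
rewrite /g -natr1 mulrDl lerD// div1r.
near: n; exists (Num.truncn e^-1) => // n /= hn.
rewrite invf_ple ?posrE// (le_trans (ltW (truncnS_gt _)))// ler_nat ltnS//.
Unshelve. all: by end_near. Qed.

End right_continuous_measurable.

(** * Transition functions and hitting times *)

Section cemetery_measurability.
Context (E : topologicalType) (R : realType).

Lemma sigma_algebra_cem_borel : sigma_algebra [set: option E] (@cem_borel E).
Proof.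
split=> [|B|F].
- by rewrite /cem_borel /= preimage_set0; exact: sigma_algebra0.
- rewrite /cem_borel /= => mB; rewrite setTD preimage_setC -setTD.
  exact: sigma_algebraCD.
- rewrite /cem_borel /= => mF; rewrite preimage_bigcup.
  exact: sigma_algebra_bigcup.
Qed.

Lemma measurable_cemE (B : set (cem_space E)) : measurable B = cem_borel B.
Proof.
rewrite /measurable /=.
by rewrite (sigma_algebra_id sigma_algebra_cem_borel).
Qed.

Lemma measurable_cem_fun (h : cem_space E -> R) :
  continuous (fun x : E => h (Some x)) -> measurable_fun [set: cem_space E] h.
Proof.
move=> ch.
apply: (measurability _ (RGenOpens.measurableE R)).
move=> _ [_ [a [b ->] <-]].
rewrite setTI; rewrite measurable_cemE.
apply: sub_sigma_algebra.
apply: (@open_comp _ _ (fun x : E => h (Some x))); last exact: interval_open.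
by move=> x _; exact: ch.
Qed.

Lemma bmf_cem_fun (h : cem_space E -> R) (M : R) :
  continuous (fun x : E => h (Some x)) -> (forall x, `|h x| <= M) -> bmf h.
Proof. by move=> ch hM; split; [exact: measurable_cem_fun | exists M]. Qed.

Lemma cem_ext_le (f : E -> R) (M : R) : 0 <= M ->
  (forall x, `|f x| <= M) -> forall z, `|cem_ext f z| <= M.
Proof. by move=> M0 hM [x|] //=; rewrite normr0. Qed.

End cemetery_measurability.

(** * Transition operators and the Markov property for functions *)

Section transition.
Context d (Omega : measurableType d) (R : realType) (E : topologicalType).
Variable X : process_data Omega R E.

Definition transition (t : R) (h : option E -> R) (z : option E) : R :=
  \int[law X z]_w h (position X t w).

Hypothesis mX : markov_process X.

Lemma position_measurable t : 0 <= t ->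
  measurable_fun [set: Omega] (position X t : Omega -> cem_space E).
Proof.
move=> t0 _ B; rewrite measurable_cemE setTI => mB.
by apply: (filtration_measurable mX t0); exact: (coord_adapted mX).
Qed.

Lemma bmf_position t (h : cem_space E -> R) : 0 <= t -> bmf h ->
  bmf (fun w : Omega => h (position X t w)).
Proof. by move=> t0 bh; apply: bmf_comp bh _; exact: position_measurable. Qed.

Lemma bmf_transition t (h : cem_space E -> R) : 0 <= t -> bmf h ->
  bmf (transition t h : cem_space E -> R).
Proof.
move=> t0 bh; have [mh [M hM]] := bh.
split; last by exists M => z; apply: Ex_norm => //; exact: bmf_position.
have M0 : 0 <= M by rewrite (le_trans _ (hM None)).
have mp := position_measurable t0.
pose l (z : cem_space E) :
  {measure set (cem_space E) -> \bar R} := pushforward (law X z) (position X t : Omega -> cem_space E).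
(* Kernel integrals are measurable for nonnegative integrands; M is added here and subtracted at the
   end. *)
have bhM : bmf (fun z : cem_space E => h z + M) by apply: bmfD => //; exact: bmf_cst.
have k0 z : (0 <= (h z + M)%:E)%E.
  by rewrite lee_fin -lerBlDr sub0r; have := hM z; rewrite ler_norml => /andP[].
have := @measurable_fun_integral_kernel _ _ (cem_space E) (cem_space E) R
  (l mp).
move=> /(_ _ (fun z => (h z + M)%:E) k0); have mlaw B : measurable B ->
    measurable_fun [set: cem_space E] (fun z : cem_space E => l mp z B).
  by rewrite measurable_cemE => mB; exact: (law_measurable mX).
move=> /(_ mlaw); have mhM : measurable_fun [set: cem_space E] (fun z => (h z + M)%:E).
  by apply/measurable_EFinP; case: bhM.
move=> /(_ mhM) mI.
have eI z : (\int[l mp z]_y (h y + M)%:E)%E = (transition t h z + M)%:E.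
  rewrite (@ge0_integral_pushforward _ _ _ _ _ _ mp (law X z) _ (fun y => (h y + M)%:E))//.
  have -> : transition t h z + M = \int[law X z]_w (h (position X t w) + M).
    by rewrite Ex_D ?Ex_cst//; [exact: bmf_position|exact: bmf_cst].
  rewrite fineK//; apply: integrable_fin_num => //.
  exact: (bmf_integrable (law X z) (bmf_position t0 bhM)).
have -> : transition t h = (fun z => (transition t h z + M) - M).
  by apply/funext => z; rewrite addrK.
apply: measurable_funB => //; apply/measurable_EFinP.
by have := mI; under eq_fun do rewrite eI.
Qed.

Lemma transitionZD t (a : R) (f g : cem_space E -> R) z : 0 <= t -> bmf f -> bmf g ->
  transition t (fun x => a * f x + g x) z = a * transition t f z + transition t g z.
Proof.
move=> t0 bf bg; have bf' := bmf_position t0 bf; have bg' := bmf_position t0 bg.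
by rewrite /transition Ex_D ?Ex_Z//; exact: bmfZ.
Qed.

Lemma transition_le t (f g : cem_space E -> R) z : 0 <= t -> bmf f -> bmf g ->
  (forall x, f x <= g x) -> transition t f z <= transition t g z.
Proof. by move=> t0 bf bg fg; apply: Ex_le => //; exact: bmf_position. Qed.

Lemma transition_cst t (a : R) z : transition t (fun=> a) z = a.
Proof. by rewrite /transition Ex_cst. Qed.

Lemma transition_indic t (B : set (cem_space E)) z : 0 <= t -> measurable B ->
  transition t (fun x => (x \in B)%:R) z = fine (law X z (position X t @^-1` B)).
Proof.
move=> t0 mB; rewrite -Ex_indic//.
  by rewrite -[X in measurable X]setTI; exact: position_measurable.
Qed.

Lemma markov_event z (s t : R) (A : set Omega) (h : cem_space E -> R) :
  0 <= s -> 0 <= t -> filtration X t A -> bmf h ->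
  \int[law X z]_w ((w \in A)%:R * h (position X (t + s) w)) =
  \int[law X z]_w ((w \in A)%:R * transition s h (position X t w)).
Proof.
move=> s0 t0 FA; have ts0 : 0 <= t + s by exact: addr_ge0.
have mA : measurable A by exact: (filtration_measurable mX t0).
have bA := bmf_indic R mA.
apply: (@positive_functional_eq _ (cem_space E) R
  (fun h => \int[law X z]_w ((w \in A)%:R * h (position X (t + s) w)))
  (fun h => \int[law X z]_w ((w \in A)%:R * transition s h (position X t w)))).
- split=> [a f g bf bg|f g bf bg fg].
    rewrite -Ex_Z; last by apply: bmfM => //; exact: bmf_position.
    rewrite -Ex_D; last 2 first.
    + by apply: bmfZ; apply: bmfM => //; exact: bmf_position.
    + by apply: bmfM => //; exact: bmf_position.
    by apply: eq_Rintegral => w _; ring.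
  apply: Ex_le; try by apply: bmfM => //; exact: bmf_position.
  by move=> w; rewrite ler_wpM2l.
- split=> [a f g bf bg|f g bf bg fg].
    have bf' := bmf_transition s0 bf; have bg' := bmf_transition s0 bg.
    rewrite -Ex_Z; last by apply: bmfM => //; exact: bmf_position.
    rewrite -Ex_D; last 2 first.
    + by apply: bmfZ; apply: bmfM => //; exact: bmf_position.
    + by apply: bmfM => //; exact: bmf_position.
    by apply: eq_Rintegral => w _; rewrite transitionZD//; ring.
  have bf' := bmf_transition s0 bf; have bg' := bmf_transition s0 bg.
  apply: Ex_le; try by apply: bmfM => //; exact: bmf_position.
  by move=> w; rewrite ler_wpM2l// transition_le.
- move=> B mB; have mB' : cem_borel B by rewrite -measurable_cemE.
  have mXB : measurable (position X (t + s) @^-1` B).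
    by rewrite -[X in measurable X]setTI; exact: position_measurable.
  transitivity (fine (law X z (A `&` position X (t + s) @^-1` B))).
    rewrite -Ex_indic; last exact: measurableI.
    apply: eq_Rintegral => w _; rewrite -natrM mulnb; congr (nat_of_bool _)%:R.
    by rewrite in_setI; congr (_ && _); apply/idP/idP; rewrite !inE.
  rewrite (markov_property mX)// integral_mkcond; congr fine.
  apply: eq_integral => w _; rewrite transition_indic// EFinM.
  rewrite patchE; case: ifPn => wA; rewrite ?mul1e ?mul0e//.
  by rewrite fineK// fin_num_measure//; rewrite -[X in measurable X]setTI; exact: position_measurable.
Qed.

Lemma measurable_filtrationE t (A : set (g_sigma_algebraType (filtration X t))) :
  0 <= t -> measurable A = filtration X t A.
Proof.
move=> t0; rewrite /measurable /=.
by rewrite (sigma_algebra_id (filtration_sigma_algebra mX t0)).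
Qed.

Lemma measurable_fun_filtration t (Z : g_sigma_algebraType (filtration X t) -> R) :
  0 <= t -> bmf Z -> bmf (Z : Omega -> R).
Proof.
move=> t0 [mZ hZ]; split=> // _ B mB.
have := mZ measurableT B mB; rewrite !setTI measurable_filtrationE//.
exact: (filtration_measurable mX t0).
Qed.

Lemma bmf_filtration_position s t (h : cem_space E -> R) : 0 <= s -> s <= t -> bmf h ->
  bmf (fun w : g_sigma_algebraType (filtration X t) => h (position X s w)).
Proof.
move=> s0 st bh; have t0 := le_trans s0 st.
apply: (bmf_comp (g := (position X s : g_sigma_algebraType (filtration X t) -> cem_space E)) bh).
move=> _ B; rewrite measurable_cemE setTI => mB.
rewrite measurable_filtrationE//.
by apply: (filtration_nondecreasing mX s0 st); exact: (coord_adapted mX).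
Qed.

(** Second extension of the Markov property: the test function having been treated for events A of
    the past, both sides are now compared as functionals of the weight Z. *)
Lemma markov_functional z (s t : R) (Z : Omega -> R) (h : cem_space E -> R) :
  0 <= s -> 0 <= t -> bmf (Z : g_sigma_algebraType (filtration X t) -> R) -> bmf h ->
  \int[law X z]_w (Z w * h (position X (t + s) w)) =
  \int[law X z]_w (Z w * transition s h (position X t w)).
Proof.
move=> s0 t0 bZ bh; have ts0 : 0 <= t + s by exact: addr_ge0.
have bt := bmf_transition s0 bh.
have [_ [M hM]] := bh.
have hpos (h' : cem_space E -> R) u : 0 <= u -> bmf h' -> (forall x, 0 <= h' x) ->
  positive_functional (fun Z : g_sigma_algebraType (filtration X t) -> R =>
    \int[law X z]_w (Z w * h' (position X u w))).
  move=> u0 bh' h0; split=> [a f g bf bg|f g bf bg fg].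
    have bf' := measurable_fun_filtration t0 bf; have bg' := measurable_fun_filtration t0 bg.
    rewrite -Ex_Z; last by apply: bmfM => //; exact: bmf_position.
    rewrite -Ex_D; last 2 first.
    + by apply: bmfZ; apply: bmfM => //; exact: bmf_position.
    + by apply: bmfM => //; exact: bmf_position.
    by apply: eq_Rintegral => w _; ring.
  have bf' := measurable_fun_filtration t0 bf; have bg' := measurable_fun_filtration t0 bg.
  apply: Ex_le; try by apply: bmfM => //; exact: bmf_position.
  by move=> w; rewrite ler_wpM2r.
have bc : bmf (fun _ : cem_space E => M) by exact: bmf_cst.
(* As a functional of Z the integral is monotone only against a nonnegative function, hence the
   shift by M; the factor 1 fits [transitionZD]. *)
have b1 : bmf (fun x : cem_space E => 1 * h x + M).
  by apply: bmfD => //; exact: bmfZ.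
have p1 x : 0 <= 1 * h x + M.
  by rewrite mul1r -lerBlDr sub0r; have := hM x; rewrite ler_norml => /andP[].
have bZ' := measurable_fun_filtration t0 bZ.
have : \int[law X z]_w (Z w * (1 * h (position X (t + s) w) + M)) =
  \int[law X z]_w (Z w * transition s (fun x => 1 * h x + M) (position X t w)).
  apply: (@positive_functional_eq _ (g_sigma_algebraType (filtration X t)) R
    (fun Z => \int[law X z]_w (Z w * (1 * h (position X (t + s) w) + M)))
    (fun Z => \int[law X z]_w (Z w * transition s (fun x => 1 * h x + M) (position X t w)))) => //.
  - exact: (hpos (fun x => 1 * h x + M)).
  - apply: hpos => //; first exact: bmf_transition.
    by move=> x; apply: Ex_ge_cst => //; exact: (bmf_position s0 b1).
  - move=> A; rewrite measurable_filtrationE// => FA.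
    exact: (@markov_event z s t A (fun x => 1 * h x + M)).
have e1 : \int[law X z]_w (Z w * (1 * h (position X (t + s) w) + M)) =
    \int[law X z]_w (Z w * h (position X (t + s) w)) + \int[law X z]_w (M * Z w).
  rewrite -Ex_D; last 2 first.
  - by apply: bmfM => //; exact: bmf_position.
  - exact: bmfZ.
  by apply: eq_Rintegral => w _; ring.
have e2 : \int[law X z]_w (Z w * transition s (fun x => 1 * h x + M) (position X t w)) =
    \int[law X z]_w (Z w * transition s h (position X t w)) + \int[law X z]_w (M * Z w).
  rewrite -Ex_D; last 2 first.
  - by apply: bmfM => //; exact: bmf_position.
  - exact: bmfZ.
  by apply: eq_Rintegral => w _; rewrite transitionZD// transition_cst; ring.
by rewrite e1 e2 => /addIr.
Qed.

Lemma transition_add (s t : R) (h : cem_space E -> R) z : 0 <= s -> 0 <= t -> bmf h ->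
  transition (t + s) h z = transition t (transition s h) z.
Proof.
move=> s0 t0 bh; have := @markov_functional z s t (fun=> 1) h s0 t0 (bmf_cst _ _) bh.
rewrite /transition => e; transitivity (\int[law X z]_w (1 * h (position X (t + s) w))).
  by apply: eq_Rintegral => w _; rewrite mul1r.
by rewrite e; apply: eq_Rintegral => w _; rewrite mul1r.
Qed.

Hypothesis nX : normal_process X.

Hypothesis hE : hausdorff_space E.

Lemma measurable_cem_set1 (z : option E) : measurable ([set z] : set (cem_space E)).
Proof.
rewrite measurable_cemE /cem_borel /=; case: z => [x|].
  rewrite (_ : Some @^-1` [set Some x] = [set x]); last first.
    by apply/seteqP; split=> y /= => [[]|->].
  rewrite -[X in <<s _ >> X]setCK -setTD; apply: sigma_algebraCD.
  apply: sub_sigma_algebra; apply: closed_openC.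
  exact: accessible_closed_set1 (hausdorff_accessible hE) _.
rewrite (_ : Some @^-1` [set None] = set0); first exact: sigma_algebra0.
by apply/seteqP; split=> y.
Qed.

Lemma start_null z : measurable (~` [set w | position X 0 w = z]) /\
  law X z (~` [set w | position X 0 w = z]) = 0%E.
Proof.
have m0 : measurable [set w | position X 0 w = z].
  rewrite -[X in measurable X]setTI.
  exact: (position_measurable (lexx 0) measurableT (measurable_cem_set1 z)).
split; first exact: measurableC.
by rewrite probability_setC// nX subee.
Qed.

Lemma transition0 (h : cem_space E -> R) z : bmf h -> transition 0 h z = h z.
Proof.
move=> bh; have [mN N0] := start_null z.
rewrite -[RHS](Ex_cst (law X z)); apply: (Ex_ae mN N0) => //.
- by case: (bmf_position (lexx 0) bh).
- by move=> w /contrapT ->.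
Qed.

Lemma transition_None t (h : cem_space E -> R) : 0 <= t -> bmf h ->
  transition t h None = h None.
Proof.
move=> t0 bh; have [mN N0] := start_null None.
rewrite -[RHS](Ex_cst (law X None)); apply: (Ex_ae mN N0) => //.
- by case: (bmf_position t0 bh).
- by move=> w /contrapT h0; rewrite (coord_absorbed mX _ t0 h0).
Qed.

End transition.

Section extended_real_measurability.
Context d (T : measurableType d) (R : realType).

Lemma measurable_fun_ltrays (f : T -> \bar R) :
  (forall t : R, measurable [set w | (f w < t%:E)%E]) -> measurable_fun [set: T] f.
Proof.
move=> mf; apply: (measurability _ (ErealGenInftyO.measurableE R)) => //.
move=> _ [_ [r ->] <-]; rewrite setTI.
by rewrite (_ : f @^-1` _ = [set w | (f w < r%:E)%E])//; apply/seteqP; split=> w /=; rewrite in_itv.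
Qed.

Lemma measurable_fun_lerays (f : T -> \bar R) :
  (forall t : R, measurable [set w | (f w <= t%:E)%E]) -> measurable_fun [set: T] f.
Proof.
move=> mf; apply: (measurability _ (ErealGenOInfty.measurableE R)) => //.
move=> _ [_ [r ->] <-]; rewrite setTI.
rewrite (_ : f @^-1` _ = ~` [set w | (f w <= r%:E)%E]); first exact: measurableC.
apply/seteqP; split=> w /=; rewrite in_itv/= andbT ltNge; first by move=> /negP.
by move=> h; apply/negP.
Qed.

End extended_real_measurability.

(** * Entrance and hitting times *)

Section rational_hitting_times.
Context d (Omega : measurableType d) (R : realType) (E : topologicalType).
Variables (X : process_data Omega R E) (cem : set_system (option E)).

Lemma almost_surelyI (P Q : Omega -> Prop) :
  almost_surely X P -> almost_surely X Q -> almost_surely X (fun w => P w /\ Q w).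
Proof.
move=> [N [mN N0 hN]] [M [mM M0 hM]]; exists (N `|` M); split.
- exact: measurableU.
- move=> x; apply/eqP; rewrite eq_le measure_ge0 andbT.
  rewrite (le_trans (measureU2 _ mN mM))//.
  by rewrite [X in (X + _)%E](N0 x) [X in (_ + X)%E](M0 x) adde0.
- by move=> w /not_orP[/hN ? /hM ?].
Qed.

Lemma almost_surely_all (P : nat -> Omega -> Prop) :
  (forall n, almost_surely X (P n)) -> almost_surely X (fun w => forall n, P n w).
Proof.
move=> /choice[N hN]; exists (\bigcup_n N n); split.
- by apply: bigcupT_measurable => n; case: (hN n).
- move=> x; apply/negligibleP.
    by apply: bigcupT_measurable => n; case: (hN n).
  apply: negligible_bigcup => n; have [mN N0 _] := hN n.
  by apply/negligibleP => //; exact: N0.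
- move=> w hw n; have [_ _] := hN n; apply => Nw.
  by apply: hw; exists n.
Qed.

Lemma almost_surely_mono (P Q : Omega -> Prop) : (forall w, P w -> Q w) ->
  almost_surely X P -> almost_surely X Q.
Proof. by move=> PQ [N [mN N0 hN]]; exists N; split=> // w /hN /PQ. Qed.

(** For U open and a right-continuous path this is the entrance time into U after eps, and a
    countable set of times keeps it measurable. A positive eps is used to approximate hitting times,
    which only count times t > 0. *)
Definition rational_hitting (eps : R) (U : set E) (w : Omega) : \bar R :=
  ereal_inf (EFin @` [set r | [/\ eps <= r, exists q : rat, r = ratr q &
                                  (Some @` U) (position X r w)]]).

Definition right_continuous_at (w : Omega) := forall t : R, 0 <= t ->
  position X s w @[s --> t^'+] `=>` cem_nbhs cem (position X t w).

Lemma rational_hitting_ge eps U w : (eps%:E <= rational_hitting eps U w)%E.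
Proof. by apply: le_ereal_inf_tmp => _ [r [er _ _] <-]; rewrite lee_fin. Qed.

Lemma rational_hitting_ltP eps U w (t : R) : (rational_hitting eps U w < t%:E)%E <->
  exists q : rat, [/\ eps <= ratr q, ratr q < t & (Some @` U) (position X (ratr q) w)].
Proof.
split=> [/ereal_inf_lt[_ [r [er [q rq] qU] <-]]|[q [eq qt qU]]].
  by rewrite lte_fin => qt; exists q; rewrite -rq.
rewrite (@le_lt_trans _ _ (ratr q)%:E)//.
by apply: ereal_inf_lbound; exists (ratr q) => //; split=> //; exists q.
Qed.

Lemma rational_hitting_mono eps (U V : set E) w : U `<=` V ->
  (rational_hitting eps V w <= rational_hitting eps U w)%E.
Proof.
move=> UV; apply: ereal_inf_le_tmp => _ [r [er rq [x Ux xr]] <-].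
by exists r => //; split=> //; exists x => //; exact: UV.
Qed.

Hypothesis sX : standard_process X cem.
Let mX : markov_process X := standard_markov sX.

(** Completeness of the filtration: A differs from the empty set by a set that is null for every
    initial law. *)
Lemma null_subset_filtration (Q : Omega -> Prop) (A : set Omega) (t : R) :
  almost_surely X Q -> A `<=` [set w | ~ Q w] -> 0 <= t -> filtration X t A.
Proof.
move=> [N [mN N0 hN]] AQ t0; apply: (standard_complete_filtration sX) => // mu.
exists set0.
  by have [+ _ _] := filtration_sigma_algebra mX t0.
exists N; split=> //.
  by rewrite setD0 set0D setU0 => w /AQ nQ; apply: contrapT => /hN.
by exists set0; split=> // x /=; rewrite N0 eqxx.
Qed.

Lemma null_subset_measurable (Q : Omega -> Prop) (A : set Omega) :
  almost_surely X Q -> A `<=` [set w | ~ Q w] -> measurable A.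
Proof.
move=> aQ AQ; apply: (filtration_measurable mX (lexx 0)).
exact: null_subset_filtration aQ AQ (lexx 0).
Qed.

Lemma almost_surely_measurable (A B : set Omega) : measurable B ->
  almost_surely X (fun w => A w <-> B w) -> measurable A.
Proof.
move=> mB [N [mN N0 hN]].
have -> : A = (B `\` N) `|` (A `&` N).
  apply/seteqP; split=> [w Aw|w [[Bw Nw]|[]//]]; last exact/(hN w Nw).
  have [Nw|Nw] := pselect (N w); first by right.
  by left; split=> //; exact/(hN w Nw).
apply: measurableU; first exact: measurableD.
apply: (@null_subset_measurable (fun w => ~ N w)); first by exists N; split.
by move=> w [_ Nw]; exact.
Qed.

Lemma law_almost_surely (A B : set Omega) x : measurable A -> measurable B ->
  almost_surely X (fun w => A w -> B w) -> (law X x A <= law X x B)%E.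
Proof.
move=> mA mB [N [mN N0 hN]].
apply: (@le_trans _ _ (law X x (B `|` N))).
  apply: le_measure; rewrite ?inE//; first exact: measurableU.
  move=> w Aw; have [Nw|Nw] := pselect (N w); first by right.
  by left; exact: hN.
by rewrite (le_trans (measureU2 _ mB mN))//= [X in (_ + X)%E](N0 x) adde0.
Qed.

Lemma almost_surely_right_continuous : almost_surely X right_continuous_at.
Proof. exact: (standard_right_continuous_paths sX). Qed.

Lemma right_continuous_nbhs w (t : R) y (V : set E) : right_continuous_at w ->
  0 <= t -> position X t w = Some y -> nbhs y V ->
  exists2 e : R, 0 < e & forall s, t <= s < t + e -> (Some @` V) (position X s w).
Proof.
move=> rc t0 ty yV; have := rc t t0; rewrite ty /= => /(_ (Some @` V)) [].
  by apply: filterS yV => x Vx; exists x.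
move=> e /= e0 eV; exists e => // s /andP[ts se].
have [<-|ts'] := eqVneq t s; first by rewrite ty; exists y => //; exact: nbhs_singleton.
apply: eV; last by rewrite lt_neqAle ts' ts.
by rewrite /= ltr_norml; apply/andP; split; lra.
Qed.

(** Strictness comes from right continuity: a path at a point of E stays in E, hence alive, for a
    little while. *)
Lemma lifetime_gt w (t : R) y : right_continuous_at w -> 0 <= t ->
  position X t w = Some y -> (t%:E < lifetime X w)%E.
Proof.
move=> rc t0 ty; have [e e0 he] := right_continuous_nbhs rc t0 ty filterT.
apply: (@lt_le_trans _ _ (t + e)%:E); first by rewrite lte_fin ltrDl.
apply: le_ereal_inf_tmp => _ [s [s0 sN] <-]; rewrite lee_fin leNgt; apply/negP => ste.
have [st|ts] := leP s t.
  by have := coord_absorbed mX s0 st sN; rewrite ty.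
have := he s; rewrite (ltW ts) ste => /(_ isT) [z _].
by rewrite sN.
Qed.

Lemma position_before_lifetime w (t : R) : 0 <= t -> (t%:E < lifetime X w)%E ->
  exists y, position X t w = Some y.
Proof.
move=> t0 tl; case e : (position X t w) => [y|]; first by exists y.
move: tl; rewrite ltNge => /negP; case.
by apply: ereal_inf_lbound; exists t.
Qed.

Lemma rational_hitting_le_hit w eps (U : set E) (t : R) y : right_continuous_at w ->
  0 <= eps -> eps <= t -> position X t w = Some y -> nbhs y U ->
  (rational_hitting eps U w <= t%:E)%E.
Proof.
move=> rc e0 et ty yU.
have [e ep he] := right_continuous_nbhs rc (le_trans e0 et) ty yU.
apply/lee_addgt0Pr => u u0.
have [q] : exists q : rat, ratr q \in `]t, (t + Num.min e u)[.
  by apply: rat_in_itvoo; rewrite ltrDl lt_min ep u0.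
rewrite in_itv/= => /andP[tq qu].
rewrite -EFinD (@le_trans _ _ (ratr q)%:E)//; last first.
  by rewrite lee_fin ltW// (lt_le_trans qu)// lerD2l ge_min lexx orbT.
apply: ereal_inf_lbound; exists (ratr q) => //; split.
- exact: le_trans et (ltW tq).
- by exists q.
- by apply: he; rewrite (ltW tq) (lt_le_trans qu)// lerD2l ge_min lexx.
Qed.

Lemma rational_hitting_closure w eps (U : set E) (r : R) : right_continuous_at w ->
  0 <= eps -> rational_hitting eps U w = r%:E ->
  exists2 z, position X r w = Some z & closure U z.
Proof.
move=> rc e0 Dr.
have r0 : 0 <= r.
  by rewrite (le_trans e0)// -lee_fin -Dr; exact: rational_hitting_ge.
have hr (e : R) : 0 < e -> exists q : rat,
    [/\ r <= ratr q, ratr q < r + e & (Some @` U) (position X (ratr q) w)].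
  move=> ep; have : (rational_hitting eps U w < (r + e)%:E)%E.
    by rewrite Dr lte_fin ltrDl.
  move=> /rational_hitting_ltP[q [eq qe qU]]; exists q; split=> //.
  rewrite -lee_fin -Dr; apply: ereal_inf_lbound.
  by exists (ratr q) => //; split=> //; exists q.
case rz : (position X r w) => [z|]; last first.
  have [q [rq _ [x _]]] := hr 1 ltr01.
  by rewrite (coord_absorbed mX r0 rq rz).
exists z => // V zV.
have [e ep he] := right_continuous_nbhs rc r0 rz zV.
have [q [rq qe [x Ux xq]]] := hr e ep.
have := he (ratr q); rewrite rq qe => /(_ isT) [x' Vx']; rewrite -xq => -[xx'].
by exists x; split=> //; rewrite -xx'.
Qed.

(** Rational times before u decide whether T < u, so this event is in F_u; right continuity of the
    filtration then gives T <= t. *)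
Lemma stopping_time_rational_hitting eps (U : set E) : 0 <= eps -> open U ->
  stopping_time X (rational_hitting eps U).
Proof.
move=> e0 oU; split=> [w|t t0].
  by rewrite (le_trans _ (rational_hitting_ge eps U w)).
have Flt (u : R) : 0 < u -> filtration X u [set w | (rational_hitting eps U w < u%:E)%E].
  move=> u0; rewrite -(measurable_filtrationE mX _ (ltW u0)).
  have -> : [set w | (rational_hitting eps U w < u%:E)%E] =
      \bigcup_q ((if (eps <= ratr q) && (ratr q < u) then
        position X (ratr q) @^-1` (Some @` U) else set0) : set (g_sigma_algebraType (filtration X u))).
    apply/seteqP; split=> [w /= /rational_hitting_ltP[q [h1 h2 h3]]|w [q _]].
      by exists q => //; rewrite h1 h2.
    case: ifPn => // /andP[h1 h2] h3; apply/rational_hitting_ltP.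
    by exists q.
  apply: bigcupT_measurable_rat => q; case: ifPn => // /andP[h1 h2].
  rewrite measurable_filtrationE//; last exact: ltW.
  have q0 := le_trans e0 h1.
  apply: (filtration_nondecreasing mX q0 (ltW h2)); apply: (coord_adapted mX) => //.
  rewrite /cem_borel /=; apply: sub_sigma_algebra.
  rewrite (_ : Some @^-1` _ = U)//; apply/seteqP; split=> x /=.
    by move=> [y Uy [<-]].
  by move=> Ux; exists x.
(* For s > t the event T <= t is the intersection of the events T < t + (s - t)/(n+1), all of which
   belong to F_s. *)
apply: (standard_right_continuous_filtration sX) => // s ts.
have s0 : 0 <= s by rewrite (le_trans t0)// ltW.
rewrite -(measurable_filtrationE mX)//.
have st0 : 0 < s - t by rewrite subr_gt0.
have -> : [set w | (rational_hitting eps U w <= t%:E)%E] =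
    \bigcap_n [set w : g_sigma_algebraType (filtration X s) |
      (rational_hitting eps U w < (t + (s - t) / n.+1%:R)%:E)%E].
  apply/seteqP; split=> [w /= h n _ /=|w h /=].
    by rewrite (le_lt_trans h)// lte_fin ltrDl divr_gt0.
  apply/lee_addgt0Pr => u u0; rewrite -EFinD.
  pose n := Num.truncn ((s - t) / u).
  apply: ltW; rewrite (lt_le_trans (h n I))// lee_fin lerD2l ler_pdivrMr//.
  by rewrite mulrC -ler_pdivrMr// ltW// truncnS_gt.
apply: bigcapT_measurable => n; rewrite measurable_filtrationE//.
have h : 0 < t + (s - t) / n.+1%:R by rewrite ltr_wpDl// divr_gt0.
apply: (filtration_nondecreasing mX (ltW h)); last exact: Flt.
by rewrite -lerBrDl ler_pdivrMr// ler_peMr ?(ltW st0)// ler1n.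
Qed.

Lemma measurable_stopping_time T : stopping_time X T -> measurable_fun [set: Omega] T.
Proof.
move=> [T0 FT]; apply: measurable_fun_lerays => t.
have [t0|t0] := leP 0 t; first exact: (filtration_measurable mX t0 (FT _ t0)).
rewrite (_ : [set w | _] = set0)//; apply/seteqP; split=> w //= h.
by have := le_trans (T0 w) h; rewrite lee_fin leNgt t0.
Qed.

Lemma measurable_lifetime : measurable_fun [set: Omega] (lifetime X).
Proof.
apply: measurable_fun_ltrays => t.
rewrite (_ : [set w | _] = \bigcup_(q in [set: rat])
   (if (0 <= ratr q :> R) && (ratr q < t) then position X (ratr q) @^-1` [set None] else set0)).
  apply: bigcupT_measurable_rat => q; case: ifPn => // /andP[q0 _].
  apply: (filtration_measurable mX q0); apply: (coord_adapted mX) => //.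
  rewrite /cem_borel /= (_ : Some @^-1` [set None] = set0); first exact: sigma_algebra0.
  by apply/seteqP; split=> y.
apply/seteqP; split=> [w /= /ereal_inf_lt[_ [s [s0 sN] <-]]|w [q _]].
  rewrite lte_fin => st; have [q] := rat_in_itvoo st.
  rewrite in_itv/= => /andP[sq qt]; exists q => //.
  rewrite qt (le_trans s0 (ltW sq))/=.
  exact: (coord_absorbed mX s0 (ltW sq) sN).
case: ifPn => // /andP[q0 qt] qN /=.
rewrite (@le_lt_trans _ _ (ratr q)%:E)//.
by apply: ereal_inf_lbound; exists (ratr q).
Qed.

Section shrinking_open_sets.
Variables (U : nat -> set E) (eps : R).
Hypotheses (oU : forall n, open (U n)) (eps0 : 0 <= eps)
  (dU : forall m n, (m <= n)%N -> U n `<=` U m).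

Let D w := ereal_sup (range (fun n => rational_hitting eps (U n) w)).

Lemma measurable_sup_rational_hitting : measurable_fun [set: Omega] D.
Proof.
apply: measurable_fun_lerays => t.
rewrite (_ : [set w | _] = \bigcap_n [set w | (rational_hitting eps (U n) w <= t%:E)%E]).
  apply: bigcapT_measurable => n; rewrite -[X in measurable X]setTI.
  apply: emeasurable_fun_infty_c => //; apply: measurable_stopping_time.
  exact: stopping_time_rational_hitting.
apply/seteqP; split=> [w /= h n _ /=|w h /=].
  by apply: le_trans h; apply: ereal_sup_ubound; exists n.
by apply: ge_ereal_sup => _ [n _ <-]; exact: h.
Qed.

(* Quasi-left-continuity forces the path to be in the closed set at the limit
   of the entrance times into its open neighbourhoods. *)
Lemma sup_rational_hitting_closure :
  almost_surely X (fun w => (D w < lifetime X w)%E ->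
    exists2 y, position_at X (D w) w = Some y & forall n, closure (U n) y).
Proof.
have aQ := @standard_quasi_left_continuous _ _ _ _ _ _ sX
  (fun n => rational_hitting eps (U n))
  (fun n => stopping_time_rational_hitting eps0 (oU n)).
have {}aQ := aQ (fun w m n mn => rational_hitting_mono _ _ (dU mn)).
apply: almost_surely_mono (almost_surelyI almost_surely_right_continuous aQ).
move=> w [rc qlc] Dl; have := qlc Dl; rewrite -/(D w) => {}qlc.
have D0 : (0 <= D w)%E.
  apply: (@le_trans _ _ (rational_hitting eps (U 0%N) w)).
    by rewrite (le_trans _ (rational_hitting_ge _ _ _)).
  by apply: ereal_sup_ubound; exists 0%N.
move: Dl D0 qlc; case eD : (D w) => [r| |]//= rl r0; last by rewrite ltNge leey in rl.
rewrite lee_fin in r0.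
have [y ry] := position_before_lifetime r0 rl.
rewrite ry => cv; exists y => // n V yV.
have [V' [oV' V'y] V'V] : exists2 V', open_nbhs y V' & V' `<=` V by move: yV; rewrite nbhsE.
have := cv (Some @` V'); case.
  by apply: filterS (open_nbhs_nbhs (conj oV' V'y)) => x Vx; exists x.
move=> k _ hk; pose m := maxn k n.
have := hk m; rewrite /= leq_maxl => /(_ isT).
have Tm : (rational_hitting eps (U m) w <= r%:E)%E.
  by rewrite -eD; apply: ereal_sup_ubound; exists m.
have Tm0 := rational_hitting_ge eps (U m) w.
case em : (rational_hitting eps (U m) w) Tm Tm0 => [u| |]//= _ _.
have [z uz Uz] := rational_hitting_closure rc eps0 em.
rewrite uz => -[x V'x [xz]]; rewrite xz in V'x.
have [x' [Ux' V'x']] := Uz V' (open_nbhs_nbhs (conj oV' V'x)).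
exists x'; split; last exact: V'V.
by apply: dU Ux'; exact: leq_maxr.
Qed.

End shrinking_open_sets.

(** Rational times do not see visits to a closed set F. Instead, let D m be the limit of the
    entrance times after 1/(m+1) into the open sets U n shrinking to F: if D m is below the
    lifetime, quasi-left-continuity puts the path in F at time D m, and conversely a visit at time u
    bounds D m by u as soon as 1/(m+1) <= u. The two descriptions agree off a null set, which
    suffices by completeness. *)
Lemma measurable_hitting_time (F : set E) (U : nat -> set E) :
  (forall n, open (U n)) -> (forall m n, (m <= n)%N -> U n `<=` U m) ->
  (forall n, F `<=` U n) -> \bigcap_n closure (U n) `<=` F ->
  measurable_fun [set: Omega] (hitting_time X F).
Proof.
move=> oU dU FU UF; apply: measurable_fun_ltrays => t.
pose D m w := ereal_sup (range (fun n => rational_hitting m.+1%:R^-1 (U n) w)).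
have e0 m : 0 <= m.+1%:R^-1 :> R by [].
pose B := \bigcup_m ([set w | (D m w < t%:E)%E] `&` [set w | (D m w < lifetime X w)%E]).
apply: (@almost_surely_measurable _ B).
  apply: bigcupT_measurable => m; have mD := measurable_sup_rational_hitting oU (e0 m).
  apply: measurableI; rewrite -[X in measurable X]setTI.
    exact: emeasurable_fun_infty_o.
  by apply: measurable_lte => //; exact: measurable_lifetime.
have aD := almost_surely_all (fun m => sup_rational_hitting_closure oU (e0 m) dU).
apply: almost_surely_mono (almost_surelyI almost_surely_right_continuous aD).
move=> w [rc hD]; split=> /=.
  move=> /ereal_inf_lt[_ [u [u0 [y Fy yu]] <-]]; rewrite lte_fin => ut.
  pose m := Num.truncn u^-1.
  have mu : m.+1%:R^-1 <= u.
    by rewrite invf_ple ?posrE// ltW// truncnS_gt.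
  have Du : (D m w <= u%:E)%E.
    apply: ge_ereal_sup => _ [n _ <-].
    apply: (@rational_hitting_le_hit w _ _ u y) => //.
    exact: open_nbhs_nbhs (conj (oU n) (FU n _ Fy)).
  exists m => //; split=> /=; first by rewrite (le_lt_trans Du).
  by rewrite (le_lt_trans Du)// (@lifetime_gt w u y)// ltW.
move=> [m _ [/= Dt Dl]]; have [y Dy Uy] := hD m Dl.
apply: le_lt_trans Dt.
have D0 : ((m.+1%:R^-1)%:E <= D m w)%E.
  apply: (@le_trans _ _ (rational_hitting m.+1%:R^-1 (U 0%N) w)).
    exact: rational_hitting_ge.
  by apply: ereal_sup_ubound; exists 0%N.
rewrite -/(D m w) in Dy.
case: (D m w) D0 Dy => [r| |]//=; rewrite lee_fin => r0 ry.
apply: ereal_inf_lbound; exists r => //; split; first by rewrite (lt_le_trans _ r0).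
by exists y => //; apply: UF => n _; exact: Uy.
Qed.

End rational_hitting_times.

(** * Resolvents *)

Lemma right_continuous_bmf (R : realType) (phi : R -> R) (M : R) :
  (forall t, 0 <= t -> phi s @[s --> t^'+] --> phi t) -> (forall t, 0 <= t -> `|phi t| <= M) ->
  bmf (fun t : measurableTypeR R => phi `|t|).
Proof.
move=> cphi hM; split; last by exists M => t; exact: hM.
have mj := @right_continuous_joint_measurable _ unit R (fun t _ => phi t).
have {}mj := mj (fun t t0 => measurable_cst _) (fun _ t t0 => cphi t t0).
exact: (measurableT_comp mj (@measurable_pair2 _ _ (measurableTypeR R) unit tt)).
Qed.

Section time_Fubini.
Context d (T : measurableType d) (R : realType) (P Q : probability T R) (Qt : probability (measurableTypeR R) R).
Variables (phi : R -> T -> R) (N : set T) (M : R).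
Hypotheses (mN : measurable N) (PN : P N = 0%E)
  (mphi : forall t, 0 <= t -> measurable_fun [set: T] (phi t))
  (cphi : forall w t, ~ N w -> 0 <= t -> phi s w @[s --> t^'+] --> phi t w)
  (Mphi : forall t w, 0 <= t -> `|phi t w| <= M).

Let psi t w := (w \notin N)%:R * phi t w.

Let bind : bmf (fun w => (w \notin N)%:R : R).
Proof.
have := bmf_indic R (measurableC mN); congr bmf; apply/funext => w.
by rewrite in_setC.
Qed.

Let bphi t : 0 <= t -> bmf (phi t).
Proof. by move=> t0; split; [exact: mphi | exists M => w; exact: Mphi]. Qed.

(** Right continuity in time holds off N only, so the product measurability is that of phi
    multiplied by the indicator of the complement of N. The factor stays where the integral over
    paths is the outer one, since it makes the integrand measurable; where that integral is the
    inner one it disappears, N being null. *)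
Lemma time_Fubini :
  [/\ bmf (fun w => (w \notin N)%:R * \int[Qt]_t phi `|t| w),
      bmf (fun t : measurableTypeR R => \int[P]_w phi `|t| w) &
      \int[P]_w ((w \notin N)%:R * \int[Qt]_t phi `|t| w) =
      \int[Qt]_t \int[P]_w phi `|t| w].
Proof.
have bj : bmf (fun z : measurableTypeR R * T => psi `|z.1| z.2).
  split.
    apply: right_continuous_joint_measurable => [t t0|w t t0].
      by case: (bmfM bind (bphi t0)).
    rewrite /psi; case: (boolP (w \in N)) => wN /=.
      by under eq_fun do rewrite mul0r; rewrite mul0r; exact: cvg_cst.
    under eq_fun do rewrite mul1r; rewrite mul1r; apply: cphi => //.
    by rewrite -notin_setE.
  exists M => -[t w] /=; rewrite /psi normrM.
  have := Mphi w (normr_ge0 t); case: (_ \notin _); rewrite ?normr1 ?normr0 ?mul1r ?mul0r// => h.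
  by rewrite (le_trans _ h).
have bt w : bmf (fun t : measurableTypeR R => psi `|t| w).
  have [mj [M' hM']] := bj; split; last by exists M' => t; exact: (hM' (t, w)).
  exact: (measurableT_comp mj (@measurable_pair2 _ _ (measurableTypeR R) T w)).
have [b1 b2 e] := Ex_Fubini Qt P bj.
have e1 w : \int[Qt]_t psi `|t| w = (w \notin N)%:R * \int[Qt]_t phi `|t| w.
  rewrite /psi; case: (boolP (w \in N)) => wN /=.
    by under eq_Rintegral do rewrite mul0r; rewrite Ex_cst mul0r.
  by under eq_Rintegral do rewrite mul1r; rewrite mul1r.
have e2 t : \int[P]_w psi `|t| w = \int[P]_w phi `|t| w.
  apply: (Ex_ae mN PN).
  - by case: (bmfM bind (bphi (normr_ge0 t))).
  - exact: mphi.
  - by move=> w Nw; rewrite /psi (_ : w \notin N) ?mul1r// notin_setE.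
split.
- by move: b2; under eq_fun do rewrite e1.
- by move: b1; under eq_fun do rewrite e2.
- under eq_Rintegral do rewrite -e1; rewrite -e.
  by apply: eq_Rintegral => t _; rewrite e2.
Qed.

End time_Fubini.

Section mean_resolvent.
Context d (Omega : measurableType d) (R : realType) (E : topologicalType).
Variables (X : process_data Omega R E) (cem : set_system (option E)).
Hypothesis sX : standard_process X cem.
Let mX : markov_process X := standard_markov sX.
Implicit Types (h : option E -> R) (q : R).

(** The value at the cemetery is free: absorbed paths are constant there, so h is still
    right-continuous along paths. Constants and functions like |f - f(oo)|, which need not vanish at
    the cemetery, are thereby included. *)
Definition cbf h := continuous (fun x : E => h (Some x)) /\ exists M, forall z, `|h z| <= M.

Lemma transition_norm (t : R) h z (M : R) : 0 <= t -> bmf (h : cem_space E -> R) ->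
  (forall z, `|h z| <= M) -> `|transition X t h z| <= M.
Proof. by move=> t0 bh hM; apply: Ex_norm => //; exact: (bmf_position mX t0 bh). Qed.

Lemma cbf_bmf h : cbf h -> bmf (h : cem_space E -> R).
Proof. by move=> [ch [M hM]]; exact: bmf_cem_fun hM. Qed.

Lemma cbf_cem_ext (f : E -> R) : continuous f -> (exists M, forall x, `|f x| <= M) ->
  cbf (cem_ext f).
Proof.
move=> cf [M hM]; split=> //; exists `|M|.
by apply: cem_ext_le => // x; rewrite (le_trans (hM x))// ler_norm.
Qed.

Lemma cbfZD (a : R) h h' : cbf h -> cbf h' -> cbf (fun z => a * h z + h' z).
Proof.
move=> [ch [M hM]] [ch' [M' hM']]; split.
  by move=> x; apply: cvgD; [apply: cvgM; [exact: cvg_cst|exact: ch]|exact: ch'].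
exists (`|a| * M + M') => z; rewrite (le_trans (ler_normD _ _))// lerD// normrM.
by rewrite ler_wpM2l.
Qed.

Lemma cbf_cst (a : R) : cbf (fun=> a).
Proof. by split; [move=> x; exact: cst_continuous | exists `|a|]. Qed.

Lemma right_continuous_path h w t : cbf h -> right_continuous_at X cem w -> 0 <= t ->
  h (position X s w) @[s --> t^'+] --> h (position X t w).
Proof.
move=> [ch _] rc t0; case e : (position X t w) => [y|].
  have := rc t t0; rewrite e /= => cv V hV.
  exact: (cv (h @^-1` V) (ch y V hV)).
apply/cvgrPdist_le => eps eps0; near=> s.
rewrite (coord_absorbed mX t0 _ e) ?subrr ?normr0; [exact: ltW|].
by near: s; exact: nbhs_right_ge.
Unshelve. all: by end_near. Qed.

Lemma right_continuous_null : exists N : set Omega, [/\ measurable N,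
  forall x, law X x N = 0%E & forall w, ~ N w -> right_continuous_at X cem w].
Proof. exact: (standard_right_continuous_paths sX). Qed.

Lemma right_continuous_transition h z t : cbf h -> 0 <= t ->
  transition X s h z @[s --> t^'+] --> transition X t h z.
Proof.
move=> ch t0; have bh := cbf_bmf ch; have [N [mN N0 rc]] := right_continuous_null.
apply/cvg_at_rightP => u [ut cu].
have bind : bmf (fun w => (w \notin N)%:R : R).
  have := bmf_indic R (measurableC mN); congr bmf; apply/funext => w.
  by rewrite in_setC.
have u0 n : 0 <= u n by rewrite (le_trans t0)// ltW.
have e s : 0 <= s -> transition X s h z =
    \int[law X z]_w ((w \notin N)%:R * h (position X s w)).
  move=> s0; apply: (Ex_ae mN (N0 z)).
  - by case: (bmf_position mX s0 bh).
  - by case: (bmfM bind (bmf_position mX s0 bh)).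
  - by move=> w Nw; rewrite (_ : w \notin N) ?mul1r// notin_setE.
rewrite e//; under eq_fun do rewrite e//.
have [_ [M hM]] := ch.
have := @Ex_dominated _ _ _ (law X z) (fun n w => (w \notin N)%:R * h (position X (u n) w))
  (fun w => (w \notin N)%:R * h (position X t w)) M.
case=> //.
- by move=> n; case: (bmfM bind (bmf_position mX (u0 n) bh)).
- move=> n w; rewrite normrM; case: (_ \notin _); rewrite ?normr1 ?normr0 ?mul1r ?mul0r//.
  by rewrite (le_trans _ (hM None)).
- move=> w; case: (boolP (w \in N)) => wN /=.
    by under eq_fun do rewrite mul0r; rewrite mul0r; exact: cvg_cst.
  under eq_fun do rewrite mul1r; rewrite mul1r.
  have Nw : ~ N w by rewrite -notin_setE.
  have := right_continuous_path ch (rc w Nw) t0.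
  move=> /(cvg_at_rightP (fun s => h (position X s w)))/(_ u); apply.
  by split.
Qed.

Lemma bmf_transition_time h z : cbf h ->
  bmf (fun t : measurableTypeR R => transition X `|t| h z).
Proof.
move=> ch; have [_ [M hM]] := ch.
apply: (@right_continuous_bmf R (fun t => transition X t h z) M).
  by move=> t t0; exact: right_continuous_transition.
move=> t t0; apply: Ex_norm => //; exact: (bmf_position mX t0 (cbf_bmf ch)).
Qed.

(* q R^q h: the mean of P_T h for T exponential of rate q. *)
Definition mean_resolvent q h z := \int[explaw q]_t transition X `|t| h z.

Lemma mean_resolvent_norm q h z (M : R) : cbf h -> (forall z, `|h z| <= M) ->
  `|mean_resolvent q h z| <= M.
Proof.
move=> ch hM; apply: Ex_norm; first exact: bmf_transition_time.
move=> t; apply: Ex_norm => //.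
exact: (bmf_position mX (normr_ge0 t) (cbf_bmf ch)).
Qed.

Lemma mean_resolventZD q (a : R) h h' z : cbf h -> cbf h' ->
  mean_resolvent q (fun z => a * h z + h' z) z =
  a * mean_resolvent q h z + mean_resolvent q h' z.
Proof.
move=> ch ch'; have b := bmf_transition_time z ch; have b' := bmf_transition_time z ch'.
rewrite /mean_resolvent -Ex_Z// -Ex_D//; last exact: bmfZ.
by apply: eq_Rintegral => t _; rewrite transitionZD//; exact: cbf_bmf.
Qed.

Lemma mean_resolvent_cst q (a : R) z : mean_resolvent q (fun=> a) z = a.
Proof.
rewrite /mean_resolvent -[RHS](Ex_cst (explaw q)).
by apply: eq_Rintegral => t _; rewrite transition_cst.
Qed.

Lemma mean_resolvent_le q h h' z : cbf h -> cbf h' -> (forall z, h z <= h' z) ->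
  mean_resolvent q h z <= mean_resolvent q h' z.
Proof.
move=> ch ch' hh'; apply: Ex_le; try exact: bmf_transition_time.
by move=> t; apply: transition_le => //; exact: cbf_bmf.
Qed.

Lemma almost_surely_measurable_fun (f g : Omega -> R) : measurable_fun [set: Omega] g ->
  almost_surely X (fun w => f w = g w) -> measurable_fun [set: Omega] f.
Proof.
move=> mg fg _ B mB; rewrite setTI.
apply: (almost_surely_measurable sX (B := g @^-1` B)).
  by rewrite -[X in measurable X]setTI; exact: mg.
by apply: almost_surely_mono fg => w /= ->.
Qed.

(** Ties the resolvent of the hypotheses to means over an exponential time. Off a null set
    [discounted_integral] is a measurable function, and by completeness it is then measurable
    itself. *)
Lemma resolventE q (f : E -> R) x : 0 < q -> continuous f ->
  (exists M, forall x, `|f x| <= M) ->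
  resolvent X q f x = q^-1 * mean_resolvent q (cem_ext f) (Some x).
Proof.
move=> q0 cf bf; have ch := cbf_cem_ext cf bf.
have bh := cbf_bmf ch; have [_ [M hM]] := ch.
have [N [mN N0 rc]] := right_continuous_null.
have [b1 _ eF] := @time_Fubini _ Omega R (law X (Some x)) (explaw q)
  (fun t w => cem_ext f (position X t w)) N M mN (N0 _)
  (fun t t0 => bmf_measurable (bmf_position mX t0 bh))
  (fun w t Nw t0 => right_continuous_path ch (rc w Nw) t0)
  (fun t w _ => hM _).
have e w : ~ N w -> discounted_integral X q f w = q^-1 * ((w \notin N)%:R *
    \int[explaw q]_t cem_ext f (position X `|t| w)).
  move=> Nw; rewrite (_ : w \notin N) ?mul1r ?notin_setE// -(@explaw_discounted _ _ (fun t => cem_ext f (position X t w)))//.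
    by rewrite mulKf// gt_eqF.
  apply: (@right_continuous_bmf R (fun t => cem_ext f (position X t w)) M) => // t t0.
  exact: right_continuous_path (rc w Nw) t0.
have bg := bmfZ q^-1 b1.
have md : measurable_fun [set: Omega] (discounted_integral X q f).
  apply: (almost_surely_measurable_fun (bmf_measurable bg)).
  by exists N; split=> // w /e.
rewrite /resolvent unlock -/(Rintegral _ _ _).
rewrite (Ex_ae mN (N0 _) md (bmf_measurable bg) e).
by rewrite Ex_Z// eF.
Qed.

(** With T exponential of rate q, memorylessness turns the left-hand side into the mean of P_T h
    over the event T >= s. *)
Lemma mean_resolvent_supermedian q h (s : R) z : 0 < q -> 0 <= s -> cbf h ->
  (forall z, 0 <= h z) -> bmf (mean_resolvent q h : cem_space E -> R) ->
  expR (- (q * s)) * transition X s (mean_resolvent q h) z <= mean_resolvent q h z.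
Proof.
move=> q0 s0 ch h0 bres.
have bh := cbf_bmf ch; have [_ [M hM]] := ch.
have bt t : 0 <= t -> bmf (transition X t h : cem_space E -> R).
  by move=> t0; exact: bmf_transition.
have [_ _ eF] := @time_Fubini _ Omega R (law X z) (explaw q)
  (fun t w => transition X t h (position X s w)) set0 M measurable0 (measure0 _)
  (fun t t0 => bmf_measurable (bmf_position mX s0 (bt t t0)))
  (fun w t _ t0 => right_continuous_transition ch t0)
  (fun t w t0 => transition_norm _ t0 bh hM).
have -> : transition X s (mean_resolvent q h) z =
    \int[explaw q]_t transition X (s + `|t|) h z.
  transitivity (\int[explaw q]_t \int[law X z]_w transition X `|t| h (position X s w)).
    rewrite -eF; apply: eq_Rintegral => w _.
    by rewrite (_ : w \notin set0) ?mul1r// notin_setE.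
  by apply: eq_Rintegral => t _; rewrite transition_add.
have btt := bmf_transition_time z ch.
rewrite (@explaw_shift _ q s (fun t => transition X t h z))//.
have bi := bmf_ge s.
apply: Ex_le => //; first exact: bmfM.
move=> t; have : 0 <= transition X `|t| h z.
  by apply: Ex_ge_cst => //; exact: (bmf_position mX (normr_ge0 t) bh).
by move=> ?; case: (s <= _); rewrite ?mul1r ?mul0r.
Qed.

End mean_resolvent.

(** * Passage below a level *)

Lemma negligible_bigcup_countable d (T : measurableType d) (R : realType)
    (mu : {measure set T -> \bar R}) (C : countType) (F : C -> set T) :
  (forall c, mu.-negligible (F c)) -> mu.-negligible (\bigcup_c F c).
Proof.
move=> nF.
apply: (@negligibleS _ _ _ _ (\bigcup_n (if unpickle n is Some c then F c else set0))).
  by move=> w [c _ Fc]; exists (pickle c) => //; rewrite pickleK.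
by apply: negligible_bigcup => n; case: unpickle => [c|]; [exact: nF|exact: negligible_set0].
Qed.

Section continuous_sublevel.
Context d (Omega : measurableType d) (R : realType) (E : topologicalType).
Variables (X : process_data Omega R E) (cem : set_system (option E)).
Hypothesis sX : standard_process X cem.
Let mX : markov_process X := standard_markov sX.

Lemma open_sublevel (rho : E -> R) (a : R) : continuous rho -> open [set y | rho y < a].
Proof.
move=> crho; apply: (@open_comp _ _ rho [set r | r < a]) => // x _; exact: crho.
Qed.

Lemma closure_sublevel (rho : E -> R) (a : R) : continuous rho ->
  closure [set y | rho y < a] `<=` [set y | rho y <= a].
Proof.
move=> crho; have cl : closed [set y | rho y <= a].
  by apply: (@closed_comp _ _ rho [set r | r <= a]) => // x _; exact: crho.
rewrite [X in _ `<=` X](closure_id _).1//.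
by apply: closure_subset => y /= /ltW.
Qed.

Lemma measurable_hitting_sublevel (rho : E -> R) : continuous rho ->
  measurable_fun [set: Omega] (hitting_time X [set y | rho y <= 0]).
Proof.
move=> crho.
apply: (measurable_hitting_time sX (U := fun n => [set y | rho y < n.+1%:R^-1])).
- by move=> n; exact: open_sublevel.
- move=> m n mn y /= /lt_le_trans; apply.
  by rewrite lef_pV2 ?posrE// ler_nat ltnS.
- by move=> n y /= /le_lt_trans; apply.
- move=> y hy /=; rewrite leNgt; apply/negP => y0.
  pose n := Num.truncn (rho y)^-1.
  have := closure_sublevel crho (hy n I) => /=; apply/negP; rewrite -ltNge.
  by rewrite invf_plt ?posrE// truncnS_gt.
Qed.

Lemma stopped_event_le T t : stopping_time X T -> 0 <= t ->
  stopped_events X T [set w | (T w <= t%:E)%E].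
Proof.
move=> [T0 FT] t0; split; first exact: (filtration_measurable mX t0 (FT _ t0)).
move=> s s0; rewrite (_ : _ `&` _ = [set w | (T w <= (Num.min t s)%:E)%E]); last first.
  by apply/seteqP; split=> w /=; rewrite EFin_min le_min; [move=> [-> ->]|move=> /andP].
have ts0 : 0 <= Num.min t s by rewrite le_min t0 s0.
by apply: (filtration_nondecreasing mX ts0); [rewrite ge_min lexx orbT|exact: FT].
Qed.

Lemma stopping_timeD T u : stopping_time X T -> 0 <= u ->
  stopping_time X (fun w => (T w + u%:E)%E).
Proof.
move=> [T0 FT] u0; split=> [w|s s0]; first by rewrite adde_ge0.
have [us|su] := leP u s.
  have su0 : 0 <= s - u by rewrite subr_ge0.
  rewrite (_ : [set w | _] = [set w | (T w <= (s - u)%:E)%E]); last first.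
    by apply/seteqP; split=> w /=; rewrite EFinB leeBrDr.
  by apply: (filtration_nondecreasing mX su0); [rewrite gerBl|exact: FT].
rewrite (_ : [set w | _] = set0).
  by have [+ _ _] := filtration_sigma_algebra mX s0.
apply/seteqP; split=> w //= h.
have : (u%:E <= s%:E)%E.
  by apply: le_trans h; rewrite leeDr.
by rewrite lee_fin leNgt su.
Qed.

Lemma position_at_measurable T : stopping_time X T ->
  measurable_fun [set: Omega] (fun w => position_at X (T w) w : cem_space E).
Proof.
move=> sT _ B; rewrite measurable_cemE setTI => mB.
by have [/(_ B mB)[]] := standard_strong_markov sX sT.
Qed.

(** Since the position at time T is almost surely the fixed point z on A, the path after T is
    independent of A; hence a product. *)
Lemma strong_markov_at T (A : set Omega) x z u (h : cem_space E -> R) (N : set Omega) :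
  stopping_time X T -> stopped_events X T A -> 0 <= u -> bmf h ->
  measurable N -> law X x N = 0%E ->
  (forall w, A w -> ~ N w -> position_at X (T w) w = z) ->
  \int[law X x]_w ((w \in A)%:R * h (position_at X (T w + u%:E)%E w)) =
  fine (law X x A) * transition X u h z.
Proof.
move=> sT sA u0 + mN N0 hN; have mA : measurable A by case: sA.
have bA := bmf_indic R mA.
have mp : measurable_fun [set: Omega] (fun w => position_at X (T w + u%:E)%E w : cem_space E).
  exact: (position_at_measurable (stopping_timeD sT u0)).
have bAh (g : cem_space E -> R) : bmf g -> bmf (fun w => (w \in A)%:R * g (position_at X (T w + u%:E)%E w)).
  by move=> bg; apply: bmfM => //; exact: bmf_comp bg mp.
have A0 : 0 <= fine (law X x A) by exact: fine_ge0.
move: h; apply: (@positive_functional_eq _ (cem_space E) R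
  (fun h => \int[law X x]_w ((w \in A)%:R * h (position_at X (T w + u%:E)%E w)))
  (fun h => fine (law X x A) * transition X u h z)).
- split=> [a f g bf bg|f g bf bg fg].
    rewrite -Ex_Z; last exact: bAh.
    rewrite -Ex_D; last 2 first.
    + by apply: bmfZ; exact: bAh.
    + exact: bAh.
    by apply: eq_Rintegral => w _; ring.
  apply: Ex_le; try exact: bAh.
  by move=> w; rewrite ler_wpM2l.
- split=> [a f g bf bg|f g bf bg fg]; first by rewrite transitionZD//; ring.
  by rewrite ler_wpM2l// transition_le.
- move=> B mB; have mB' : cem_borel B by rewrite -measurable_cemE.
  have mXB : measurable [set w | B (position_at X (T w + u%:E)%E w)].
    by rewrite -[X in measurable X]setTI; exact: mp.
  transitivity (fine (law X x (A `&` [set w | B (position_at X (T w + u%:E)%E w)]))).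
    rewrite -Ex_indic; last exact: measurableI.
    apply: eq_Rintegral => w _; rewrite -natrM mulnb; congr (nat_of_bool _)%:R.
    by rewrite in_setI; congr (_ && _); apply/idP/idP; rewrite !inE.
  have [_ ->//] := standard_strong_markov sX sT.
  have mXu : measurable (position X u @^-1` B).
    by rewrite -[X in measurable X]setTI; exact: position_measurable.
  rewrite transition_indic// -fineM ?fin_num_measure//.
  congr fine.
  transitivity (\int[law X x]_(w in A) (law X z (position X u @^-1` B)))%E; last first.
    by rewrite integral_cst// muleC.
  apply: ae_eq_integral => //.
  - apply: measurable_funTS.
    have := law_measurable mX u0 mB' => ml.
    exact: (measurableT_comp ml (position_at_measurable sT)).
  - exists N; split=> // w /= h; apply: contrapT => Nw; apply: h => Aw.
    by rewrite hN.
Qed.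

End continuous_sublevel.

Section half_line_state_space.
Context {R : realType} {I : set R}.
Hypothesis I_half_line : I = `[0, +oo[%classic \/ I = `]0, +oo[%classic.

Lemma half_line_ge0 (x : I) : 0 <= set_val x.
Proof.
have : I (set_val x) := set_valP x; move: (set_val x) => r.
by case: I_half_line => ->; rewrite /= in_itv/= andbT// => /ltW.
Qed.

Lemma half_line_gt0 (x : I) : ~ I 0 -> 0 < set_val x.
Proof.
move=> I0; rewrite lt_def half_line_ge0 andbT; apply/eqP => x0.
by apply: I0; rewrite -x0; exact: set_valP.
Qed.

Lemma half_line_pt (r : R) : 0 < r -> {x : I | set_val x = r}.
Proof.
move=> r0; have Ir : r \in I.
  by apply/mem_set; case: I_half_line => ->; rewrite /= in_itv/= andbT// ltW.
by exists (exist _ r Ir).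
Qed.

Lemma set_val_continuous : continuous (set_val : I -> R).
Proof. exact: initial_continuous. Qed.

Lemma half_line_hausdorff : hausdorff_space I.
Proof.
move=> x y xy; apply: val_inj.
apply: (@Rhausdorff R) => A B xA yB.
have [z [zA zB]] := xy _ _ (set_val_continuous xA) (set_val_continuous yB).
by exists (set_val z).
Qed.

End half_line_state_space.

Section passage.
Context {R : realType} {I : set R}.
Hypothesis I_half_line : I = `[0, +oo[%classic \/ I = `]0, +oo[%classic.
Context d (Omega : measurableType d).
Variables (X : process_data Omega R I) (cem : set_system (option I)).
Hypothesis sX : standard_process X cem.
Let mX : markov_process X := standard_markov sX.
Hypothesis nnj : no_negative_jumps X.
Let v : I -> R := set_val.
Let v_continuous : continuous v. Proof. exact: set_val_continuous. Qed.

(** The sublevel set is open, unlike the one in [tau_minus], so that this entrance time along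
    rational times is a stopping time. *)
Definition passage_below (c : R) := rational_hitting X 0 [set y : I | set_val y < c].

Lemma stopping_time_passage c : stopping_time X (passage_below c).
Proof.
apply: (stopping_time_rational_hitting sX) => //.
by apply: open_sublevel; exact: v_continuous.
Qed.

Lemma measurable_tau_minus (b : I) : measurable_fun [set: Omega] (tau_minus X b).
Proof.
have := @measurable_hitting_sublevel _ _ _ _ _ _ sX (fun y => v y - v b).
rewrite (_ : [set y | v y - v b <= 0] = [set y | set_val y <= set_val b]).
  by apply; apply: continuous_fB => //; exact: continuous_fcst.
by apply/seteqP; split=> y /=; rewrite subr_le0.
Qed.

Lemma measurable_tau (b : I) : measurable_fun [set: Omega] (tau X b).
Proof.
have := @measurable_hitting_sublevel _ _ _ _ _ _ sX (fun y => `|v y - v b|).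
rewrite (_ : [set y | `|v y - v b| <= 0] = [set b]).
  by apply; apply/continuous_fnorm/continuous_fB => //; exact: continuous_fcst.
apply/seteqP; split=> y /=; last by move=> ->; rewrite subrr normr0.
by rewrite normr_le0 subr_eq0 => /eqP /val_inj.
Qed.

(** By right continuity the position z at the passage time r is at most c. If z < c, pick a rational
    level a and a level y with z < a < y < c: the path is below a at time r without having visited
    y, and by the absence of negative jumps this has probability 0. There are countably many choices
    of a. *)
Lemma passage_position (c x : I) : v c < v x ->
  exists N, [/\ measurable N, law X (Some x) N = 0%E,
   forall w, ~ N w -> right_continuous_at X cem w &
   forall w r, ~ N w -> passage_below (v c) w = r%:E -> position X r w = Some c].
Proof.
move=> cx.
have [N0 [mN0 N00 rc]] := right_continuous_null sX.
have nX := standard_normal sX.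
have [mN1 N10] := start_null mX nX half_line_hausdorff (Some x).
set N1 := ~` _ in mN1 N10.
(* The level y is the midpoint of a and c. The pair (x, x) is a dummy for a outside (0, c), where
   [S'] is empty. *)
have pts (a : rat) : {ay : I * I | 0 < (ratr a : R) < v c ->
    [/\ v ay.1 = ratr a, v ay.1 < v ay.2 & v ay.2 < v c]}.
  case: (boolP (0 < (ratr a : R) < v c)) => [/andP[a0 ac]|]; last first.
    by move=> _; exists (x, x).
  have [a' ea'] := half_line_pt I_half_line a0.
  have m0 : 0 < (ratr a + v c) / 2 by rewrite divr_gt0// addr_gt0// (lt_trans a0).
  have [y ey] := half_line_pt I_half_line m0.
  by exists (a', y) => _ /=; rewrite /v ea' ey !midf_lt.
pose S a := [set w | (tau_minus X (sval (pts a)).1 w < tau X (sval (pts a)).2 w)%E].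
have mS a : measurable (S a).
  rewrite -[X in measurable X]setTI.
  by apply: measurable_lte => //; [exact: measurable_tau_minus|exact: measurable_tau].
pose S' a := if 0 < (ratr a : R) < v c then S a else set0.
have mS' a : measurable (S' a) by rewrite /S'; case: ifP.
have S0 a : law X (Some x) (S' a) = 0%E.
  rewrite /S'; case: ifPn => [ac|_]; last exact: measure0.
  by have [_ h1 h2] := svalP (pts a) ac; apply: nnj => //; exact: lt_trans cx.
exists (N0 `|` N1 `|` \bigcup_a S' a); split.
- apply: measurableU; first exact: measurableU.
  exact: bigcupT_measurable_rat.
- apply/negligibleP.
    apply: measurableU; first exact: measurableU.
    exact: bigcupT_measurable_rat.
  apply: negligibleU; first by apply: negligibleU; apply/negligibleP => //; exact: N00.
  by apply: negligible_bigcup_countable => a; apply/negligibleP => //; exact: S0.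
- by move=> w Nw; apply: rc => N0w; apply: Nw; left; left.
move=> w r Nw er.
have rcw : right_continuous_at X cem w.
  by apply: rc => N0w; apply: Nw; left; left.
have X0 : position X 0 w = Some x.
  by apply: contrapT => h; apply: Nw; left; right.
have [z rz cz] := rational_hitting_closure sX rcw (lexx 0) er.
have zc : v z <= v c by have := closure_sublevel v_continuous cz.
have r0 : 0 <= r by rewrite -lee_fin -er; exact: rational_hitting_ge.
have {}r0 : 0 < r.
  rewrite lt_neqAle r0 andbT; apply/eqP => r00; move: rz; rewrite -r00 X0 => -[xz].
  by move: cx; rewrite xz ltNge zc.
rewrite rz; congr Some; apply: val_inj; apply/eqP; rewrite eq_le zc /= leNgt.
apply/negP => zc'; apply: Nw; right.
have [a] := rat_in_itvoo zc'.
rewrite in_itv/= => /andP[za ac]; exists a => //; rewrite /S'.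
have a0 : 0 < (ratr a : R) by rewrite (le_lt_trans _ za)// (half_line_ge0 I_half_line).
rewrite a0 ac /S /=.
have [] := svalP (pts a); first by rewrite a0.
move: (sval (pts a)) => [a' y] /= ea' ay yc.
have zy : v z < v y by rewrite (lt_trans _ ay)// ea'.
have tr : (tau_minus X a' w <= r%:E)%E.
  apply: ereal_inf_lbound; exists r => //; split=> //.
  by exists z => //=; rewrite -/v ea' ltW.
apply: le_lt_trans tr _.
have zV : nbhs z [set y' | v y' < v y].
  apply: open_nbhs_nbhs; split=> //; apply: open_sublevel; exact: v_continuous.
have [e e0 he] := right_continuous_nbhs rcw (ltW r0) rz zV.
apply: (@lt_le_trans _ _ (r + e)%:E); first by rewrite lte_fin ltrDl.
apply: le_ereal_inf_tmp => _ [t [t0 [_ -> ty]] <-]; rewrite lee_fin leNgt.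
(* A visit to y before r would make the passage below c earlier than r; from r to r + e the path is
   strictly below y. *)
apply/negP => tre; have [tr|rt] := ltP t r.
  have : (passage_below (v c) w <= t%:E)%E.
    apply: (rational_hitting_le_hit rcw (lexx 0) (ltW t0) (esym ty)).
    by apply: open_nbhs_nbhs; split=> //; apply: open_sublevel; exact: v_continuous.
  by rewrite er lee_fin leNgt tr.
have := he t; rewrite rt tre => /(_ isT) [y' y'y]; rewrite -ty => -[yy'].
by move: y'y; rewrite /= yy' ltxx.
Qed.

(* Splitting at the passage time s below c, which is a visit to c: before s the
   path stays above c, after s the strong Markov property applies, and
   discounting by e^(-q s) only decreases a nonnegative integral. *)
Lemma mean_resolvent_descent (x c : I) (h : option I -> R) (M m q t0 : R) :
  v c < v x -> 0 < q -> 0 <= t0 -> cbf h -> (forall z, 0 <= h z <= M) -> 0 <= m ->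
  (forall y, v c <= v y -> h (Some y) <= m) ->
  mean_resolvent X q h (Some x) <=
    M * (1 - fine (law X (Some x) [set w | (passage_below (v c) w <= t0%:E)%E])) +
    m * (1 - expR (- (q * t0))) + mean_resolvent X q h (Some c).
Proof.
move=> cx q0 t00 ch hM m0 hm.
have bh := cbf_bmf ch.
have hM' z : `|h z| <= M by have /andP[h0 h1] := hM z; rewrite ger0_norm.
have [N [mN N0 rc Xc]] := passage_position cx.
set T := passage_below (v c) in Xc *.
have sT : stopping_time X T := stopping_time_passage (v c).
set A := [set w | (T w <= t0%:E)%E].
have sA : stopped_events X T A := stopped_event_le sX sT t00.
have mA : measurable A by case: sA.
have bA := bmf_indic R mA.
have T0 w : (0 <= T w)%E by case: sT.
pose phi u w := (w \in A)%:R * h (position_at X (T w + u%:E)%E w).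
have Tfin w : A w -> exists2 r, T w = r%:E & 0 <= r <= t0.
  rewrite /A /=; have := T0 w; case: (T w) => [r| |]//=.
  by rewrite !lee_fin => r0 rt; exists r => //; rewrite r0.
have mphi u : 0 <= u -> bmf (phi u).
  move=> u0; apply: bmfM => //; apply: bmf_comp bh _.
  exact: (position_at_measurable sX (stopping_timeD sX sT u0)).
have cphi w u : ~ N w -> 0 <= u -> phi s w @[s --> u^'+] --> phi u w.
  move=> Nw u0; rewrite /phi; case: (boolP (w \in A)) => [|_]; last first.
    by under eq_fun do rewrite mul0r; rewrite mul0r; exact: cvg_cst.
  move=> /set_mem /Tfin[r -> /andP[r0 _]].
  under eq_fun do rewrite mul1r; rewrite mul1r /=.
  have := right_continuous_path sX ch (rc w Nw) (addr_ge0 r0 u0).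
  move=> hc V /hc [e e0 eV]; exists e => // s /= us s0.
  by apply: eV; rewrite /= ?ltrD2l// opprD addrACA subrr add0r.
have Mphi u w : 0 <= u -> `|phi u w| <= M.
  move=> _; rewrite /phi normrM; case: (_ \in _); rewrite ?normr1 ?normr0 ?mul1r ?mul0r//.
  exact: le_trans (normr_ge0 _) (hM' None).
have [b1 _ e1] := @time_Fubini _ _ R (law X (Some x)) (explaw q) phi N M mN N0
  (fun t t0 => bmf_measurable (mphi t t0)) cphi Mphi.
have {}e1 : \int[law X (Some x)]_w ((w \notin N)%:R * \int[explaw q]_t phi `|t| w) =
    fine (law X (Some x) A) * mean_resolvent X q h (Some c).
  rewrite e1 /mean_resolvent -Ex_Z; last exact: (bmf_transition_time sX).
  apply: eq_Rintegral => t _; apply: (strong_markov_at sX sT sA _ bh mN N0) => //.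
  move=> w Aw Nw; have [r er _] := Tfin w Aw.
  by rewrite er /=; exact: Xc.
have [b2 _ e2] := @time_Fubini _ _ R (law X (Some x)) (explaw q)
  (fun t w => h (position X t w)) N M mN N0
  (fun t t0 => bmf_measurable (bmf_position mX t0 bh))
  (fun w t Nw t0 => right_continuous_path sX ch (rc w Nw) t0)
  (fun t w _ => hM' _).
rewrite {1}/mean_resolvent /transition -e2.
pose c1 := M - M * fine (law X (Some x) A).
have res0 : 0 <= mean_resolvent X q h (Some c).
  apply: Ex_ge_cst => [|t]; first exact: (bmf_transition_time sX).
  apply: Ex_ge_cst => [|w]; last by case/andP: (hM (position X `|t| w)).
  exact: (bmf_position mX (normr_ge0 t) bh).
(* Pathwise upper bound off N. Off A the mean is at most M. On A, with passage time r <= t0, the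
   part before r contributes at most m times the probability 1 - e^(-qr) <= 1 - e^(-q t0), and the
   part after r is discounted by e^(-qr) <= 1. *)
pose G w := (M * (1 - (w \in A)%:R) + m * (1 - expR (- (q * t0)))) +
  (w \notin N)%:R * \int[explaw q]_t phi `|t| w.
have bG0 : bmf (fun w : Omega => M * (1 - (w \in A)%:R) + m * (1 - expR (- (q * t0)))).
  apply: bmfD; last exact: bmf_cst.
  by apply: bmfZ; apply: bmfB => //; exact: bmf_cst.
have bG : bmf G by exact: bmfD.
apply: (@le_trans _ _ (\int[law X (Some x)]_w G w)).
  apply: Ex_le => // w; rewrite /G.
  have em : 0 <= m * (1 - expR (- (q * t0))).
    by rewrite mulr_ge0// subr_ge0 -[leRHS]expR0 ler_expR oppr_le0 mulr_ge0// ltW.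
  have M0 : 0 <= M by exact: le_trans (normr_ge0 _) (hM' None).
  case: (boolP (w \in N)) => wN /=.
    rewrite !mul0r addr0 addr_ge0// mulr_ge0//.
    by case: (_ \in A); rewrite ?subrr ?subr0.
  have Nw : ~ N w by rewrite -notin_setE.
  rewrite !mul1r.
  have bhw : bmf (fun t : measurableTypeR R => h (position X `|t| w)).
    apply: (@right_continuous_bmf R (fun t => h (position X t w)) M) => // t t1.
    exact: (right_continuous_path sX ch (rc w Nw) t1).
  rewrite /phi; case: (boolP (w \in A)) => wA /=; last first.
    rewrite subr0 mulr1 (@le_trans _ _ M)//.
      by apply: Ex_le_cst => // t; case/andP: (hM (position X `|t| w)).
    rewrite -addrA lerDl addr_ge0//; under eq_Rintegral do rewrite mul0r.
    by rewrite Ex_cst.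
  have [r er /andP[r0 rt0]] := Tfin w (set_mem wA).
  rewrite subrr mulr0 add0r er /=.
  under [in leRHS]eq_Rintegral do rewrite mul1r.
  have mi : measurable [set t : measurableTypeR R | r <= `|t|].
    rewrite -[X in measurable X]setTI.
    by apply: measurable_fun_le => //; exact: measurableT_comp.
  have bi : bmf (fun t : measurableTypeR R => (r <= `|t|)%R%:R : R).
    by have := bmf_indic R mi; under eq_fun do rewrite mem_setE.
  have bih : bmf (fun t : measurableTypeR R => (r <= `|t|)%R%:R * h (position X `|t| w)).
    exact: bmfM.
  have bmi : bmf (fun t : measurableTypeR R => m * (1 - (r <= `|t|)%R%:R)).
    by apply: bmfZ; apply: bmfB => //; exact: bmf_cst.
  apply: (@le_trans _ _ (\int[explaw q]_t
    (m * (1 - (r <= `|t|)%R%:R) + (r <= `|t|)%R%:R * h (position X `|t| w)))).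
    apply: Ex_le => [//||t]; first exact: bmfD.
    case: (leP r `|t|) => rt /=; first by rewrite subrr mulr0 add0r mul1r.
    rewrite subr0 mulr1 mul0r addr0.
    case ey : (position X `|t| w) => [y|].
      apply: hm; rewrite leNgt; apply/negP => yc.
      have : (T w <= `|t|%:E)%E.
        apply: (rational_hitting_le_hit (rc w Nw) (lexx 0) (normr_ge0 t) ey).
        by apply: open_nbhs_nbhs; split=> //; apply: open_sublevel; exact: v_continuous.
      by rewrite er lee_fin leNgt rt.
    have := coord_absorbed mX (normr_ge0 t) (ltW rt) ey.
    by rewrite (Xc w r Nw er).
  rewrite Ex_D// Ex_Z; last by apply: bmfB => //; exact: bmf_cst.
  rewrite Ex_B//; last exact: bmf_cst.
  rewrite Ex_cst explaw_tail// lerD//.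
    by rewrite ler_wpM2l// lerB// ler_expR lerN2 ler_wpM2l// ltW.
  rewrite -(@explaw_shift _ q r (fun t => h (position X t w)))//.
  have int0 : 0 <= \int[explaw q]_t h (position X (r + `|t|) w).
    by apply: Rintegral_ge0 => t _; case/andP: (hM (position X (r + `|t|) w)).
  rewrite -[leRHS]mul1r ler_wpM2r// -[leRHS]expR0 ler_expR oppr_le0 mulr_ge0// ltW//.
rewrite /G Ex_D// e1 Ex_D//; last 2 first.
- by apply: bmfZ; apply: bmfB => //; exact: bmf_cst.
- exact: bmf_cst.
rewrite Ex_cst Ex_Z; last by apply: bmfB => //; exact: bmf_cst.
rewrite Ex_B//; last exact: bmf_cst.
rewrite Ex_cst Ex_indic// lerD2l -[leRHS]mul1r ler_wpM2r//.
rewrite -lee_fin fineK ?fin_num_measure//; exact: probability_le1.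
Qed.

End passage.

(** * Functions on the half-line with infinity adjoined *)

Lemma set_type_nbhsP (T : topologicalType) (A : set T) (x : A) (U : set A) :
  nbhs x U <-> exists2 V, nbhs (set_val x) V & forall y : A, V (set_val y) -> U y.
Proof.
split=> [[_ [[W oW <-] Wx] WU]|[V xV VU]].
  by exists W; [exact: open_nbhs_nbhs|move=> y Wy; exact: WU].
have [W [oW Wx] WV] : exists2 W, open_nbhs (set_val x) W & W `<=` V.
  by move: xV; rewrite nbhsE.
exists (set_val @^-1` W); split=> //; first by exists W.
by move=> y Wy; apply/VU/WV.
Qed.

Section extended_half_line.
Context {R : realType} {I : set R}.
Hypothesis I_half_line : I = `[0, +oo[%classic \/ I = `]0, +oo[%classic.
Local Notation v := (set_val : I -> R).
Local Notation iota := (@to_I_infty R I).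
Local Notation oo := (point_infty I).

Lemma I_infty_cases (z : I_infty I) : (exists x, z = iota x) \/ z = oo.
Proof.
have [[r Ir rz]|zoo] := set_valP z.
  left; have Ir' : r \in I by exact/mem_set.
  by exists (exist _ r Ir'); apply: val_inj; rewrite /= -rz.
by right; exact: val_inj.
Qed.

Lemma iota_inj : injective iota.
Proof. by move=> x y /(congr1 val) /= [/val_inj]. Qed.

Lemma iota_neq_oo x : iota x <> oo.
Proof. by move=> /(congr1 val). Qed.

Lemma I_infty_hausdorff : hausdorff_space (I_infty I).
Proof.
move=> x y xy; apply: val_inj; apply: (@ereal_hausdorff R) => A B xA yB.
have cv := @initial_continuous (I_infty I) (\bar R) set_val.
have [z [zA zB]] := xy _ _ (cv x A xA) (cv y B yB).
by exists (set_val z).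
Qed.

Lemma nbhs_iota x (U : set (I_infty I)) : nbhs (iota x) U <->
  exists2 e : R, 0 < e & forall y, `|v y - v x| < e -> U (iota y).
Proof.
rewrite set_type_nbhsP; split=> [[V xV VU]|[e e0 eU]].
  have [e e0 eV] : nbhs (v x) (EFin @^-1` V) by exact: xV.
  by exists e => // y ye; apply: VU; apply: eV => /=; rewrite distrC.
exists (EFin @` ball (v x) e).
  by apply: nbhs_image_EFin; exact: nbhsx_ballx.
move=> y [r xr ry]; case: (I_infty_cases y) ry => [[y' ->]|->]// [ry].
by apply: eU; rewrite distrC; move: xr; rewrite /ball /= ry.
Qed.

Lemma nbhs_oo (U : set (I_infty I)) : nbhs oo U <->
  U oo /\ exists A : R, forall y, A < v y -> U (iota y).
Proof.
rewrite set_type_nbhsP; split=> [[V ooV VU]|[Uoo [A AU]]].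
  split; first by apply: VU; exact: nbhs_singleton ooV.
  have [A [_ AV]] := ooV; exists A => y Ay.
  by apply: VU; apply: AV; rewrite lte_fin.
exists [set y | (A%:E < y)%E]; first exact: nbhs_open_ereal_pinfty.
move=> y; case: (I_infty_cases y) => [[y' ->]|->]//=.
by rewrite lte_fin; exact: AU.
Qed.

Lemma nbhs_half_line (x : I) (U : set I) : nbhs x U <->
  exists2 e : R, 0 < e & forall y, `|v y - v x| < e -> U y.
Proof.
rewrite set_type_nbhsP; split=> [[V [e e0 eV] VU]|[e e0 eU]].
  by exists e => // y ye; apply: VU; apply: eV => /=; rewrite distrC.
exists (ball (v x) e); first exact: nbhsx_ballx.
by move=> y; rewrite /ball /= distrC; exact: eU.
Qed.

Lemma iota_continuous : continuous iota.
Proof. by move=> x U /nbhs_iota[e e0 eU]; apply/nbhs_half_line; exists e. Qed.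

(** A filter that does not cluster at infinity contains a set of points below some M, and so
    clusters in the compact interval [a, M]. The value a = 0 is allowed only when 0 is a point of
    I. *)
Lemma compact_upper_segment (a : R) : 0 < a \/ I = `[0, +oo[%classic -> 0 <= a ->
  compact [set z : I_infty I | (a%:E <= set_val z)%E].
Proof.
move=> ha a0 F PF Fa.
have [coo|] := pselect (cluster F oo); first by exists oo; split=> //=; exact: leey.
move=> /existsNP[A /existsNP[B /not_implyP[FA /not_implyP[/nbhs_oo[Boo [M MB]] nAB]]]].
have Iab (r : R) : a <= r -> r \in I.
  move=> ar; apply/mem_set; case: I_half_line => IE.
    by rewrite IE /= in_itv/= andbT (le_trans a0).
  case: ha => [ha|IE']; first by rewrite IE /= in_itv/= andbT (lt_le_trans ha).
  by rewrite IE' /= in_itv/= andbT (le_trans a0).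
pose g (z : I_infty I) : R := fine (set_val z).
have AM z : A z -> exists2 x, z = iota x & v x <= M.
  move=> Az; case: (I_infty_cases z) => [[x zx]|zoo]; last first.
    by exfalso; apply: nAB; exists oo; split=> //; rewrite -zoo.
  exists x => //; rewrite leNgt; apply/negP => Mx; apply: nAB.
  by exists (iota x); split; [rewrite -zx|exact: MB].
have [r [arM cr]] : [set` `[a, M]] `&` cluster (g @ F) !=set0.
  apply: (@segment_compact R a M); rewrite /nbhs /=.
  apply: filterS (filterI Fa FA) => z [/= az /AM[x zx xM]].
  move: az; rewrite zx /= lee_fin => ax.
  by rewrite /g /= in_itv/= ax xM.
have ar : a <= r by move: arM; rewrite /= in_itv/= => /andP[].
pose x : I := exist _ r (Iab r ar).
exists (iota x); split; first by rewrite /= lee_fin.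
move=> C D FC /nbhs_iota[e e0 eD].
have gFC : (g @ F) (g @` (C `&` A)).
  change (F (g @^-1` (g @` (C `&` A)))).
  by apply: filterS (filterI FC FA) => z CAz; exists z.
have [y [[z [Cz Az] zy] ye]] := cr _ _ gFC (nbhsx_ballx r e e0).
have [x' zx' _] := AM z Az; exists z; split=> //.
rewrite zx'; apply: eD; rewrite distrC; move: ye; rewrite /ball /= -zy /g zx' /=.
by [].
Qed.

Lemma continuous_I_inftyP (f : I_infty I -> R) : continuous f <->
  continuous (f \o iota) /\
  (forall e, 0 < e -> exists A : R, forall y, A < v y -> `|f (iota y) - f oo| < e).
Proof.
split=> [cf|[cf coo] z].
  split=> [x|e e0]; first by apply: continuous_comp; [exact: iota_continuous|exact: cf].
  have [_ [A AU]] := (nbhs_oo _).1 (cf oo _ (nbhsx_ballx _ e e0)).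
  by exists A => y /AU; rewrite /ball /= distrC.
case: (I_infty_cases z) => [[x ->]|->] U.
  move=> /(cf x) /nbhs_half_line[e e0 eU]; apply/nbhs_iota; exists e => //.
move=> [e /= e0 eU]; apply/nbhs_oo; split; first by apply: eU; exact: ballxx.
have [A hA] := coo e e0; exists A => y /hA h; apply: eU.
by rewrite /ball /= distrC.
Qed.

Definition vanishes_at_0 (g : I -> R) := ~ I 0 -> forall e, 0 < e ->
  exists2 a : R, 0 < a & forall x, v x < a -> `|g x| < e.

Lemma vanishes_at_0P (g : I -> R) : vanishes_at_0 g <->
  (~ I 0 -> g x @[x --> trace_filter (nbhs (0 : R))] --> (0 : R)).
Proof.
split=> [h I0 V [e /= e0 eV]|h I0 e e0].
  have [a a0 ha] := h I0 e e0; exists a => //= r /= ra x xr.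
  apply: eV; rewrite /= sub0r normrN; apply: ha.
  by rewrite -xr in ra; rewrite (le_lt_trans (ler_norm _))// -normrN -sub0r.
have [a /= a0 ha] := h I0 _ (nbhsx_ballx (0 : R) e e0).
exists a => // x xa; have := ha (v x); rewrite /= sub0r normrN.
rewrite ger0_norm ?(half_line_ge0 I_half_line)// => /(_ xa x erefl).
by rewrite /ball /= sub0r normrN.
Qed.

(** These are the restrictions to I of the functions of C_infty(I'). The limit at infinity is
    expressed by a Cauchy condition, which names no limit and passes to uniform limits. *)
Definition extendable (g : I -> R) := [/\ continuous g, exists M, forall x, `|g x| <= M,
  vanishes_at_0 g &
  forall e, 0 < e -> exists A : R, forall x y, A < v x -> A < v y -> `|g x - g y| <= e].

Lemma extendable_space_C g : extendable g -> space_C g.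
Proof. by move=> [cg bg /vanishes_at_0P vg _]; split. Qed.

Lemma C_infty_bounded (S : topologicalType) (f : S -> R) : C_infty f ->
  exists M, forall x, `|f x| <= M.
Proof.
move=> [cf vf]; have [K cK hK] := vf 1 ltr01.
have : compact (f @` K).
  by apply: continuous_compact => //; exact: continuous_subspaceT.
move=> /compact_bounded[M [_ hM]].
exists (Num.max 1 (`|M| + 1)) => x; rewrite le_max.
have [Kx|Kx] := pselect (K x); last by rewrite ltW ?hK.
apply/orP; right; apply: hM; last by exists x.
by rewrite (le_lt_trans (ler_norm _))// ltrDl.
Qed.

Lemma extendable_restriction f : C_infty f -> extendable (f \o iota).
Proof.
move=> Cf; have [cf vf] := Cf; have [ci coo] := (continuous_I_inftyP f).1 cf.
have [M hM] := C_infty_bounded Cf.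
split=> //; first by exists M => x; exact: hM.
  move=> I0 e e0; have [K cK hK] := vf e e0.
  have Ilt (x : I) : 0 < v x.
    rewrite lt_neqAle (half_line_ge0 I_half_line) andbT; apply/eqP => x0.
    by apply: I0; rewrite x0; exact: set_valP.
  (* If 0 is not in I, a compact subset of (0, oo] is bounded away from 0. *)
  have : near_covering K by exact/compact_near_coveringP.
  move=> /(_ _ (0 : R)^'+ (fun a z => (a%:E < set_val z)%E)) [|a /= a0 ha].
    move=> z Kz; case: (I_infty_cases z) => [[x ->]|->].
      exists ([set z' | ((v x / 2)%:E < set_val z')%E], [set a | a < v x / 2]) => /=.
        split; last first.
          by apply: nbhs_right_lt; rewrite divr_gt0.
        apply/nbhs_iota; exists (v x / 2); first by rewrite divr_gt0.
        by move=> y /=; rewrite lte_fin ltr_norml => /andP[h _]; lra.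
      by move=> [z' a] /= [h1 h2]; rewrite (lt_trans _ h1)// lte_fin.
    exists ([set z' | (1%:E < set_val z')%E], [set a | a < 1]) => /=.
      split; last exact: nbhs_right_lt.
      by apply/nbhs_oo; split=> /=; [exact: ltry|exists 1 => y /=; rewrite lte_fin].
    by move=> [z' a] /= [h1 h2]; rewrite (lt_trans _ h1)// lte_fin.
  exists (a / 2); first by rewrite divr_gt0.
  move=> x xa; apply: hK => Kx.
  have := ha (a / 2); rewrite /= sub0r normrN ger0_norm ?divr_ge0 ?ltW//.
  rewrite ltr_pdivrMr// ltr_pMr// ltr1n divr_gt0// => /(_ isT isT _ Kx) /=.
  by rewrite lte_fin ltNge ltW.
move=> e e0; have e20 : 0 < e / 2 by rewrite divr_gt0.
have [A hA] := coo _ e20; exists A => x y /hA h1 /hA h2 /=.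
rewrite (_ : _ - _ = f (iota x) - f oo - (f (iota y) - f oo)); last by ring.
by rewrite (le_trans (ler_normB _ _))// ltW// [ltRHS](splitr e) ltrD.
Qed.

Lemma extendable_extension g : extendable g ->
  exists2 f : I_infty I -> R, C_infty f & forall x, f (iota x) = g x.
Proof.
move=> [cg [M hM] vg ccg].
(* The value at infinity is the limit of g along the positive integers. *)
have pt (n : nat) : {x : I | v x = n.+1%:R} by exact: half_line_pt.
pose u n := g (sval (pt n)).
have cu : cauchy (u @ \oo).
  apply/cauchy_ballP => e e0; have e20 : 0 < e / 2 by rewrite divr_gt0.
  have [A hA] := ccg _ e20.
  pose N0 := [set n : nat | A < n.+1%:R].
  have N0oo : \oo (u @^-1` (u @` N0)).
    exists (Num.truncn A) => // n /= hn; exists n => //.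
    by rewrite /N0 /= (lt_le_trans (truncnS_gt _))// ler_nat ltnS.
  exists (u @` N0, u @` N0) => //.
  move=> [_ _] /= [[m hm <-] [n hn <-]]; rewrite /ball /=.
  rewrite (@le_lt_trans _ _ (e / 2))//; last by rewrite gtr_pMr// invf_lt1// ltr1n.
  by apply: hA; rewrite (svalP (pt _)).
have /cauchy_cvg cvu := cu.
pose l := lim (u @ \oo).
have gl e : 0 < e -> exists A : R, forall y, A < v y -> `|g y - l| < e.
  move=> e0; have e20 : 0 < e / 2 by rewrite divr_gt0.
  have [A hA] := ccg _ e20; exists A => y Ay.
  rewrite (@le_lt_trans _ _ (e / 2))//; last by rewrite gtr_pMr// invf_lt1// ltr1n.
  have cn : `|g y - u n| @[n --> \oo] --> `|g y - l|.
    by apply: cvg_norm; apply: cvgB; [exact: cvg_cst|exact: cvu].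
  rewrite -(cvg_lim _ cn)//; apply: limr_le; first by apply/cvg_ex; eexists; exact: cn.
  exists (Num.truncn A) => // n /= hn; apply: hA => //; rewrite (svalP (pt _)).
  by rewrite (lt_le_trans (truncnS_gt _))// ler_nat ltnS.
pose f z := if pselect (exists x, iota x = z) is left h then g (projT1 (cid h)) else l.
have fi x : f (iota x) = g x.
  rewrite /f; case: pselect => [h|[]]; last by exists x.
  by case: cid => y /= /iota_inj ->.
have foo : f oo = l.
  by rewrite /f; case: pselect => // h; exfalso; case: h => x; exact: iota_neq_oo.
exists f => //; split.
  apply/continuous_I_inftyP; split.
    by rewrite (_ : f \o iota = g)//; exact/funext.
  by move=> e /gl[A hA]; exists A => y; rewrite fi foo; exact: hA.
move=> e e0; case: I_half_line => IE.
  exists [set z : I_infty I | (0%:E <= set_val z)%E].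
    by apply: compact_upper_segment => //; right.
  move=> z []; case: (I_infty_cases z) => [[x ->]|->] /=; last exact: leey.
  by rewrite lee_fin (half_line_ge0 I_half_line).
have I0 : ~ I 0 by rewrite IE /= in_itv/= ltxx.
have [a a0 ha] := vg I0 e e0.
exists [set z : I_infty I | (a%:E <= set_val z)%E].
  by apply: compact_upper_segment; [left|exact: ltW].
move=> z; case: (I_infty_cases z) => [[x ->]|->]/=; last by rewrite leey.
by rewrite lee_fin => /negP; rewrite -ltNge fi => /ha.
Qed.

Lemma extendable_uniform g : (forall e, 0 < e -> exists2 g', extendable g' &
  forall x, `|g x - g' x| <= e) -> extendable g.
Proof.
move=> h; split.
- move=> x U [e /= e0 eU]; have e40 : 0 < e / 4 by rewrite divr_gt0.
  have [g' [cg' _ _ _] gg'] := h _ e40.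
  have /nbhs_half_line[r r0 hr] := cg' x _ (nbhsx_ballx _ _ e40).
  apply/nbhs_half_line; exists r => // y /hr; rewrite /ball /= => h1.
  apply: eU => /=.
  rewrite (_ : _ - _ = (g x - g' x) + (g' x - g' y) - (g y - g' y)); last by ring.
  rewrite (le_lt_trans (ler_normB _ _))//.
  have := ler_normD (g x - g' x) (g' x - g' y).
  by have := gg' x; have := gg' y; move=> *; lra.
- have [g' [_ [M hM] _ _] gg'] := h 1 ltr01.
  exists (1 + M) => x; rewrite (_ : g x = (g x - g' x) + g' x); last by ring.
  by rewrite (le_trans (ler_normD _ _))// lerD.
- move=> I0 e e0; have e20 : 0 < e / 2 by rewrite divr_gt0.
  have [g' [_ _ vg' _] gg'] := h _ e20.
  have [a a0 ha] := vg' I0 _ e20; exists a => // x /ha h1.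
  rewrite (_ : g x = (g x - g' x) + g' x); last by ring.
  by rewrite (le_lt_trans (ler_normD _ _))// [ltRHS](splitr e) ler_ltD.
- move=> e e0; have e30 : 0 < e / 3 by rewrite divr_gt0.
  have [g' [_ _ _ cg'] gg'] := h _ e30.
  have [A hA] := cg' _ e30; exists A => x y Ax Ay.
  rewrite (_ : _ - _ = (g x - g' x) + (g' x - g' y) - (g y - g' y)); last by ring.
  rewrite (le_trans (ler_normB _ _))//.
  have := ler_normD (g x - g' x) (g' x - g' y).
  by have := gg' x; have := gg' y; have := hA _ _ Ax Ay; move=> *; lra.
Qed.

(* I is dense in I'. *)
Lemma le_at_oo (f : I_infty I -> R) (a : R) : continuous f -> (forall x, f (iota x) <= a) -> f oo <= a.
Proof.
move=> /continuous_I_inftyP[_ coo] fa; apply/ler_addgt0Pr => e e0.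
have [A hA] := coo e e0.
have p0 : 0 < `|A| + 1 by rewrite ltr_pwDr.
have [x xA] := half_line_pt I_half_line p0.
have Ax : A < v x by rewrite xA (le_lt_trans (ler_norm _))// ltrDl.
have := hA x Ax; rewrite ltr_norml => /andP[h1 h2].
by have := fa x; lra.
Qed.

Lemma le_I_infty (f : I_infty I -> R) (a : R) : continuous f -> (forall x, f (iota x) <= a) -> forall z, f z <= a.
Proof. by move=> cf fa z; case: (I_infty_cases z) => [[x ->]|->]//; exact: le_at_oo. Qed.

Lemma eq_I_infty (f g : I_infty I -> R) : continuous f -> continuous g ->
  (forall x, f (iota x) = g (iota x)) -> f = g.
Proof.
move=> cf cg fg; apply/funext => z; apply/eqP; rewrite -subr_eq0 -normr_le0.
apply: (@le_I_infty (fun z => `|f z - g z|)).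
  by apply/continuous_fnorm/continuous_fB.
by move=> x; rewrite fg subrr normr0.
Qed.

End extended_half_line.

Lemma compact_finite_cover (S : topologicalType) (K : set S) (U : S -> set S) :
  compact K -> (forall y, nbhs y (U y)) ->
  exists s : seq S, forall z, K z -> exists2 y, y \in s & U y z.
Proof.
move=> cK hU; have : near_covering K by exact/compact_near_coveringP.
(* The filter of finite lists, directed by inclusion: a property holding eventually holds for some
   list, which turns [near_covering] into the choice of a finite subcover. *)
pose F : set_system (seq S) := [set P : set (seq S) | exists s0 : seq S, forall s : seq S, {subset s0 <= s} -> P s].
have FF : Filter F.
  split; first by exists [::].
  - move=> P Q [s hs] [s' hs']; exists (s ++ s') => t st; split.
      by apply: hs => x xs; apply: st; rewrite mem_cat xs.
    by apply: hs' => x xs; apply: st; rewrite mem_cat xs orbT.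
  - by move=> P Q PQ [s hs]; exists s => t /hs /PQ.
move=> /(_ _ F (fun s z => exists2 y, y \in s & U y z)) [|s hs].
  move=> z Kz; exists (U z, [set s : seq S | z \in s]) => /=.
    by split=> //; exists [:: z] => t; apply; rewrite inE.
  by move=> [z' s] /= [h1 h2]; exists z.
by exists s => z Kz; exact: hs.
Qed.

(** * Functions vanishing at infinity: stability, Stone and Dini *)

Section C_infty_closure.
Context (R : realType) (S : topologicalType).
Implicit Types (f g u : S -> R).

Lemma C_infty_vanish2 f g : C_infty f -> C_infty g -> forall e, 0 < e ->
  exists2 K, compact K & forall x, ~ K x -> `|f x| < e /\ `|g x| < e.
Proof.
move=> [_ vf] [_ vg] e e0; have [K cK hK] := vf e e0; have [K' cK' hK'] := vg e e0.
exists (K `|` K'); first exact: compactU.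
by move=> x /not_orP[Kx K'x]; split; [exact: hK|exact: hK'].
Qed.

Lemma C_inftyD f g : C_infty f -> C_infty g -> C_infty (fun x => f x + g x).
Proof.
move=> Cf Cg; split; first by apply: continuous_fD; [case: Cf|case: Cg].
move=> e e0; have e20 : 0 < e / 2 by rewrite divr_gt0.
have [K cK hK] := C_infty_vanish2 Cf Cg e20; exists K => // x /hK[h1 h2].
by rewrite (le_lt_trans (ler_normD _ _))// [ltRHS](splitr e) ltrD.
Qed.

Lemma C_inftyM f g : C_infty f -> C_infty g -> C_infty (fun x => f x * g x).
Proof.
move=> Cf Cg; split; first by apply: continuous_fM; [case: Cf|case: Cg].
move=> e e0; have m0 : 0 < Num.min e 1 by rewrite lt_min e0 ltr01.
have [K cK hK] := C_infty_vanish2 Cf Cg m0; exists K => // x /hK.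
rewrite !lt_min => -[/andP[h1 _] /andP[_ h2]]; rewrite normrM -[ltRHS]mulr1.
exact: ltr_pM.
Qed.

Lemma C_inftyZ (a : R) f : C_infty f -> C_infty (fun x => a * f x).
Proof.
move=> Cf; split; first by apply: continuous_fM; [exact: continuous_fcst|case: Cf].
move=> e e0; have a0 : 0 < `|a| + 1 by rewrite ltr_pwDr.
have ea0 : 0 < e / (`|a| + 1) by rewrite divr_gt0.
have [K cK hK] := C_infty_vanish2 Cf Cf ea0; exists K => // x /hK[+ _].
rewrite ltr_pdivlMr// => h; rewrite normrM (le_lt_trans _ h)// mulrC.
by rewrite ler_wpM2l// lerDl.
Qed.

Lemma C_inftyB f g : C_infty f -> C_infty g -> C_infty (fun x => f x - g x).
Proof.
move=> Cf Cg; have := C_inftyD Cf (C_inftyZ (-1) Cg).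
by under eq_fun do rewrite mulN1r.
Qed.

Lemma C_infty_norm f : C_infty f -> C_infty (fun x => `|f x|).
Proof.
move=> [cf vf]; split; first exact: continuous_fnorm.
by move=> e /vf[K cK hK]; exists K => // x /hK; rewrite normr_id.
Qed.

Lemma C_infty_min f g : C_infty f -> C_infty g -> C_infty (fun x => Num.min (f x) (g x)).
Proof.
move=> Cf Cg; split; first by apply: continuous_fmin; [case: Cf|case: Cg].
move=> e e0; have [K cK hK] := C_infty_vanish2 Cf Cg e0; exists K => // x /hK[h1 h2].
by rewrite /Num.min; case: ifP.
Qed.

Lemma C_infty_sum (n : nat) (F : nat -> S -> R) : (0 < n)%N -> (forall k, C_infty (F k)) ->
  C_infty (fun x => \sum_(k < n) F k x).
Proof.
case: n => // n _ CF; elim: n => [|n IH].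
  by under eq_fun do rewrite big_ord1; exact: CF.
by under eq_fun do rewrite big_ord_recr/=; exact: C_inftyD.
Qed.

Lemma open_gt f g : continuous f -> continuous g -> open [set z | f z < g z].
Proof.
move=> cf cg; rewrite (_ : [set z | _] = (fun z => g z - f z) @^-1` [set r | 0 < r]).
  by apply: open_comp => // x _; apply: continuous_fB.
by apply/seteqP; split=> z /=; rewrite subr_gt0.
Qed.

Section lattice_approximation.
Variables (L : set (S -> R)) (x0 : S).
Hypotheses (LC : forall u, L u -> C_infty u)
  (Lmin : forall u u', L u -> L u' -> L (fun x => Num.min (u x) (u' x)))
  (Lmax : forall u u', L u -> L u' -> L (fun x => Num.max (u x) (u' x))).

(* The lattice form of the Stone-Weierstrass theorem. *)
Lemma lattice_approximation f : C_infty f ->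
  (forall x y e, 0 < e -> exists2 u, L u & `|u x - f x| < e /\ `|u y - f y| < e) ->
  forall e, 0 < e -> exists2 u, L u & forall z, `|u z - f z| <= e.
Proof.
move=> Cf h2 e e0.
have e20 : 0 < e / 2 by rewrite divr_gt0.
have cf : continuous f by case: Cf.
(* With x fixed, the maximum of finitely many u y exceeds f - e on a compact set K and stays within
   e of f at x. Outside K both |f| and |u x| are below e/2, so that u x, which the maximum
   dominates, is enough. *)
have step1 x : exists2 u, L u & `|u x - f x| < e /\ forall z, f z - e < u z.
  have /choice[u hu] : forall y, exists u, [/\ L u, `|u x - f x| < e & `|u y - f y| < e].
    by move=> y; have [u Lu [? ?]] := h2 x y e e0; exists u.
  pose U y := [set z | f z - e < u y z].
  have oU y : open (U y).
    apply: open_gt; first by apply: continuous_fB => //; exact: continuous_fcst.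
    by have [Lu _ _] := hu y; case: (LC Lu).
  have Uy y : U y y.
    by have [_ _] := hu y; rewrite /U /= ltr_norml => /andP[? _]; lra.
  have Cux : C_infty (u x) by have [Lu _ _] := hu x; exact: LC.
  have [K cK hK] := C_infty_vanish2 Cux Cf e20.
  have [D' KD] := compact_finite_cover cK (fun y => open_nbhs_nbhs (conj (oU y) (Uy y))).
  have fold (s : seq S) : exists2 w, L w & `|w x - f x| < e /\
      forall z, u x z <= w z /\ forall y, y \in s -> u y z <= w z.
    elim: s => [|y s [w Lw [wx wz]]].
      by exists (u x); have [Lu h _] := hu x => //; split=> // z; split.
    have [Ly yx _] := hu y.
    exists (fun z => Num.max (w z) (u y z)); first exact: Lmax.
    split; first by rewrite /Num.max; case: ifP.
    move=> z; have [h1 h3] := wz z; split; first by rewrite le_max h1.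
    move=> y'; rewrite inE le_max => /orP[/eqP ->|/h3 ->]//.
    by rewrite lexx orbT.
  have [w Lw [wx wz]] := fold D'.
  exists w => //; split=> // z; have [h1 h3] := wz z.
  have [Kz|Kz] := pselect (K z).
    have [y yD Uyz] := KD z Kz.
    by rewrite (lt_le_trans Uyz)// h3.
  rewrite (lt_le_trans _ h1)//; have [] := hK z Kz.
  by rewrite !ltr_norml => /andP[? ?] /andP[? ?]; lra.
have /choice[u hu] : forall x, exists u, [/\ L u, `|u x - f x| < e & forall z, f z - e < u z].
  by move=> x; have [u Lu [? ?]] := step1 x; exists u.
(* The dual step: a minimum of finitely many u x, with u x0 serving outside the compact set. *)
pose U x := [set z | u x z < f z + e].
have oU x : open (U x).
  apply: open_gt; last by apply: continuous_fD => //; exact: continuous_fcst.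
  by have [Lu _ _] := hu x; case: (LC Lu).
have Ux x : U x x.
  by have [_ + _] := hu x; rewrite /U /= ltr_norml => /andP[_ ?]; lra.
have Cux : C_infty (u x0) by have [Lu _ _] := hu x0; exact: LC.
have [K cK hK] := C_infty_vanish2 Cux Cf e20.
have [D' KD] := compact_finite_cover cK (fun y => open_nbhs_nbhs (conj (oU y) (Ux y))).
have fold (s : seq S) : exists2 w, L w & forall z, [/\ f z - e < w z,
    w z <= u x0 z & forall y, y \in s -> w z <= u y z].
  elim: s => [|y s [w Lw wz]].
    by exists (u x0); have [Lu _ h] := hu x0 => //; split.
  have [Ly _ yz] := hu y.
  exists (fun z => Num.min (w z) (u y z)); first exact: Lmin.
  move=> z; have [h1 h3 h4] := wz z; split.
  - by rewrite lt_min h1 yz.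
  - by rewrite ge_min h3.
  - move=> y'; rewrite inE ge_min => /orP[/eqP ->|/h4 ->]//.
    by rewrite lexx orbT.
have [w Lw wz] := fold D'.
exists w => // z; have [h1 h3 h4] := wz z.
rewrite ler_norml; apply/andP; split; first by lra.
have [Kz|Kz] := pselect (K z).
  by have [y yD Uyz] := KD z Kz; have := le_lt_trans (h4 y yD) Uyz; lra.
have [] := hK z Kz.
by rewrite !ltr_norml => /andP[? ?] /andP[? ?]; lra.
Qed.

End lattice_approximation.

(** The compactness half of Dini's theorem: the index may vary with z below a common bound N, and
    the monotonicity is supplied where the lemma is applied. Off a compact set u itself is small,
    and u will dominate the quantity to be estimated. *)
Lemma Dini_index u (w : nat -> S -> R) : C_infty u -> (forall n, continuous (w n)) ->
  (forall z e, 0 < e -> exists n, w n z < e) -> forall e, 0 < e ->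
  exists N, forall z, u z < e \/ exists2 n, (n <= N)%N & w n z < e.
Proof.
move=> Cu cw w0 e e0; have [K cK hK] := C_infty_vanish2 Cu Cu e0.
have : near_covering K by exact/compact_near_coveringP.
move=> /(_ nat \oo (fun N z => exists2 n, (n <= N)%N & w n z < e)) [|N _ hN].
  move=> z Kz; have [n hn] := w0 z e e0.
  exists ([set z' | w n z' < e], [set N | (n <= N)%N]) => /=.
    split; last by exists n.
    apply: open_nbhs_nbhs; split=> //; apply: open_gt => //; exact: continuous_fcst.
  by move=> [z' N] /= [h1 h2]; exists n.
exists N => z; have [Kz|Kz] := pselect (K z); first by right; exact: (hN N (leqnn N) z Kz).
by left; have [+ _] := hK z Kz; rewrite ltr_norml => /andP[].
Qed.

End C_infty_closure.

(** * The maximum of independent exponential times *)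

Section maximum_of_exponentials.
Context {R : realType}.
Implicit Types (phi : measurableTypeR R -> R) (q s t : R) (N : nat).

(* Mean of phi under the law of the maximum of N independent exponential
   variables of rate q, by inclusion-exclusion. *)
Definition max_exp_mean N q phi :=
  \sum_(k < N) 'C(N, k.+1)%:R * (-1) ^+ k * \int[explaw (k.+1%:R * q)]_t phi `|t|.

(** With respect to one exponential law the maximum has density N (1 - e^(-qt))^(N-1). Its binomial
    expansion gives the alternating sum, by (k+1) C(N,k+1) = N C(N-1,k) and the change of rate. *)
Lemma max_exp_meanE N q phi : (0 < N)%N -> 0 < q ->
  bmf (fun t : measurableTypeR R => phi `|t|) ->
  max_exp_mean N q phi =
  \int[explaw q]_t (N%:R * (1 - expR (- (q * `|t|))) ^+ N.-1 * phi `|t|).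
Proof.
case: N => // N _ q0 bphi; rewrite /max_exp_mean /=.
have be (k : nat) : bmf (fun t : measurableTypeR R => expR (- (k%:R * q * `|t|))).
  split.
    apply: measurableT_comp => //; apply: measurableT_comp => //.
    by apply: measurable_funM => //; exact: measurableT_comp.
  exists 1 => t; rewrite ger0_norm ?expR_ge0// -[leRHS]expR0 ler_expR oppr_le0.
  by rewrite !mulr_ge0// ltW.
under eq_bigr => k _.
  rewrite explaw_scale ?ler1n// (_ : k.+1%:R - 1 = k%:R); last by rewrite -natr1 addrK.
  rewrite mulrA -Ex_Z; last exact: bmfM.
  over.
rewrite -(@Ex_sum _ _ _ (explaw q) N.+1 (fun k t => 'C(N.+1, k.+1)%:R * (-1) ^+ k * k.+1%:R *
  (expR (- (k%:R * q * `|t|)) * phi `|t|))); last first.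
  by move=> k; apply: bmfZ; exact: bmfM.
apply: eq_Rintegral => t _.
under eq_bigr do rewrite mulrA.
rewrite -mulr_suml; congr (_ * _).
rewrite exprBn mulr_sumr; apply: eq_bigr => k _.
rewrite expr1n mulr1 -expRM_natl mulrN mulrA.
have := mul_bin_diag N.+1 k; rewrite /= => /(congr1 (fun n => n%:R : R)).
rewrite !natrM => h; rewrite -[_ *+ 'C(N, k)]mulr_natr.
move: (expR _) ((-1) ^+ k) => x y.
rewrite [RHS](_ : _ = N.+1%:R * 'C(N, k)%:R * (y * x)); last by ring.
by rewrite h; ring.
Qed.

Lemma max_exp_mean_tail N q s : (0 < N)%N -> 0 < q -> 0 <= s ->
  max_exp_mean N q (fun t => (s <= t)%R%:R) = 1 - (1 - expR (- (q * s))) ^+ N.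
Proof.
move=> N0 q0 s0; rewrite /max_exp_mean.
under eq_bigr do rewrite explaw_tail ?mulr_gt0//.
rewrite exprBn big_ord_recl [X in 1 - (X + _)](_ : _ = 1); last first.
  by rewrite /= bin0 expr0 !expr1n mulr1n !mulr1.
rewrite opprD addrA subrr add0r -sumrN; apply: eq_bigr => k _.
rewrite lift0 expr1n mulr1 exprS -expRM_natl -[_ *+ 'C(N, k.+1)]mulr_natr.
rewrite (_ : k.+1%:R * - (q * s) = - (k.+1%:R * q * s)); last by ring.
move: (expR _) ((-1) ^+ k) => x y.
by ring.
Qed.

Lemma bernoulli_inequality N (y : R) : 0 <= y <= 1 -> 1 - N%:R * y <= (1 - y) ^+ N.
Proof.
move=> /andP[y0 y1]; elim: N => [|N IH]; first by rewrite mul0r subr0 expr0.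
rewrite exprS; have y1' : 0 <= 1 - y by rewrite subr_ge0.
apply: le_trans (ler_wpM2l y1' IH).
rewrite -subr_ge0 (_ : _ - _ = N%:R * y ^+ 2); first by rewrite mulr_ge0// sqr_ge0.
by rewrite -natr1; ring.
Qed.

(* That maximum concentrates at time t when N is large and q = ln N / t. *)
Lemma max_exp_mean_approx t : 0 < t -> forall M d e : R, 0 <= M -> 0 < d -> 0 < e ->
  exists N q, [/\ (0 < N)%N, 0 < q & forall phi o,
    bmf (fun t : measurableTypeR R => phi `|t|) -> (forall s, 0 <= s -> `|phi s| <= M) ->
    (forall s, 0 <= s -> `|s - t| <= d -> `|phi s - phi t| <= o) ->
    `|max_exp_mean N q phi - phi t| <= o + e].
Proof.
move=> t0 M d e M0 d0 e0.
have M40 : 0 < 4 * M + 1 by rewrite ltr_wpDl// mulr_ge0.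
(* A is chosen so that ln N > A forces q > (4M+1)/(e d), and then 4 M e^(-qd) <= e because e^y >= y.
   The summand 1 keeps the constant positive when M = 0. *)
pose A := t * Num.max 1 ((4 * M + 1) / e / d).
pose N := (Num.truncn (expR A)).+1.
have N0 : 0 < N%:R :> R by [].
have AN : A < ln N%:R.
  by rewrite -ltr_expR lnK ?posrE// truncnS_gt.
pose q := ln N%:R / t.
have qA : Num.max 1 ((4 * M + 1) / e / d) < q.
  by rewrite /q ltr_pdivlMr// mulrC.
have q0 : 0 < q by rewrite (lt_trans _ qA)// lt_max ltr01.
have eqt : expR (q * t) = N%:R by rewrite /q divfK ?gt_eqF// lnK ?posrE.
have eqd : (4 * M + 1) * expR (- (q * d)) <= e.
  rewrite expRN ler_pdivrMr ?expR_gt0// [e * _]mulrC -ler_pdivrMr//.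
  apply: (@le_trans _ _ (q * d)); last first.
    by rewrite (le_trans _ (expR_ge1Dx _))// lerDr.
  rewrite -ler_pdivrMr//; apply: ltW; apply: le_lt_trans qA.
  by rewrite le_max lexx orbT.
have {}eqd : 4 * M * expR (- (q * d)) <= e.
  by apply: le_trans eqd; rewrite ler_wpM2r ?expR_ge0// lerDl.
exists N, q; split=> // phi o bphi hM ho.
pose a := Num.max 0 (t - d).
have a0 : 0 <= a by rewrite le_max lexx.
have td0 : 0 <= t + d by rewrite addr_ge0// ltW.
have mi s : measurable [set t : measurableTypeR R | s <= `|t|].
  rewrite -[X in measurable X]setTI.
  by apply: measurable_fun_le => //; exact: measurableT_comp.
have bi s : bmf (fun t : measurableTypeR R => (s <= `|t|)%R%:R : R).
  by have := bmf_indic R (mi s); under eq_fun do rewrite mem_setE.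
have bc (c : R) : bmf (fun _ : measurableTypeR R => c) by exact: bmf_cst.
pose kern s := N%:R * (1 - expR (- (q * s))) ^+ N.-1.
have k0 s : 0 <= s -> 0 <= kern s.
  move=> s0; rewrite mulr_ge0// exprn_ge0// subr_ge0 -[leRHS]expR0 ler_expR.
  by rewrite oppr_le0 mulr_ge0// ltW.
have bk : bmf (fun s : measurableTypeR R => kern `|s|).
  split.
    apply: measurable_funM => //; apply: measurable_funX.
    apply: measurable_funB => //; apply: measurableT_comp => //.
    apply: measurableT_comp => //.
    by apply: measurable_funM => //; exact: measurableT_comp.
  exists N%:R => s; rewrite ger0_norm ?k0// /kern -[leRHS]mulr1 ler_wpM2l//.
  have h0 : 0 <= 1 - expR (- (q * `|s|)).
    by rewrite subr_ge0 -[leRHS]expR0 ler_expR oppr_le0 mulr_ge0// ltW.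
  by rewrite exprn_ile1// gerBl expR_ge0.
have mean1 : \int[explaw q]_s kern `|s| = 1.
  have := @max_exp_mean_tail N q 0 isT q0 (lexx 0).
  rewrite mulr0 oppr0 expR0 subrr expr0n /= subr0 => <-.
  rewrite (@max_exp_meanE N q (fun t => (0 <= t)%R%:R) isT q0 (bi 0)).
  by apply: eq_Rintegral => s _; rewrite normr_ge0 mulr1.
(* Within d of t the error is o; elsewhere it is at most 2M, and the two indicators pick out s >= t
   + d and s < max 0 (t - d). *)
pose bound s := o + 2 * M * ((t + d <= s)%R%:R + (1 - (a <= s)%R%:R)).
have hb s : 0 <= s -> `|phi s - phi t| <= bound s.
  move=> s0; have [sd|] := leP `|s - t| d.
    rewrite (le_trans (ho s s0 sd))// lerDl mulr_ge0//.
      by rewrite mulr_ge0.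
    by case: (a <= s); case: (t + d <= s); rewrite /= ?subrr ?subr0 ?addr0 ?add0r.
  have o0 : 0 <= o by rewrite (le_trans _ (ho t (ltW t0) _))// subrr normr0 ltW.
  have h2M : `|phi s - phi t| <= 2 * M.
    rewrite (le_trans (ler_normB _ _))// (_ : 2 * M = M + M); last by ring.
    by rewrite lerD// hM// ltW.
  rewrite /bound lter_normr => /orP[h|h].
    have -> : (t + d <= s) by lra.
    rewrite (le_trans h2M)// -[leLHS]add0r lerD//.
    rewrite -[leLHS]mulr1 ler_wpM2l ?mulr_ge0// lerDl.
    by case: (a <= s); rewrite /= ?subrr ?subr0.
  have -> : (a <= s) = false.
    by apply/negbTE; rewrite -ltNge /a lt_max; apply/orP; right; lra.
  rewrite subr0 (le_trans h2M)// -[leLHS]add0r lerD//.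
  by rewrite -[leLHS]mulr1 ler_wpM2l ?mulr_ge0// lerDr.
have bb : bmf (fun s : measurableTypeR R => bound `|s|).
  apply: bmfD; first exact: bc.
  apply: bmfZ; apply: bmfD; first exact: bi.
  by apply: bmfB; [exact: bc|exact: bi].
have bkphi := bmfM bk bphi.
rewrite max_exp_meanE//.
have -> : \int[explaw q]_s (kern `|s| * phi `|s|) - phi t =
    \int[explaw q]_s (kern `|s| * (phi `|s| - phi t)).
  rewrite -[X in _ - X]mulr1 -mean1 -Ex_Z// -Ex_B//; last exact: bmfZ.
  by apply: eq_Rintegral => s _; ring.
have bkd : bmf (fun s : measurableTypeR R => kern `|s| * (phi `|s| - phi t)).
  by apply: bmfM => //; apply: bmfB => //; exact: bc.
have bkb : bmf (fun s : measurableTypeR R => kern `|s| * bound `|s|) by exact: bmfM.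
apply: (@le_trans _ _ (\int[explaw q]_s (kern `|s| * bound `|s|))).
  rewrite ler_norml -Ex_N//; apply/andP; split; apply: Ex_le => //.
  - exact: bmfN.
  - move=> s; rewrite -mulrN ler_wpM2l ?k0//.
    by have := hb _ (normr_ge0 s); rewrite ler_norml => /andP[].
  - move=> s; rewrite ler_wpM2l ?k0//.
    by have := hb _ (normr_ge0 s); rewrite ler_norml => /andP[].
have tail s : 0 <= s -> \int[explaw q]_u (kern `|u| * (s <= `|u|)%R%:R) =
    1 - (1 - expR (- (q * s))) ^+ N.
  move=> s0; rewrite -max_exp_mean_tail//.
  by rewrite (@max_exp_meanE N q (fun t => (s <= t)%R%:R) isT q0 (bi s)).
have -> : \int[explaw q]_s (kern `|s| * bound `|s|) = o + 2 * M *
    ((1 - (1 - expR (- (q * (t + d)))) ^+ N) + (1 - expR (- (q * a))) ^+ N).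
  have bki s := bmfM bk (bi s).
  transitivity (\int[explaw q]_s ((o + 2 * M) * kern `|s| +
      (2 * M * (kern `|s| * (t + d <= `|s|)%R%:R) - 2 * M * (kern `|s| * (a <= `|s|)%R%:R)))).
    by apply: eq_Rintegral => s _; rewrite /bound; ring.
  rewrite Ex_D; [|exact: bmfZ|by apply: bmfB; exact: bmfZ].
  rewrite Ex_B; [|exact: bmfZ|exact: bmfZ].
  rewrite (Ex_Z _ _ bk) (Ex_Z _ _ (bki (t + d))) (Ex_Z _ _ (bki a)) mean1 !tail//.
  by ring.
rewrite lerD2l (le_trans _ eqd)//.
rewrite (_ : 4 * M * _ = 2 * M * (expR (- (q * d)) + expR (- (q * d)))); last by ring.
rewrite ler_wpM2l ?mulr_ge0// lerD//.
  have y01 : 0 <= expR (- (q * (t + d))) <= 1.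
    by rewrite expR_ge0 -[leRHS]expR0 ler_expR oppr_le0 mulr_ge0// ltW.
  have h := bernoulli_inequality N y01.
  have eN : N%:R * expR (- (q * (t + d))) = expR (- (q * d)).
    by rewrite -eqt -expRD mulrDr opprD addrA subrr add0r.
  rewrite eN in h; move: h; move: (_ ^+ N) (expR (- (q * d))) => x y h.
  by lra.
have [ta|ta] := leP (t - d) 0.
  rewrite /a (max_idPl ta) mulr0 oppr0 expR0 subrr expr0n /= expR_ge0//.
rewrite /a (max_idPr (ltW ta)).
have y0 : 0 <= 1 - expR (- (q * (t - d))).
  by rewrite subr_ge0 -[leRHS]expR0 ler_expR oppr_le0 mulr_ge0// ltW.
(* The lower tail is (1 - y)^N <= e^(-N y) with y = e^(-q(t-d)). As N = e^(qt), the exponent is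
   -e^(qd), which is at most -qd. *)
apply: (@le_trans _ _ (expR (- (expR (- (q * (t - d))))) ^+ N)).
  apply: lerXn2r; rewrite ?nnegrE ?expR_ge0//.
  by rewrite (le_trans _ (expR_ge1Dx _)).
rewrite -expRM_natl ler_expR mulrN lerN2 -eqt -expRD.
rewrite (_ : q * t + _ = q * d); last by ring.
by rewrite (le_trans _ (expR_ge1Dx _))// lerDr.
Qed.

End maximum_of_exponentials.

(** * The Feller semigroup *)

Lemma mulr_div_add1_le (R : realFieldType) (M y : R) :
  0 <= M -> 0 <= y -> M * (y / (M + 1)) <= y.
Proof.
by move=> M0 y0; rewrite mulrA ler_pdivrMr ?ltr_wpDl// mulrDr mulr1 mulrC lerDl.
Qed.

Lemma shift_range (R : realFieldType) (a M : R) : `|a| <= M ->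
  0 <= 1 * a + M <= 2 * M /\ 0 <= -1 * a + M <= 2 * M.
Proof.
by rewrite ler_norml => /andP[h1 h2]; split; apply/andP; split; lra.
Qed.

Lemma two_sided_dist_le (R : realFieldType) (a b k e : R) :
  1 * a + k <= 1 * b + k + e -> -1 * a + k <= -1 * b + k + e -> `|a - b| <= e.
Proof. by move=> h1 h2; rewrite ler_norml; apply/andP; split; lra. Qed.

Lemma dist_le_three (R : realFieldType) (a b c e e' : R) :
  `|a - b| < e' -> `|a - c| <= e -> `|b - c| <= e + e'.
Proof.
move=> h1 h2; rewrite -[b - c](subrK (a - c)) (le_trans (ler_normD _ _))//.
by rewrite addrC lerD// (_ : b - c - (a - c) = b - a); [rewrite distrC ltW|ring].
Qed.

Section feller_extension.
Context {R : realType} {I : set R}.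
Hypothesis I_half_line : I = `[0, +oo[%classic \/ I = `]0, +oo[%classic.
Context d (Omega : measurableType d).
Variable X : process_data Omega R I.
Hypothesis X_standard : standard_process X (@infinity_cem I).
Hypothesis X_no_negative_jumps : no_negative_jumps X.
Hypothesis X_comes_down : comes_down_from_infinity X.
Hypothesis resolvent_C : forall f, space_C f -> forall q : R, 0 < q ->
  space_C (resolvent X q f).
Hypothesis resolvent_cvg : forall f, space_C f -> forall x : I,
  q * resolvent X q f x @[q --> +oo] --> f x.
Local Notation v := (set_val : I -> R).
Local Notation iota := (@to_I_infty R I).
Local Notation oo := (point_infty I).
Let mX : markov_process X := standard_markov X_standard.
Implicit Types (f g u : I_infty I -> R) (s t q : R) (x : I).

Definition restr f : option I -> R := cem_ext (f \o iota).

Lemma restr_le f (M : R) : 0 <= M -> (forall z, `|f z| <= M) -> forall z, `|restr f z| <= M.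
Proof. by move=> M0 hM; apply: cem_ext_le => // x; exact: hM. Qed.

Lemma cbf_restr f : C_infty f -> cbf (restr f).
Proof.
move=> Cf; have [cf bf _ _] := extendable_restriction I_half_line Cf.
exact: cbf_cem_ext.
Qed.

Lemma bmf_restr f : C_infty f -> bmf (restr f : cem_space I -> R).
Proof. by move=> /cbf_restr /cbf_bmf. Qed.

(** The iterated limit of the hypothesis, restated for the stopping times [passage_below] as an
    estimate with explicit thresholds. *)
Lemma comes_down_passage (e t : R) : 0 < e -> 0 < t ->
  exists B : R, forall c, B <= v c -> exists x0 : R, forall x, x0 <= v x ->
    v c < v x /\
    1 - fine (law X (Some x) [set w | (passage_below X (v c) w <= t%:E)%E]) <= e.
Proof.
move=> e0 t0.
(* The cap 1/2 makes 1 - e' positive, so an inner [lim] exceeding it cannot be the default value 0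
   and is a genuine limit. *)
pose e' := Num.min e 2^-1.
have e'0 : 0 < e' by rewrite lt_min e0 invr_gt0 ltr0n.
have e'1 : 0 < 1 - e'.
  rewrite subr_gt0 (@le_lt_trans _ _ 2^-1)//; first by rewrite ge_min lexx orbT.
  by rewrite invf_lt1// ltr1n.
have h1 : nbhs (1%E : \bar R) [set l | ((1 - e')%:E < l)%E].
  apply: open_nbhs_nbhs; split; first exact: open_ereal_gt_ereal.
  by rewrite /= lte_fin gtrBl.
have [A [_ hA]] := X_comes_down t0 h1.
(* The margin 2 leaves room for the level b = c - 1, which is positive and beyond A; a path at or
   below b is strictly below c. *)
exists (Num.max A 0 + 2) => c Bc.
have b0 : 0 < v c - 1.
  by rewrite subr_gt0 (lt_le_trans _ Bc)// ltr_wpDl ?le_max ?lexx ?orbT// ltr1n.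
have [b vb] := half_line_pt I_half_line b0.
have Ab : A < v b.
  rewrite vb ltrBrDr (lt_le_trans _ Bc)// ler_ltD ?ltr1n//.
  by rewrite le_max lexx.
have := hA _ Ab b erefl.
pose F := law X (Some x) [set w | (tau_minus X b w <= t%:E)%E] @[x --> @trace_filter R I +oo].
pose l := lim F; move=> /= hl.
have Fl : F --> l.
  by apply: contrapT => /dvgP lF; move: hl; rewrite -/F lF lte_fin ltNge ltW.
have h2 : nbhs l [set l | ((1 - e')%:E < l)%E].
  apply: open_nbhs_nbhs; split; last exact: hl.
  exact: open_ereal_gt_ereal.
have [A' [_ hA']] := Fl _ h2.
exists (Num.max (A' + 1) (v c + 1)) => x.
rewrite ge_max => /andP[A'x cx]; split; first by rewrite (lt_le_trans _ cx)// ltrDl.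
have A'x' : A' < v x by rewrite (lt_le_trans _ A'x)// ltrDl.
have := hA' _ A'x' x erefl => hx.
have sT := stopping_time_passage X_standard (v c).
have mT : measurable [set w | (passage_below X (v c) w <= t%:E)%E].
  by have [] := stopped_event_le X_standard sT (ltW t0).
have mtau : measurable [set w | (tau_minus X b w <= t%:E)%E].
  rewrite -[Z in measurable Z]setTI.
  apply: emeasurable_fun_infty_c => //; exact: (measurable_tau_minus X_standard).
have le_law : (law X (Some x) [set w | (tau_minus X b w <= t%:E)%E] <=
    law X (Some x) [set w | (passage_below X (v c) w <= t%:E)%E])%E.
  apply: (law_almost_surely _ mtau mT).
  apply: almost_surely_mono (almost_surely_right_continuous X_standard) => w rc /=.
  apply: le_trans; apply: le_ereal_inf_tmp => _ [r [r0 [y /= yb yr]] <-].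
  apply: (rational_hitting_le_hit rc (lexx 0) (ltW r0) (esym yr)).
  apply: open_nbhs_nbhs; split.
    by apply: open_sublevel; exact: set_val_continuous.
  by rewrite /= (le_lt_trans yb)// vb gtrBl.
have := lt_le_trans hx le_law.
rewrite -[law X (Some x) _]fineK ?fin_num_measure// lte_fin => /ltW h3.
have : e' <= e by rewrite ge_min lexx.
rewrite /=; move: (fine _) h3 => p h3 h4; lra.
Qed.

Lemma one_sub_expRN (y : R) : 1 - expR (- y) <= y.
Proof. by have := expR_ge1Dx (- y); lra. Qed.

(** The point c and the threshold depend on h only through the bound M. This uniformity later allows
    a whole sequence of functions to be compared at the same c. *)
Lemma mean_resolvent_near_infinity q (M e : R) : 0 < q -> 0 <= M -> 0 < e ->
  exists c (x0 : R), forall x, x0 <= v x ->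
    forall h, cbf h -> (forall z, 0 <= h z <= M) ->
    mean_resolvent X q h (Some x) <= mean_resolvent X q h (Some c) + e.
Proof.
(* The descent leaves two errors, M dl for late passage and M (1 - e^(-dl)) <= M dl for the time
   above c; each is at most e/2. *)
move=> q0 M0 e0; pose dl := e / 2 / (M + 1).
have M1 : 0 < M + 1 by rewrite ltr_wpDl.
have dl0 : 0 < dl by rewrite !divr_gt0.
have Mdl : M * dl <= e / 2.
  by rewrite mulr_div_add1_le// divr_ge0// ltW.
have t0 : 0 < dl / q by rewrite divr_gt0.
have [B hB] := comes_down_passage dl0 t0.
have B0 : 0 < Num.max B 1 by rewrite lt_max ltr01 orbT.
have [c vc] := half_line_pt I_half_line B0.
have [|x0 hx0] := hB c; first by rewrite vc le_max lexx.
exists c, x0 => x /hx0[cx px] h ch hM.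
have := @mean_resolvent_descent _ _ I_half_line _ _ _ _ X_standard X_no_negative_jumps
  x c h M M q (dl / q) cx q0 (ltW t0) ch hM M0.
move=> /(_ (fun y _ => (andP (hM (Some y))).2)) hd.
apply: (le_trans hd); rewrite addrC lerD2l [leRHS]splitr lerD//.
  by rewrite (le_trans _ Mdl)// ler_wpM2l.
rewrite (le_trans _ Mdl)// ler_wpM2l// (le_trans (one_sub_expRN _))//.
by rewrite mulrC divfK// gt_eqF.
Qed.

(** Continuity and decay at 0 are hypothesis (i); the Cauchy condition at infinity comes from the
    descent to a level c. *)
Lemma mean_resolvent_extendable q f : 0 < q -> C_infty f ->
  extendable (fun x => mean_resolvent X q (restr f) (Some x)).
Proof.
move=> q0 Cf; have ch := cbf_restr Cf.
have ef := extendable_restriction I_half_line Cf.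
have [cf bf _ _] := ef.
have eR x : mean_resolvent X q (restr f) (Some x) = q * resolvent X q (f \o iota) x.
  by rewrite (resolventE X_standard)// mulrA divff ?mul1r// gt_eqF.
have [cR [M hM] /(vanishes_at_0P I_half_line) vR] :=
  resolvent_C (extendable_space_C I_half_line ef) q0.
have [M' hM'] : exists M, forall z, `|restr f z| <= M by case: ch.
have M0 : 0 <= M' by rewrite (le_trans _ (hM' None)).
split.
- under eq_fun do rewrite eR.
  by apply: continuous_fM => //; exact: continuous_fcst.
- by exists M' => x; exact: (mean_resolvent_norm X_standard).
- move=> I0 e e0; have eq0 : 0 < e / q by rewrite divr_gt0.
  have [a a0 ha] := vR I0 _ eq0; exists a => // x /ha.
  by rewrite eR normrM gtr0_norm// ltr_pdivlMr// mulrC.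
move=> e e0; have e20 : 0 < e / 2 by rewrite divr_gt0.
have MM0 : 0 <= 2 * M' by rewrite mulr_ge0.
have [c [x0 hx]] := mean_resolvent_near_infinity q0 MM0 e20.
have hc x : x0 <= v x ->
    `|mean_resolvent X q (restr f) (Some x) - mean_resolvent X q (restr f) (Some c)| <= e / 2.
  move=> /hx h.
  (* The one-sided estimate for the nonnegative functions M' + f and M' - f gives the two-sided one
     for f. *)
  have c1 : cbf (fun z => 1 * restr f z + M') by apply: cbfZD => //; exact: cbf_cst.
  have c2 : cbf (fun z => -1 * restr f z + M') by apply: cbfZD => //; exact: cbf_cst.
  have := h _ c1; have := h _ c2.
  rewrite !(mean_resolventZD X_standard)//; try exact: cbf_cst.
  rewrite !mean_resolvent_cst => h1 h2.
  apply: (@two_sided_dist_le _ _ _ M').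
    by apply: h2 => z; have [] := shift_range (hM' z).
  by apply: h1 => z; have [] := shift_range (hM' z).
exists x0 => x y /ltW /hc h1 /ltW /hc h2.
by rewrite [e]splitr (le_trans (ler_distD (mean_resolvent X q (restr f) (Some c)) _ _))// lerD// distrC.
Qed.

Definition ext_resolvent q f : I_infty I -> R :=
  match pselect (0 < q /\ C_infty f) with
  | left h => projT1 (cid2 (extendable_extension I_half_line
      (mean_resolvent_extendable h.1 h.2)))
  | right _ => f
  end.

Lemma ext_resolventP q f : 0 < q -> C_infty f -> C_infty (ext_resolvent q f) /\
  forall x, ext_resolvent q f (iota x) = mean_resolvent X q (restr f) (Some x).
Proof.
move=> q0 Cf; rewrite /ext_resolvent; case: pselect => [h|[]//].
by case: cid2 => F /= CF hF.
Qed.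

(** On I this is hypothesis (ii). At infinity it is enough to use (ii) at one far point c: for h =
    |f - f(oo)|, small beyond c, the descent bounds the mean of h from any x far above c by the mean
    from c plus small errors. The threshold on q depends on c and not on x, so the bound passes to
    the limit as x tends to infinity. *)
Lemma ext_resolvent_cvg f z (e : R) : C_infty f -> 0 < e ->
  exists Q : R, forall q, Q <= q -> 0 < q -> `|ext_resolvent q f z - f z| <= e.
Proof.
move=> Cf e0; have ch := cbf_restr Cf.
have ef := extendable_restriction I_half_line Cf.
have cvgI (k : I -> R) x (e' : R) : extendable k -> 0 < e' -> exists Q : R, forall q, Q <= q -> 0 < q ->
    `|mean_resolvent X q (cem_ext k) (Some x) - k x| <= e'.
  move=> ek e'0; have [ck bk _ _] := ek.
  have /cvgrPdist_le/(_ e' e'0)[Q [_ hQ]] := @resolvent_cvg k (extendable_space_C I_half_line ek) x.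
  exists (Q + 1) => q Qq q0.
  have := hQ q; rewrite (lt_le_trans _ Qq) ?ltrDl// => /(_ isT).
  by rewrite (resolventE X_standard)// mulrA divff ?mul1r ?gt_eqF// distrC.
case: (I_infty_cases z) => [[x ->]|->].
  have [Q hQ] := cvgI (f \o iota) x e ef e0; exists Q => q Qq q0.
  by have [_ ->//] := ext_resolventP q0 Cf; exact: hQ.
have e40 : 0 < e / 4 by rewrite divr_gt0.
have [M hM] := C_infty_bounded Cf.
have M0 : 0 <= M by rewrite (le_trans _ (hM oo)).
pose h (z : option I) := `|restr f z - f oo|.
have h0 z' : 0 <= h z' <= 2 * M.
  rewrite normr_ge0 (le_trans (ler_normB _ _))//.
  by rewrite (_ : 2 * M = M + M); [rewrite lerD// restr_le|ring].
have chf : cbf h.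
  split; last by exists (2 * M) => z'; rewrite normr_id; case/andP: (h0 z').
  apply: continuous_fnorm; apply: continuous_fB; last exact: continuous_fcst.
  by case: ch.
have [A hA] : exists A : R, forall y, A < v y -> `|f (iota y) - f oo| < e / 4.
  by have [cf _] := Cf; have [_ +] := (continuous_I_inftyP f).1 cf; exact.
have M20 : 0 < e / 4 / (2 * M + 1) by rewrite !divr_gt0// ltr_wpDl// mulr_ge0.
have [B hB] := comes_down_passage M20 ltr01.
have c0 : 0 < Num.max B (`|A| + 1) by rewrite lt_max ltr_wpDl// orbT.
have [c vc] := half_line_pt I_half_line c0.
have [|x0 hx0] := hB c; first by rewrite vc le_max lexx.
have hmc y : v c <= v y -> h (Some y) <= e / 4.
  move=> cy; apply/ltW/hA; apply: lt_le_trans cy; rewrite vc lt_max.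
  by apply/orP; right; rewrite (le_lt_trans (ler_norm _))// ltrDl.
(* Subtracting |f(oo)| brings h into C: when 0 is not in I, f tends to 0 at 0 and h to |f(oo)|. This
   is also the value of h at the cemetery. *)
pose k x := `|f (iota x) - f oo| - `|f oo|.
have ek : extendable k.
  split.
  - apply: continuous_fB; last exact: continuous_fcst.
    apply: continuous_fnorm; apply: continuous_fB; last exact: continuous_fcst.
    by case: ef.
  - exists (3 * M) => x; rewrite (le_trans (ler_normB _ _))// !normr_id.
    rewrite (_ : 3 * M = (M + M) + M); last by ring.
    by rewrite lerD// (le_trans (ler_normB _ _))// lerD.
  - move=> I0 e' e'0; have [_ _ vf _] := ef.
    have [a a0 ha] := vf I0 _ e'0; exists a => // x /ha /=.
    apply: le_lt_trans; rewrite /k -(normrN (f oo)).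
    rewrite (le_trans (ler_dist_dist _ _))//; rewrite opprK.
    by rewrite subrK.
  - move=> e' e'0; have [_ _ _ cf] := ef.
    have [A' hA'] := cf _ e'0; exists A' => x y Ax Ay.
    rewrite (le_trans _ (hA' x y Ax Ay))// /k opprB addrA subrK.
    rewrite (le_trans (ler_dist_dist _ _))//.
    by rewrite opprB addrA subrK.
have hk : h = (fun z => 1 * cem_ext k z + `|f oo|).
  apply/funext => -[x|]; rewrite /h /restr /= ?mul1r; first by rewrite subrK.
  by rewrite sub0r normrN add0r.
have ck : cbf (cem_ext k) by have [? ? _ _] := ek; exact: cbf_cem_ext.
have [Q hQ] := cvgI k c _ ek e40.
exists Q => q Qq q0.
have [Ce ee] := ext_resolventP q0 Cf.
have mc : mean_resolvent X q h (Some c) <= e / 2.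
  rewrite hk (mean_resolventZD X_standard)//; last exact: cbf_cst.
  rewrite mean_resolvent_cst mul1r.
  have := hQ q Qq q0; rewrite ler_norml => /andP[_].
  have := hmc c (lexx _); rewrite hk /= mul1r.
  by move: (mean_resolvent _ _ _ _) => y; lra.
have main x : x0 <= v x -> `|ext_resolvent q f (iota x) - f oo| <= e.
  move=> /hx0[cx px]; rewrite ee.
  have e4 := ltW e40.
  have := @mean_resolvent_descent _ _ I_half_line _ _ _ _ X_standard X_no_negative_jumps
    x c h (2 * M) (e / 4) q 1 cx q0 ler01 chf h0 e4 hmc.
  move=> hd.
  have hx : mean_resolvent X q h (Some x) <= e.
    apply: (le_trans hd).
    have h1 : 2 * M * (1 - fine (law X (Some x) [set w | (passage_below X (v c) w <= 1%:E)%E])) <= e / 4.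
      apply: (@le_trans _ _ (2 * M * (e / 4 / (2 * M + 1)))); first by rewrite ler_wpM2l// mulr_ge0.
      by rewrite mulr_div_add1_le// mulr_ge0.
    have h2 : e / 4 * (1 - expR (- (q * 1))) <= e / 4.
      by rewrite -[leRHS]mulr1 ler_wpM2l// gerBl expR_ge0.
    rewrite [leRHS](_ : _ = e / 4 + e / 4 + e / 2); last by field.
    by rewrite lerD// lerD.
  have ch1 : cbf (fun z => 1 * restr f z + (- f oo)) by apply: cbfZD => //; exact: cbf_cst.
  have ch2 : cbf (fun z => -1 * restr f z + f oo) by apply: cbfZD => //; exact: cbf_cst.
  have := mean_resolvent_le X_standard q (Some x) ch1 chf.
  have := mean_resolvent_le X_standard q (Some x) ch2 chf.
  rewrite !(mean_resolventZD X_standard)//; try exact: cbf_cst.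
  rewrite !mean_resolvent_cst => h1 h2.
  have {}h1 : -1 * mean_resolvent X q (restr f) (Some x) + f oo <= mean_resolvent X q h (Some x).
    by apply: h1 => z'; rewrite /h mulN1r -normrN opprB addrC ler_norm.
  have {}h2 : 1 * mean_resolvent X q (restr f) (Some x) + - f oo <= mean_resolvent X q h (Some x).
    by apply: h2 => z'; rewrite /h mul1r ler_norm.
  apply: le_trans hx; rewrite ler_norml lerNl opprB; apply/andP; split.
    by rewrite addrC -mulN1r.
  by rewrite -[X in X - _]mul1r.
apply/ler_addgt0Pr => e' e'0.
have [A' hA'] : exists A : R, forall y, A < v y ->
    `|ext_resolvent q f (iota y) - ext_resolvent q f oo| < e'.
  by have [cf _] := Ce; have [_ +] := (continuous_I_inftyP _).1 cf; exact.
have c1 : 0 < Num.max (`|x0|) `|A'| + 1 by rewrite ltr_wpDl// le_max normr_ge0.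
have [y vy] := half_line_pt I_half_line c1.
have hy1 : x0 <= v y.
  by rewrite vy (le_trans (ler_norm _))// ler_wpDr// le_max lexx.
have hy2 : A' < v y.
  by rewrite vy (le_lt_trans (ler_norm _))// ltr_pwDr// le_max lexx orbT.
exact: dist_le_three (hA' y hy2) (main y hy1).
Qed.

End feller_extension.

Lemma dist_le_range (R : realFieldType) (a b h : R) : 0 <= a <= h -> 0 <= b <= h ->
  `|a - b| <= h.
Proof.
move=> /andP[? ?] /andP[? ?]; rewrite ler_norml; apply/andP; split; lra.
Qed.

(** * The semigroup obtained from the extended resolvents *)

Section semigroup_construction.
Context {R : realType} {I : set R}.
Hypothesis I_half_line : I = `[0, +oo[%classic \/ I = `]0, +oo[%classic.
Context d (Omega : measurableType d).
Variable X : process_data Omega R I.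
Hypothesis X_standard : standard_process X (@infinity_cem I).
Local Notation v := (set_val : I -> R).
Local Notation iota := (@to_I_infty R I).
Local Notation oo := (point_infty I).
Let mX : markov_process X := standard_markov X_standard.
Let nX := standard_normal X_standard.
Let hI : hausdorff_space I := @half_line_hausdorff R I.
Implicit Types (f g u : I_infty I -> R) (s t q : R) (x : I).

(** [J q] stands for q R^q extended to I'. The absence of negative jumps and the descent from
    infinity enter the construction through the three properties below. *)
Variable J : R -> (I_infty I -> R) -> I_infty I -> R.
Hypothesis J_C : forall q f, 0 < q -> C_infty f -> C_infty (J q f).
Hypothesis JE : forall q f x, 0 < q -> C_infty f ->
  J q f (iota x) = mean_resolvent X q (restr f) (Some x).
Hypothesis J_cvg : forall f z (e : R), C_infty f -> 0 < e ->
  exists Q : R, forall q, Q <= q -> 0 < q -> `|J q f z - f z| <= e.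

Local Notation P t f x := (transition X t (restr f) (Some x)).

Lemma restrZD (a : R) f g :
  restr (fun z => a * f z + g z) = (fun z => a * restr f z + restr g z).
Proof. by apply/funext => -[x|] //=; rewrite mulr0 addr0. Qed.

Lemma transitionZD_restr t (a : R) f g x : 0 <= t -> C_infty f -> C_infty g ->
  P t (fun z => a * f z + g z) x = a * P t f x + P t g x.
Proof.
by move=> t0 Cf Cg; rewrite restrZD transitionZD//; exact: (bmf_restr I_half_line).
Qed.

Lemma transitionB_restr t f g x : 0 <= t -> C_infty f -> C_infty g ->
  P t (fun z => f z - g z) x = P t f x - P t g x.
Proof.
move=> t0 Cf Cg; have := transitionZD_restr (-1) x t0 Cg Cf.
rewrite mulN1r addrC => <-; congr (transition _ _ _ _); congr restr.
by apply/funext => z; rewrite mulN1r addrC.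
Qed.

Lemma transition_restr_norm t f x (M : R) : 0 <= M -> 0 <= t -> C_infty f ->
  (forall z, `|f z| <= M) -> `|P t f x| <= M.
Proof.
move=> M0 t0 Cf hM; apply: (transition_norm X_standard) => //.
  exact: (bmf_restr I_half_line).
exact: restr_le.
Qed.

Lemma transition_restr_le t f g z : 0 <= t -> C_infty f -> C_infty g ->
  (forall z, f z <= g z) -> transition X t (restr f) z <= transition X t (restr g) z.
Proof.
move=> t0 Cf Cg fg; apply: transition_le => //; try exact: (bmf_restr I_half_line).
by case=> [x|] //=; exact: fg.
Qed.

Lemma transition_restr_ge0 t f z : 0 <= t -> C_infty f ->
  (forall z, 0 <= f z) -> 0 <= transition X t (restr f) z.
Proof.
move=> t0 Cf f0; rewrite -[leLHS](transition_cst X t 0 z).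
apply: transition_le => //; first exact: bmf_cst.
  exact: (bmf_restr I_half_line).
by case=> [x|] //=; exact: f0.
Qed.

Lemma transition_restr_None t f : 0 <= t -> C_infty f -> transition X t (restr f) None = 0.
Proof. by move=> t0 Cf; rewrite transition_None//; exact: (bmf_restr I_half_line). Qed.

Lemma restr_J q f : 0 < q -> C_infty f -> restr (J q f) = mean_resolvent X q (restr f).
Proof.
move=> q0 Cf; apply/funext => -[x|] /=; first exact: JE.
rewrite /mean_resolvent -[LHS](Ex_cst (explaw q)).
by apply: eq_Rintegral => t _; rewrite transition_restr_None.
Qed.

Lemma J_ZD q (a : R) f g : 0 < q -> C_infty f -> C_infty g ->
  J q (fun z => a * f z + g z) = (fun z => a * J q f z + J q g z).
Proof.
move=> q0 Cf Cg; have Cfg := C_inftyD (C_inftyZ a Cf) Cg.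
apply: (eq_I_infty I_half_line).
- by case: (J_C q0 Cfg).
- by case: (C_inftyD (C_inftyZ a (J_C q0 Cf)) (J_C q0 Cg)).
- move=> x; rewrite !JE// restrZD (mean_resolventZD X_standard)//; exact: (cbf_restr I_half_line).
Qed.

Definition supermedian (a : R) u := [/\ C_infty u, forall z, 0 <= u z &
  forall s x, 0 <= s -> expR (- (a * s)) * P s u x <= u (iota x)].

Lemma supermedian_J q f : 0 < q -> C_infty f -> (forall z, 0 <= f z) -> supermedian q (J q f).
Proof.
move=> q0 Cf f0; have CJ := J_C q0 Cf; have ch := cbf_restr I_half_line Cf.
have r0 z : 0 <= restr f z by case: z => [x|] //=; exact: f0.
split=> // [z|s x s0].
- rewrite -oppr_le0 -mulN1r.
  apply: (le_I_infty I_half_line (f := fun z => -1 * J q f z)).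
    by case: (C_inftyZ (-1) CJ).
  move=> x; rewrite JE// mulN1r oppr_le0 -[leLHS](mean_resolvent_cst X q 0 (Some x)).
  by apply: (mean_resolvent_le X_standard) => //; exact: cbf_cst.
- rewrite JE// restr_J//; apply: (mean_resolvent_supermedian X_standard) => //.
  by rewrite -restr_J//; exact: (bmf_restr I_half_line).
Qed.

Lemma supermedian_mono (a b : R) u : a <= b -> supermedian a u -> supermedian b u.
Proof.
move=> ab [Cu u0 su]; split=> // s x s0; apply: le_trans (su s x s0).
by rewrite ler_wpM2r ?transition_restr_ge0// ler_expR lerN2 ler_wpM2r.
Qed.

Lemma supermedian_min (a : R) u u' : supermedian a u -> supermedian a u' ->
  supermedian a (fun z => Num.min (u z) (u' z)).
Proof.
move=> [Cu u0 su] [Cu' u0' su']; have Cm := C_infty_min Cu Cu'; split=> //.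
  by move=> z; rewrite le_min u0 u0'.
move=> s x s0; rewrite le_min; apply/andP; split.
  apply: le_trans (su s x s0); rewrite ler_wpM2l ?expR_ge0//.
  by apply: transition_restr_le => // z; rewrite ge_min lexx.
apply: le_trans (su' s x s0); rewrite ler_wpM2l ?expR_ge0//.
by apply: transition_restr_le => // z; rewrite ge_min lexx orbT.
Qed.

Lemma supermedianD (a : R) u u' : supermedian a u -> supermedian a u' ->
  supermedian a (fun z => u z + u' z).
Proof.
move=> [Cu u0 su] [Cu' u0' su']; split; first exact: C_inftyD.
  by move=> z; rewrite addr_ge0.
move=> s x s0; have := transitionZD_restr 1 x s0 Cu Cu'.
under eq_fun do rewrite mul1r; move=> ->.
by rewrite mul1r mulrDr lerD// ?su ?su'.
Qed.

(** The rate a is existential: supermedian functions remain so at larger rates, so two differences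
    can be brought to a common one. *)
Definition supermedian_difference u := exists a u1 u2,
  [/\ 0 < a, supermedian a u1, supermedian a u2 & u = (fun z => u1 z - u2 z)].

Lemma supermedian_difference_C u : supermedian_difference u -> C_infty u.
Proof. by move=> [a [u1 [u2 [_ [C1 _ _] [C2 _ _] ->]]]]; exact: C_inftyB. Qed.

Lemma supermedian_differenceN u : supermedian_difference u ->
  supermedian_difference (fun z => - u z).
Proof.
move=> [a [u1 [u2 [a0 s1 s2 ->]]]]; exists a, u2, u1; split=> //.
by apply/funext => z; rewrite opprB.
Qed.

(** Minima of supermedian functions are supermedian, and min(u1 - u2, u1' - u2') = min(u1 + u2', u1'
    + u2) - (u2 + u2'). *)
Lemma supermedian_difference_min u u' : supermedian_difference u ->
  supermedian_difference u' -> supermedian_difference (fun z => Num.min (u z) (u' z)).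
Proof.
move=> [a [u1 [u2 [a0 s1 s2 ->]]]] [a' [u1' [u2' [a0' s1' s2' ->]]]].
pose b := Num.max a a'.
have ab : a <= b by rewrite le_max lexx.
have ab' : a' <= b by rewrite le_max lexx orbT.
move: s1 s2 s1' s2' => /(supermedian_mono ab) s1 /(supermedian_mono ab) s2.
move=> /(supermedian_mono ab') s1' /(supermedian_mono ab') s2'.
exists b, (fun z => Num.min (u1 z + u2' z) (u1' z + u2 z)), (fun z => u2 z + u2' z).
split; first by rewrite lt_max a0.
- by apply: supermedian_min; exact: supermedianD.
- exact: supermedianD.
- apply/funext => z; rewrite -[RHS]addrC addr_minr; congr Num.min; by ring.
Qed.

Lemma supermedian_difference_max u u' : supermedian_difference u ->
  supermedian_difference u' -> supermedian_difference (fun z => Num.max (u z) (u' z)).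
Proof.
move=> /supermedian_differenceN s /supermedian_differenceN s'.
have := supermedian_differenceN (supermedian_difference_min s s').
by congr supermedian_difference; apply/funext => z; rewrite oppr_min !opprK.
Qed.

(** Write f = |f| - (|f| - f), a difference of nonnegative functions. *)
Lemma supermedian_difference_J q f : 0 < q -> C_infty f -> supermedian_difference (J q f).
Proof.
move=> q0 Cf; have C1 := C_infty_norm Cf; have C2 := C_inftyB C1 Cf.
exists q, (J q (fun z => `|f z|)), (J q (fun z => `|f z| - f z)); split=> //.
- exact: supermedian_J.
- by apply: supermedian_J => // z; rewrite subr_ge0 ler_norm.
- have := J_ZD (-1) q0 C2 C1.
  rewrite [X in J q X = _](_ : _ = f); last by apply/funext => z; ring.
  by move=> ->; apply/funext => z; ring.
Qed.

(** At two given points of I', infinity included, J q f is close to f as soon as q is large enough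
    for both; this is all that the lattice form of Stone's theorem asks. *)
Lemma supermedian_difference_dense f e : C_infty f -> 0 < e ->
  exists2 u, supermedian_difference u & forall z, `|u z - f z| <= e.
Proof.
move=> Cf e0; apply: (lattice_approximation oo _ _ _ Cf) => //.
- exact: supermedian_difference_C.
- exact: supermedian_difference_min.
- exact: supermedian_difference_max.
move=> x y e' e'0; have e20 : 0 < e' / 2 by rewrite divr_gt0.
have [Q hQ] := J_cvg x Cf e20; have [Q' hQ'] := J_cvg y Cf e20.
pose q := Num.max (Num.max Q Q') 1.
have q0 : 0 < q by rewrite lt_max ltr01 orbT.
have lt2 a : a <= e' / 2 -> a < e' by move=> /le_lt_trans; apply; lra.
exists (J q f); first exact: supermedian_difference_J.
by split; apply: lt2; [apply: hQ|apply: hQ'] => //; rewrite !le_max lexx ?orbT.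
Qed.

Definition strongly_continuous u := forall e : R, 0 < e -> exists2 dl : R, 0 < dl &
  forall s x, 0 <= s -> s <= dl -> `|P s u x - u (iota x)| <= e.

Lemma supermedian_decrease (a : R) u s t x : supermedian a u -> 0 <= s -> s <= t ->
  expR (- (a * t)) * P t u x <= expR (- (a * s)) * P s u x.
Proof.
move=> [Cu u0 su] s0 st; have ts0 : 0 <= t - s by rewrite subr_ge0.
have bu := bmf_restr I_half_line Cu.
have -> : t = s + (t - s) by rewrite addrC subrK.
rewrite (transition_add mX)//.
have -> : - (a * (s + (t - s))) = - (a * s) + - (a * (t - s)) by ring.
rewrite expRD -mulrA ler_wpM2l ?expR_ge0//.
have bt : bmf (transition X (t - s) (restr u) : cem_space I -> R) by exact: bmf_transition.
have := transitionZD mX (expR (- (a * (t - s)))) (Some x) s0 bt (bmf_cst _ 0).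
rewrite transition_cst addr0 => <-.
apply: transition_le => //.
  by apply: bmfD; [exact: bmfZ|exact: bmf_cst].
by case=> [y|] /=; rewrite addr0; [exact: su|rewrite transition_restr_None// mulr0].
Qed.

(* u - e^(-as) P_s u increases with s, and at s = 1/l it is at most e times
   u - l R^(l + a) u, which tends to 0 pointwise and hence uniformly, by Dini. *)
Lemma supermedian_strongly_continuous (a : R) u : 0 < a -> supermedian a u ->
  strongly_continuous u.
Proof.
move=> a0 su; have [Cu u0 sm] := su.
have [M hM] := C_infty_bounded Cu; have M0 : 0 <= M by rewrite (le_trans _ (hM oo)).
pose r (n : nat) : R := n.+1%:R / (n.+1%:R + a).
(* [r n] times J at rate n+1+a is (n+1) R^(n+1+a), so on I [w n] is the mean of u - e^(-aT) P_T u
   for T exponential of rate n+1. *)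
pose w n z := u z - r n * J (n.+1%:R + a) u z.
have na0 n : 0 < n.+1%:R + a by rewrite addr_gt0.
have cw n : continuous (w n).
  by case: (C_inftyB Cu (C_inftyZ (r n) (J_C (na0 n) Cu))).
have rE n : 1 - r n = a / (n.+1%:R + a).
  by rewrite /r -[X in X - _](divff (lt0r_neq0 (na0 n))) -mulrBl addrAC subrr add0r.
have r01 n : 0 <= r n <= 1.
  rewrite /r ler_pdivrMr ?na0// mul1r lerDl (ltW a0) andbT.
  by rewrite divr_ge0// ltW ?na0.
have w0 z e : 0 < e -> exists n, w n z < e.
  move=> e0; have e30 : 0 < e / 3 by rewrite divr_gt0.
  have [Q hQ] := J_cvg z Cu e30.
  pose n := Num.truncn (Num.max `|Q| (a * (M + 1) / (e / 3))).
  have hn : Num.max `|Q| (a * (M + 1) / (e / 3)) <= n.+1%:R by rewrite ltW ?truncnS_gt.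
  exists n; have Qn : Q <= n.+1%:R + a.
    by rewrite (le_trans (ler_norm _))// ler_wpDr ?(ltW a0)// (le_trans _ hn)// le_max lexx.
  have hJ := hQ _ Qn (na0 n).
  have an : a * (M + 1) / (n.+1%:R + a) <= e / 3.
    rewrite ler_pdivrMr// [leRHS]mulrC -ler_pdivrMr// ler_wpDr ?(ltW a0)// (le_trans _ hn)//.
    by rewrite le_max lexx orbT.
  have -> : w n z = (1 - r n) * u z + r n * (u z - J (n.+1%:R + a) u z).
    by rewrite /w; ring.
  apply: (@le_lt_trans _ _ (e / 3 + e / 3)); last by lra.
  apply: lerD.
    apply: le_trans an; rewrite rE [leRHS]mulrAC ler_wpM2l ?divr_ge0 ?(ltW a0) ?(ltW (na0 n))//.
    by rewrite (le_trans (ler_norm _))// (le_trans (hM z))// lerDl.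
  rewrite (le_trans (ler_norm _))// normrM distrC.
  have /andP[r0 r1] := r01 n.
  by rewrite ger0_norm// -[leRHS]mul1r ler_pM.
pose D s x := u (iota x) - expR (- (a * s)) * P s u x.
have D0 s x : 0 <= s -> 0 <= D s x by move=> s0; rewrite subr_ge0 sm.
have Dmono s t x : 0 <= s -> s <= t -> D s x <= D t x.
  by move=> s0 st; rewrite lerD2l lerN2 supermedian_decrease.
have Du s x : 0 <= s -> D s x <= u (iota x).
  by move=> s0; rewrite gerBl mulr_ge0 ?expR_ge0 ?transition_restr_ge0.
have bP x : bmf (fun t : measurableTypeR R => P `|t| u x).
  by apply: (bmf_transition_time X_standard); exact: (cbf_restr I_half_line).
have bE : bmf (fun t : measurableTypeR R => expR (- (a * `|t|))).
  split; last first.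
    exists 1 => t; rewrite ger0_norm ?expR_ge0// -expR0 ler_expR oppr_le0.
    by rewrite mulr_ge0// ltW.
  apply: measurableT_comp => //; apply: measurableT_comp => //.
  by apply: measurable_funM => //; exact: measurableT_comp.
have bD x : bmf (fun t : measurableTypeR R => D `|t| x).
  by apply: bmfB; [exact: bmf_cst|exact: bmfM].
have wE n x : w n (iota x) = \int[explaw n.+1%:R]_t D `|t| x.
  rewrite /w JE//= /mean_resolvent.
  have n0 : 0 < n.+1%:R :> R by rewrite ltr0n.
  have c1 : 1 <= 1 + a / n.+1%:R by rewrite lerDl divr_ge0 ?ltW.
  have := explaw_scale n0 c1 (bP x).
  have -> : (1 + a / n.+1%:R) * n.+1%:R = n.+1%:R + a.
    by rewrite mulrDl mul1r divfK ?lt0r_neq0.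
  have -> : 1 + a / n.+1%:R - 1 = a / n.+1%:R by ring.
  rewrite divfK ?pnatr_eq0// => ->.
  rewrite /D Ex_B//; [|exact: bmf_cst|exact: bmfM].
  rewrite Ex_cst mulrA (_ : r n * _ = 1) ?mul1r//.
  rewrite /r -[X in _ * (X + _)](divff (lt0r_neq0 n0)) -mulrDl mulrA divfK ?lt0r_neq0//.
  by rewrite divff ?lt0r_neq0.
(* An exponential time of rate n+1 exceeds 1/(n+1) with probability 1/e, and from then on D is at
   least its value at 1/(n+1). *)
have Dw n x : D (n.+1%:R)^-1 x <= expR 1 * w n (iota x).
  have n0 : 0 < n.+1%:R :> R by rewrite ltr0n.
  have ni0 : 0 <= (n.+1%:R)^-1 :> R by rewrite invr_ge0.
  have := explaw_tail n0 ni0; rewrite divff ?pnatr_eq0// => e1.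
  rewrite wE -ler_pdivrMl ?expR_gt0// -expRN -e1 mulrC -Ex_Z; last exact: bmf_ge.
  apply: Ex_le => //; first by apply: bmfZ; exact: bmf_ge.
  move=> t; case: (leP _ `|t|) => h; rewrite ?mulr1 ?mulr0; last exact: D0.
  exact: Dmono.
move=> e e0; have E1 : 0 < expR 1 :> R := expR_gt0 1.
have e20 : 0 < e / 2 by rewrite divr_gt0.
(* Either u < e' <= e/2, which bounds D, or some w n < e' and then D <= e^1 w n <= e/2. *)
pose e' := Num.min (e / 2) (e / 2 / expR 1).
have e'0 : 0 < e' by rewrite lt_min e20 divr_gt0.
have [N hN] := Dini_index Cu cw w0 e'0.
pose dl := Num.min (N.+1%:R)^-1 (e / 2 / (a * (M + 1))).
have aM : 0 < a * (M + 1) by rewrite mulr_gt0// ltr_wpDl.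
exists dl; first by rewrite lt_min invr_gt0 ltr0n divr_gt0.
move=> s x s0; rewrite le_min => /andP[sN sM].
have De : D s x <= e / 2.
  have [h|[n nN h]] := hN (iota x).
    rewrite (le_trans (Du s x s0))// (le_trans (ltW h))// ge_min lexx//.
  have sn : s <= (n.+1%:R)^-1.
    by rewrite (le_trans sN)// lef_pV2 ?posrE ?ltr0n// ler_nat.
  rewrite (le_trans (Dmono _ _ _ s0 sn))// (le_trans (Dw n x))//.
  rewrite mulrC -ler_pdivlMr// (le_trans (ltW h))// ge_min lexx orbT//.
have P0 : 0 <= P s u x by exact: transition_restr_ge0.
have PM : P s u x <= M by rewrite (le_trans (ler_norm _))// transition_restr_norm.
have as0 : 0 <= a * s by rewrite mulr_ge0// ltW.
have aMs : a * s * (M + 1) <= e / 2.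
  by rewrite mulrAC mulrC -ler_pdivlMr.
have h1 : expR (- (a * s)) * P s u x <= P s u x.
  by rewrite -[leRHS]mul1r ler_wpM2r// -expR0 ler_expR oppr_le0.
have h2 : P s u x - expR (- (a * s)) * P s u x <= e / 2.
  rewrite -[X in X - _]mul1r -mulrBl (le_trans _ aMs)// ler_pM//.
  - by rewrite subr_ge0 -expR0 ler_expR oppr_le0.
  - exact: one_sub_expRN.
  - by rewrite (le_trans PM)// lerDl.
(* Both terms of this difference lie in [0, e/2]. *)
have -> : P s u x - u (iota x) = (P s u x - expR (- (a * s)) * P s u x) - D s x.
  by rewrite /D; ring.
have e2e : e / 2 <= e by rewrite ler_pdivrMr// ler_peMr ?(ltW e0)// ler1n.
apply: le_trans e2e; apply: dist_le_range; apply/andP; split=> //; last exact: D0.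
by rewrite subr_ge0.
Qed.


Lemma strongly_continuousB u u' : C_infty u -> C_infty u' -> strongly_continuous u ->
  strongly_continuous u' -> strongly_continuous (fun z => u z - u' z).
Proof.
move=> Cu Cu' hu hu' e e0; have e20 : 0 < e / 2 by rewrite divr_gt0.
have [a a0 ha] := hu _ e20; have [b b0 hb] := hu' _ e20.
exists (Num.min a b); first by rewrite lt_min a0.
move=> s x s0; rewrite le_min => /andP[sa sb].
rewrite transitionB_restr// [leRHS]splitr.
rewrite (_ : _ - _ = (P s u x - u (iota x)) - (P s u' x - u' (iota x))); last by ring.
by rewrite (le_trans (ler_normB _ _))// lerD ?ha ?hb.
Qed.

Lemma C_infty_strongly_continuous f : C_infty f -> strongly_continuous f.
Proof.
move=> Cf e e0; have e30 : 0 < e / 3 by rewrite divr_gt0.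
have [u [a [u1 [u2 [a0 s1 s2 uE]]]] hu] := supermedian_difference_dense Cf e30.
have [C1 _ _] := s1; have [C2 _ _] := s2.
have Cu : C_infty u by rewrite uE; exact: C_inftyB.
have su : strongly_continuous u.
  rewrite uE; apply: strongly_continuousB => //;
  exact: supermedian_strongly_continuous a0 _.
have [dl dl0 hdl] := su _ e30; exists dl => // s x s0 sdl.
have h1 : `|P s u x - P s f x| <= e / 3.
  rewrite -transitionB_restr//; apply: transition_restr_norm => //; first exact: ltW.
  exact: C_inftyB.
rewrite [leRHS](_ : e = e / 3 + e / 3 + e / 3); last by field.
have h2 := hdl s x s0 sdl; have h3 := hu (iota x).
rewrite (_ : _ - _ = - (P s u x - P s f x) + (P s u x - u (iota x)) + (u (iota x) - f (iota x))); last by ring.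
by rewrite (le_trans (ler_normD _ _))// lerD// (le_trans (ler_normD _ _))// lerD// normrN.
Qed.

(** For s <= t, P_s f - P_t f = P_s (f - P_(t-s) f), so a modulus of continuity at time 0, uniform
    in space, is one at every time. *)
Lemma transition_time_continuous f s t (e dl : R) x : C_infty f ->
  (forall s x, 0 <= s -> s <= dl -> `|P s f x - f (iota x)| <= e) -> 0 <= e ->
  0 <= s -> 0 <= t -> `|s - t| <= dl -> `|P s f x - P t f x| <= e.
Proof.
move=> Cf hdl e0; wlog st : s t / s <= t => [hw s0 t0 dst|s0 t0].
  have [st|/ltW ts] := leP s t; first exact: hw.
  by rewrite distrC hw// distrC.
rewrite distrC ger0_norm ?subr_ge0// => tsdl; rewrite distrC.
have ts0 : 0 <= t - s by rewrite subr_ge0.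
have bf := bmf_restr I_half_line Cf.
have bt : bmf (transition X (t - s) (restr f) : cem_space I -> R) by exact: bmf_transition.
have {1}-> : t = s + (t - s) by rewrite addrC subrK.
rewrite (transition_add mX)//.
have := transitionZD mX (-1) (Some x) s0 bf bt.
rewrite mulN1r [X in `|X|]addrC => <-.
apply: (transition_norm X_standard) => //; first by apply: bmfD => //; exact: bmfZ.
case=> [y|]; first by rewrite /= mulN1r addrC hdl.
by rewrite transition_restr_None//= mulr0 addr0 normr0.
Qed.

Lemma transition_extendable t f : 0 <= t -> C_infty f ->
  extendable (fun x => P t f x).
Proof.
move=> t0 Cf; have bf := bmf_restr I_half_line Cf.
have ef := extendable_restriction I_half_line Cf.
have [t00|tn0] := eqVneq t 0.
  rewrite (_ : (fun x => _) = f \o iota)//; apply/funext => x.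
  by rewrite t00 (transition0 mX nX hI).
have tp : 0 < t by rewrite lt_def tn0.
have [M hM] := C_infty_bounded Cf; have M0 : 0 <= M by rewrite (le_trans _ (hM oo)).
apply: extendable_uniform => e e0; have e20 : 0 < e / 2 by rewrite divr_gt0.
have [dl dl0 hdl] := C_infty_strongly_continuous Cf e20.
have [N [q [N0 q0 hN]]] := max_exp_mean_approx tp M0 dl0 e20.
pose c (k : nat) : R := 'C(N, k.+1)%:R * (-1) ^+ k.
pose g z := \sum_(k < N) c k * J (k.+1%:R * q) f z.
have Cg : C_infty g.
  apply: (@C_infty_sum _ _ N (fun k z => c k * J (k.+1%:R * q) f z)) => // k.
  by apply: C_inftyZ; apply: J_C => //; rewrite mulr_gt0.
exists (g \o iota); first exact: extendable_restriction.
move=> x; rewrite distrC [leRHS]splitr.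
have -> : (g \o iota) x = max_exp_mean N q (fun t => P t f x).
  rewrite /g /max_exp_mean /=; apply: eq_bigr => k _.
  by rewrite JE ?mulr_gt0.
apply: hN.
- by apply: (bmf_transition_time X_standard); exact: cbf_restr.
- by move=> s s0; exact: transition_restr_norm.
- by move=> s s0 std; apply: (transition_time_continuous x Cf hdl) => //; exact: ltW.
Qed.

Definition ext_semigroup t f : I_infty I -> R :=
  match pselect (0 <= t /\ C_infty f) with
  | left h => projT1 (cid2 (extendable_extension I_half_line
      (transition_extendable h.1 h.2)))
  | right _ => f
  end.

Lemma ext_semigroupP t f : 0 <= t -> C_infty f -> C_infty (ext_semigroup t f) /\
  forall x, ext_semigroup t f (iota x) = P t f x.
Proof.
move=> t0 Cf; rewrite /ext_semigroup; case: pselect => [h|[]//].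
by case: cid2 => F /= CF hF.
Qed.

Lemma sup_norm_le (f : I_infty I -> R) (e : R) : (forall z, `|f z| <= e) -> sup_norm f <= e.
Proof.
move=> fe; apply: ge_sup; first by exists `|f oo|, oo.
by move=> _ [z _ <-].
Qed.

Lemma le_sup_norm f z : C_infty f -> `|f z| <= sup_norm f.
Proof.
move=> /C_infty_bounded[M hM]; apply: ub_le_sup; last by exists z.
by exists M => _ [y _ <-].
Qed.

Lemma norm_le_I_infty f (e : R) : continuous f -> (forall x, `|f (iota x)| <= e) ->
  forall z, `|f z| <= e.
Proof.
move=> cf fe; apply: (le_I_infty I_half_line (f := fun z => `|f z|)) => //.
exact: continuous_fnorm.
Qed.

Lemma ext_semigroup_feller : feller_semigroup ext_semigroup.
Proof.
have hP := ext_semigroupP.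
have eqI f g : C_infty f -> C_infty g -> (forall x, f (iota x) = g (iota x)) -> f = g.
  by move=> [cf _] [cg _]; exact: (eq_I_infty I_half_line).
have restrP t f : 0 <= t -> C_infty f ->
    restr (ext_semigroup t f) = transition X t (restr f).
  move=> t0 Cf; apply/funext => -[x|] /=; last by rewrite transition_restr_None.
  by have [_ ->] := hP t f t0 Cf.
split.
- by move=> t f t0 Cf; have [] := hP t f t0 Cf.
- move=> t a f g t0 Cf Cg; have Cfg := C_inftyD (C_inftyZ a Cf) Cg.
  have [C1 e1] := hP t _ t0 Cfg; have [C2 e2] := hP t _ t0 Cf.
  have [C3 e3] := hP t _ t0 Cg.
  apply: eqI => //; first exact: C_inftyD (C_inftyZ a C2) C3.
  by move=> x; rewrite e1 e2 e3 transitionZD_restr.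
- move=> f Cf; have [C1 e1] := hP 0 _ (lexx 0) Cf; apply: eqI => // x.
  by rewrite e1 (transition0 mX nX hI)//; exact: (bmf_restr I_half_line).
- move=> s t f s0 t0 Cf; have st0 : 0 <= s + t by exact: addr_ge0.
  have [C1 e1] := hP _ _ st0 Cf; have [C2 e2] := hP _ _ t0 Cf.
  have [C3 e3] := hP _ _ s0 C2.
  apply: eqI => // x; rewrite e1 e3 restrP// (transition_add mX)//.
  exact: (bmf_restr I_half_line).
- move=> t f t0 Cf f0 z; have [C1 e1] := hP _ _ t0 Cf.
  rewrite -oppr_le0 -mulN1r.
  apply: (le_I_infty I_half_line (f := fun z => -1 * ext_semigroup t f z)).
    by case: (C_inftyZ (-1) C1).
  by move=> x; rewrite mulN1r oppr_le0 e1 transition_restr_ge0.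
- move=> t f t0 Cf; have [[c1 _] e1] := hP _ _ t0 Cf.
  apply: sup_norm_le; apply: norm_le_I_infty => // x.
  rewrite e1; apply: transition_restr_norm => //; last by move=> z; exact: le_sup_norm.
  by rewrite (le_trans _ (le_sup_norm oo Cf)).
- move=> f Cf; apply/cvgrPdist_le => e e0.
  have [dl dl0 hdl] := C_infty_strongly_continuous Cf e0; near=> t.
  have t0 : 0 <= t by near: t; exact: nbhs_right_ge.
  have [C1 e1] := hP _ _ t0 Cf.
  rewrite sub0r normrN ger0_norm; last first.
    by rewrite (le_trans _ (le_sup_norm oo (C_inftyB C1 Cf))).
  apply: sup_norm_le; apply: norm_le_I_infty; first by case: (C_inftyB C1 Cf).
  by move=> x; rewrite e1; apply: hdl => //; near: t; exact: nbhs_right_le.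
Unshelve. all: by end_near. Qed.

End semigroup_construction.

(** * The Hunt process started at infinity *)

Section cutoff_functions.
Context {R : realType} {I : set R}.
Hypothesis I_half_line : I = `[0, +oo[%classic \/ I = `]0, +oo[%classic.
Local Notation v := (set_val : I -> R).
Local Notation iota := (@to_I_infty R I).
Local Notation oo := (point_infty I).

Lemma cutoff_extension (G : R -> R) (A c C : R) : continuous G ->
  (forall r, 0 <= G r <= 1) -> (forall r, A <= r -> G r = c) ->
  (~ I 0 -> forall r, 0 < r -> G r <= C * r) ->
  exists f : I_infty I -> R, [/\ C_infty f, forall x, f (iota x) = G (v x),
    f oo = c & forall z, 0 <= f z <= 1].
Proof.
move=> cG G01 GA GC.
have eG : extendable (fun x : I => G (v x)).
  split.
  - move=> x; apply: (@continuous_comp _ _ _ v G); first exact: set_val_continuous.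
    exact: cG.
  - by exists 1 => x; have /andP[? ?] := G01 (v x); rewrite ger0_norm.
  - move=> I0 e e0; have C1 : 0 < `|C| + 1 by rewrite ltr_wpDl.
    exists (e / (`|C| + 1)); first by rewrite divr_gt0.
    move=> x; rewrite ltr_pdivlMr// => xe.
    have x0 := half_line_gt0 I_half_line x I0.
    have /andP[? ?] := G01 (v x); rewrite ger0_norm//.
    rewrite (le_lt_trans (GC I0 _ x0))// (le_lt_trans _ xe)// mulrC ler_wpM2l ?(ltW x0)//.
    by rewrite (le_trans (ler_norm _))// lerDl.
  - by move=> e e0; exists A => x y /ltW xA /ltW yA; rewrite !GA// subrr normr0 ltW.
have [f Cf fE] := extendable_extension I_half_line eG.
have foo : f oo = c.
  apply/eqP; rewrite -subr_eq0 -normr_le0; apply/ler_addgt0Pr => e e0.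
  have [cf _] := Cf; have [_ /(_ e e0)[A' hA']] := (continuous_I_inftyP f).1 cf.
  have y0 : 0 < Num.max `|A| `|A'| + 1 by rewrite ltr_wpDl// le_max normr_ge0.
  have [y vy] := half_line_pt I_half_line y0.
  have Ay : A <= v y by rewrite vy (le_trans (ler_norm _))// ler_wpDr// le_max lexx.
  have A'y : A' < v y.
    by rewrite vy (le_lt_trans (ler_norm _))// ltr_pwDr// le_max lexx orbT.
  by have := hA' y A'y; rewrite fE GA// distrC add0r => /ltW.
exists f; split=> // z; case: (I_infty_cases z) => [[x ->]|->]; first by rewrite fE.
by rewrite foo -(GA A (lexx A)).
Qed.

Definition ramp (b r : R) : R := Num.min 1 (Num.max 0 (r - b)).

Lemma continuous_ramp b : continuous (ramp b).
Proof.
apply: continuous_fmin; first exact: continuous_fcst.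
apply: continuous_fmax; first exact: continuous_fcst.
by apply: continuous_fB; [move=> x|exact: continuous_fcst].
Qed.

Lemma ramp01 b r : 0 <= ramp b r <= 1.
Proof. by rewrite le_min ler01 le_max lexx/= ge_min lexx. Qed.

Lemma ramp_eq0 b r : r <= b -> ramp b r = 0.
Proof.
by move=> rb; rewrite /ramp (max_idPl _) ?subr_le0// (min_idPr _)// ler01.
Qed.

Lemma ramp_eq1 b r : b + 1 <= r -> ramp b r = 1.
Proof.
by move=> br; rewrite /ramp (min_idPl _)// le_max lerBrDl br orbT.
Qed.

Lemma near_infinity_functions : exists F : nat -> I_infty I -> R,
  forall n, [/\ C_infty (F n), forall z, 0 <= F n z <= 1, F n oo = 1 &
    forall x, v x <= n%:R -> F n (iota x) = 0].
Proof.
suff /choice[F hF] : forall n : nat, exists f : I_infty I -> R,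
    [/\ C_infty f, forall z, 0 <= f z <= 1, f oo = 1 &
    forall x, v x <= n%:R -> f (iota x) = 0] by exists F.
move=> n.
have [] := @cutoff_extension (ramp n%:R) (n%:R + 1) 1 1.
- exact: continuous_ramp.
- exact: ramp01.
- exact: ramp_eq1.
- move=> _ r r0; rewrite mul1r /ramp ge_min; apply/orP; right.
  by rewrite ge_max (ltW r0) lerBlDr lerDl ler0n.
- move=> f [Cf fE foo f01]; exists f; split=> // x xn.
  by rewrite fE ramp_eq0.
Qed.

Lemma exhausting_functions : exists G : nat -> I_infty I -> R,
  forall n, [/\ C_infty (G n), forall z, 0 <= G n z <= 1,
    \forall z \near oo, G n z = 0 &
    forall x, v x <= n.+1%:R -> (~ I 0 -> n.+1%:R^-1 <= v x) -> G n (iota x) = 1].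
Proof.
suff /choice[G hG] : forall n : nat, exists f : I_infty I -> R,
  [/\ C_infty f, forall z, 0 <= f z <= 1, \forall z \near oo, f z = 0 &
    forall x, v x <= n.+1%:R -> (~ I 0 -> n.+1%:R^-1 <= v x) -> f (iota x) = 1] by exists G.
move=> n.
(* If 0 is not in I, membership in C_infty(I') also requires a limit 0 at 0; the slope n+1 lets the
   factor reach 1 at 1/(n+1). *)
pose k r : R := if `[< I 0 >] then 1 else Num.min 1 (Num.max 0 (n.+1%:R * r)).
have ck : continuous k.
  rewrite /k; case: asboolP => _; first exact: continuous_fcst.
  apply: continuous_fmin; first exact: continuous_fcst.
  apply: continuous_fmax; first exact: continuous_fcst.
  by apply: continuous_fM; [exact: continuous_fcst|move=> x].
have k01 r : 0 <= k r <= 1.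
  rewrite /k; case: asboolP => _; first by rewrite ler01 lexx.
  by rewrite le_min ler01 le_max lexx/= ge_min lexx.
have [] := @cutoff_extension (fun r => (1 - ramp n.+1%:R r) * k r) (n.+1%:R + 1) 0 n.+1%:R.
- apply: continuous_fM => //; apply: continuous_fB; first exact: continuous_fcst.
  exact: continuous_ramp.
- move=> r; have /andP[r0 r1] := ramp01 n.+1%:R r; have /andP[k0 k1] := k01 r.
  by rewrite mulr_ge0 ?subr_ge0//= mulr_ile1 ?subr_ge0// gerBl.
- by move=> r nr; rewrite ramp_eq1// subrr mul0r.
- move=> I0 r r0; have /andP[r0' r1] := ramp01 n.+1%:R r; have /andP[k0 k1] := k01 r.
  rewrite (@le_trans _ _ (k r))//; first by rewrite ler_piMl// gerBl.
  rewrite /k asboolF// ge_min; apply/orP; right.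
  by rewrite ge_max mulr_ge0 ?(ltW r0)//=.
move=> f [Cf fE foo f01]; exists f; split=> //.
  apply/nbhs_oo; split=> //; exists (n.+1%:R + 1) => y /ltW ny.
  by rewrite fE ramp_eq1// subrr mul0r.
move=> x xn x0; rewrite fE ramp_eq0// subr0 mul1r /k.
case: asboolP => // I0; rewrite (min_idPl _)// le_max; apply/orP; right.
by rewrite mulrC -ler_pdivrMr ?ltr0n// div1r x0.
Qed.

End cutoff_functions.

(** * Products along time grids *)

Section fdd.
Context d (Omega : measurableType d) (R : realType) (E : topologicalType).
Variable X : process_data Omega R E.
Hypothesis mX : markov_process X.
Variables (G : cem_space E -> R) (h : R).
Hypotheses (bG : bmf G) (h0 : 0 <= h).

(** This is E_z[G(X_h) G(X_2h) ... G(X_Kh)]. Written with transition operators alone, it can be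
    compared between two processes that share them. *)
Definition grid_mean (K : nat) : cem_space E -> R :=
  iter K (fun F => transition X h (fun z => G z * F z)) (fun=> 1).

Definition grid_product (K : nat) (s : R) (w : Omega) : R :=
  \prod_(j < K) G (position X (s + j.+1%:R * h) w).

Lemma bmf_grid_mean K : bmf (grid_mean K).
Proof.
elim: K => [|K IH]; first exact: bmf_cst.
by apply: (bmf_transition mX) => //; exact: bmfM.
Qed.

Lemma bmf_grid_product K s : 0 <= s -> bmf (grid_product K s).
Proof.
move=> s0; elim: K => [|K IH].
  by rewrite /grid_product; under eq_fun do rewrite big_ord0; exact: bmf_cst.
rewrite /grid_product; under eq_fun do rewrite big_ord_recr/=.
apply: bmfM => //; apply: (bmf_position mX) => //.
by rewrite addr_ge0// mulr_ge0.
Qed.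

Lemma bmf_filtration_mono s t (Z : Omega -> R) : 0 <= s -> s <= t ->
  bmf (Z : g_sigma_algebraType (filtration X s) -> R) ->
  bmf (Z : g_sigma_algebraType (filtration X t) -> R).
Proof.
move=> s0 st [mZ hZ]; split=> // _ B mB; have t0 := le_trans s0 st.
have := mZ measurableT B mB; rewrite !setTI measurable_filtrationE//.
by rewrite measurable_filtrationE//; exact: (filtration_nondecreasing mX).
Qed.

(** The weight Z from the past is what makes the induction go through: the first factor of the
    product is absorbed into Z before time moves on by h. *)
Lemma grid_mean_product K z s (Z : Omega -> R) : 0 <= s ->
  bmf (Z : g_sigma_algebraType (filtration X s) -> R) ->
  \int[law X z]_w (Z w * grid_product K s w) =
  \int[law X z]_w (Z w * grid_mean K (position X s w)).
Proof.
elim: K s Z => [|K IH] s Z s0 bZ.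
  by apply: eq_Rintegral => w _; rewrite /grid_product big_ord0.
have sh0 : 0 <= s + h by exact: addr_ge0.
have bGh : bmf ((fun w => G (position X (s + h) w)) :
    g_sigma_algebraType (filtration X (s + h)) -> R).
  exact: bmf_filtration_position.
have bZ' : bmf (Z : g_sigma_algebraType (filtration X (s + h)) -> R).
  by apply: bmf_filtration_mono bZ => //; rewrite lerDl.
rewrite -[RHS](markov_functional mX z h0 s0 bZ (bmfM bG (bmf_grid_mean K))).
have e1 := IH _ _ sh0 (bmfM bZ' bGh).
under [RHS]eq_Rintegral do rewrite mulrA.
rewrite -e1; apply: eq_Rintegral => w _.
rewrite /grid_product big_ord_recl/= mul1r -mulrA; congr (_ * (_ * _)).
apply: eq_bigr => j _; congr (G (position X _ w)).
by rewrite /bump leq0n add1n -[j.+2%:R]natr1; ring.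
Qed.

Lemma mean_grid_product K z s : 0 <= s ->
  \int[law X z]_w grid_product K s w = transition X s (grid_mean K) z.
Proof.
move=> s0; have := grid_mean_product K z s0 (bmf_cst _ 1).
by under eq_Rintegral do rewrite mul1r; under [RHS]eq_Rintegral do rewrite mul1r.
Qed.

Hypothesis G01 : forall z, 0 <= G z <= 1.

Lemma grid_product01 K s w : 0 <= grid_product K s w <= 1.
Proof.
rewrite /grid_product; elim: K => [|K /andP[IH0 IH1]]; first by rewrite big_ord0 ler01 lexx.
rewrite big_ord_recr/=; have /andP[g0 g1] := G01 (position X (s + K.+1%:R * h) w).
by rewrite mulr_ge0//= mulr_ile1.
Qed.

Lemma grid_product_eq0 K s w (j : nat) : (0 < j <= K)%N ->
  G (position X (s + j%:R * h) w) = 0 -> grid_product K s w = 0.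
Proof.
case: j => // j /= jK Gj; rewrite /grid_product (bigD1 (Ordinal jK))//=.
by rewrite Gj mul0r.
Qed.

End fdd.

Lemma cvg_eventually_cst (T : topologicalType) (u : nat -> T) (l : T) (N : nat) :
  (forall n, (N <= n)%N -> u n = l) -> u n @[n --> \oo] --> l.
Proof. by move=> h; apply: cvg_near_cst; exists N => // n; exact: h. Qed.

Lemma cvg_le_bound (R : realType) (u : nat -> R) (l a : R) (N : nat) :
  u n @[n --> \oo] --> l -> (forall n, (N <= n)%N -> u n <= a) -> l <= a.
Proof.
move=> ul ua; rewrite -(cvg_lim _ ul)//; apply: limr_le; first exact: cvgP ul.
by exists N => // n; exact: ua.
Qed.

Section never_at_infinity.
Context {R : realType} {I : set R}.
Hypothesis I_half_line : I = `[0, +oo[%classic \/ I = `]0, +oo[%classic.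
Context d (Omega : measurableType d) (X : process_data Omega R I).
Hypothesis X_standard : standard_process X (@infinity_cem I).
Hypothesis X_no_negative_jumps : no_negative_jumps X.
Hypothesis X_comes_down : comes_down_from_infinity X.
Context d' (Omega' : measurableType d') (Y : process_data Omega' R (I_infty I)).
Variable cem : set_system (option (I_infty I)).
Hypothesis Y_standard : standard_process Y cem.
Local Notation v := (set_val : I -> R).
Local Notation iota := (@to_I_infty R I).
Local Notation oo := (point_infty I).
Let mX : markov_process X := standard_markov X_standard.
Let mY : markov_process Y := standard_markov Y_standard.
Let hI : hausdorff_space I := @half_line_hausdorff R I.
Let hI' : hausdorff_space (I_infty I) := @I_infty_hausdorff R I.
Implicit Types (f : I_infty I -> R) (s t q : R) (x : I).

Hypothesis transition_C : forall t f, 0 <= t -> C_infty f ->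
  C_infty (fun z => transition Y t (cem_ext f) (Some z)).
Hypothesis transition_iota : forall t f x, 0 <= t -> C_infty f ->
  transition Y t (cem_ext f) (Some (iota x)) = transition X t (restr f) (Some x).

Lemma cbf_ext f : C_infty f -> cbf (cem_ext f).
Proof. by move=> Cf; apply: cbf_cem_ext; [case: Cf|exact: C_infty_bounded]. Qed.

Lemma bmf_ext f : C_infty f -> bmf (cem_ext f : cem_space (I_infty I) -> R).
Proof. by move=> /cbf_ext /cbf_bmf. Qed.

Lemma mean_resolvent_oo_le q f (a x0 : R) : 0 < q -> C_infty f ->
  (forall x, x0 <= v x -> mean_resolvent X q (restr f) (Some x) <= a) ->
  mean_resolvent Y q (cem_ext f) (Some oo) <= a.
Proof.
move=> q0 Cf ha; have ch := cbf_ext Cf.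
have pt (n : nat) : {x : I | v x = `|x0| + n.+1%:R}.
  by apply: half_line_pt => //; rewrite ltr_wpDl.
pose u n := iota (sval (pt n)).
have [_ [M hM]] := ch.
have cu (g : I_infty I -> R) : C_infty g -> g (u n) @[n --> \oo] --> g oo.
  move=> [cg _]; apply/cvgrPdist_le => e e0.
  have [_ /(_ e e0)[A hA]] := (continuous_I_inftyP g).1 cg.
  exists (Num.truncn `|A|) => // n /= An; rewrite distrC ltW// hA//.
  rewrite (svalP (pt n)) (le_lt_trans (ler_norm _))// ltr_wpDl//.
  by rewrite (lt_le_trans (truncnS_gt _))// ler_nat.
have [_ cv] := Ex_dominated (explaw q)
  (F := fun n t => transition Y `|t| (cem_ext f) (Some (u n)))
  (f := fun t => transition Y `|t| (cem_ext f) (Some oo)) (M := M)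
  (fun n => bmf_measurable (bmf_transition_time Y_standard (Some (u n)) ch))
  (fun n t => transition_norm Y_standard _ (normr_ge0 t) (cbf_bmf ch) hM)
  (fun t => cu _ (transition_C (normr_ge0 t) Cf)).
apply: (cvg_le_bound (N := 0%N) cv) => n _.
have := ha (sval (pt n)); rewrite (svalP (pt n)) (le_trans (ler_norm _)) ?lerDl//.
move=> /(_ isT); apply: le_trans; rewrite le_eqVlt; apply/orP; left; apply/eqP.
by apply: eq_Rintegral => t _; exact: transition_iota.
Qed.

Definition at_infinity : cem_space (I_infty I) -> R := fun z => (z \in [set Some oo])%:R.

Lemma bmf_at_infinity : bmf at_infinity.
Proof. by apply: bmf_indic; exact: measurable_cem_set1. Qed.

(* The functions F n tend to the indicator of infinity; their resolvents at
   infinity are within e of those at some c in I, which tend to 0. *)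
Lemma occupation_infinity :
  bmf (fun t : measurableTypeR R => transition Y `|t| at_infinity (Some oo)) /\
  \int[explaw 1]_t transition Y `|t| at_infinity (Some oo) <= 0.
Proof.
have [F hF] := near_infinity_functions I_half_line.
have CF n : C_infty (F n) by have [] := hF n.
have F01 n z : 0 <= restr (F n) z <= 1.
  by case: z => [x|] /=; [have [_ + _ _] := hF n; exact|rewrite lexx ler01].
have F1 n z : `|cem_ext (F n) z| <= 1.
  case: z => [z|] /=; last by rewrite normr0.
  by have [_ /(_ z)/andP[? ?] _ _] := hF n; rewrite ger0_norm.
have F0 x : exists N, forall n, (N <= n)%N -> F n (iota x) = 0.
  exists (Num.truncn (v x)).+1 => n Nn; have [_ _ _] := hF n; apply.
  by rewrite (le_trans (ltW (truncnS_gt _)))// ler_nat.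
have Fcvg z : cem_ext (F n) z @[n --> \oo] --> at_infinity z.
  rewrite /at_infinity; case: z => [z|] /=.
    case: (I_infty_cases z) => [[x ->]|->].
      have [N hN] := F0 x; apply: (@cvg_eventually_cst _ _ _ N) => n Nn.
      rewrite hN// (_ : _ \in _ = false)//; apply/negP.
      by move=> /set_mem /Some_inj /iota_neq_oo.
    apply: (@cvg_eventually_cst _ _ _ 0%N) => n _; have [_ _ -> _] := hF n.
    by rewrite mem_set.
  apply: (@cvg_eventually_cst _ _ _ 0%N) => n _.
  by rewrite (_ : _ \in _ = false)//; apply/negP; rewrite inE.
have Rcvg z : restr (F n) z @[n --> \oo] --> (0 : R).
  case: z => [x|]; last by apply: (@cvg_eventually_cst _ _ _ 0%N).
  by have [N hN] := F0 x; exact: (@cvg_eventually_cst _ _ _ N).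
have cF n := cbf_ext (CF n).
have cR n := cbf_restr I_half_line (CF n).
have R1 n z : `|restr (F n) z| <= 1.
  by have /andP[? ?] := F01 n z; rewrite ger0_norm.
have [b1 c1] := Ex_dominated (explaw 1)
  (F := fun n t => transition Y `|t| (cem_ext (F n)) (Some oo))
  (f := fun t => transition Y `|t| at_infinity (Some oo)) (M := 1)
  (fun n => bmf_measurable (bmf_transition_time Y_standard (Some oo) (cF n)))
  (fun n t => transition_norm Y_standard _ (normr_ge0 t) (cbf_bmf (cF n)) (F1 n))
  (fun t => (Ex_dominated (law Y (Some oo))
    (fun n => bmf_measurable (bmf_position mY (normr_ge0 t) (cbf_bmf (cF n))))
    (fun n w => F1 n _) (fun w => Fcvg (position Y `|t| w))).2).
split=> //; apply/ler_addgt0Pr => e e0; rewrite add0r.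
have e20 : 0 < e / 2 by rewrite divr_gt0.
have [c [x0 hc]] := mean_resolvent_near_infinity I_half_line X_standard
  X_no_negative_jumps X_comes_down (ltr01 : 0 < 1 :> R) (ler01 : 0 <= 1 :> R) e20.
have [_ c2] := Ex_dominated (explaw 1)
  (F := fun n t => transition X `|t| (restr (F n)) (Some c))
  (f := fun t => \int[law X (Some c)]_w 0) (M := 1)
  (fun n => bmf_measurable (bmf_transition_time X_standard (Some c) (cR n)))
  (fun n t => transition_norm X_standard _ (normr_ge0 t) (cbf_bmf (cR n)) (R1 n))
  (fun t => (Ex_dominated (law X (Some c))
    (fun n => bmf_measurable (bmf_position mX (normr_ge0 t) (cbf_bmf (cR n))))
    (fun n w => R1 n _) (fun w => Rcvg (position X `|t| w))).2).
move: c2; rewrite Ex_cst Ex_cst => /cvgrPdist_le/(_ _ e20)[N _ hN].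
apply: (cvg_le_bound (N := N) c1) => n Nn.
apply: (mean_resolvent_oo_le (x0 := x0)) => // x /hc h.
rewrite (le_trans (h _ (cR n) (F01 n)))// [leRHS]splitr lerD2r.
by have := hN n Nn; rewrite /= sub0r normrN; apply: le_trans; exact: ler_norm.
Qed.

(** Otherwise m(s), the probability that Y_s is at infinity, would be positive on all of [0, dl), an
    interval of positive exponential measure, although its mean over an exponential time is at most
    0. *)
Lemma avoid_infinity_time (dl : R) : 0 < dl ->
  exists2 s, 0 < s < dl & transition Y s at_infinity (Some oo) = 0.
Proof.
move=> dl0; have [bm m0] := occupation_infinity.
set m := (fun t : measurableTypeR R => _) in bm.
have mge0 t : 0 <= transition Y `|t| at_infinity (Some oo).
  rewrite -[leLHS](transition_cst Y `|t| 0 (Some oo)).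
  by apply: (transition_le mY) => //; [exact: bmf_cst|exact: bmf_at_infinity].
apply: contrapT => hn.
have mpos s : 0 <= s -> s < dl -> 0 < transition Y s at_infinity (Some oo).
  move=> s0 sdl; have [->|sn0] := eqVneq s 0.
    rewrite (transition0 mY (standard_normal Y_standard) hI' _ bmf_at_infinity).
    by rewrite /at_infinity mem_set.
  rewrite lt_def -[s in leRHS]ger0_norm// mge0 andbT; apply/eqP => ms; apply: hn.
  by exists s => //; rewrite lt_def sn0 s0.
(* The functions min(1, (k+1) m) have integral at most (k+1) times that of m, hence at most 0, and
   they tend to the indicator of m > 0. *)
have bk k : bmf (fun t : measurableTypeR R => Num.min 1 (k.+1%:R * m t)).
  split; last first.
    exists 1 => t; rewrite ger0_norm; first by rewrite ge_min lexx.
    by rewrite le_min ler01 mulr_ge0 ?mge0.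
  apply: measurable_minr => //; apply: measurable_funM => //.
  exact: bmf_measurable bm.
pose ind (t : measurableTypeR R) : R := (0 < m t)%R%:R.
have hk k (t : measurableTypeR R) : `|Num.min 1 (k.+1%:R * m t)| <= 1.
  rewrite ger0_norm; first by rewrite ge_min lexx.
  by rewrite le_min ler01 mulr_ge0 ?mge0.
have ck (t : measurableTypeR R) : Num.min 1 (k.+1%:R * m t) @[k --> \oo] --> ind t.
  rewrite /ind; have := mge0 t; rewrite -/(m t) le_eqVlt => /orP[/eqP e|mt].
    apply: (@cvg_eventually_cst _ _ _ 0%N) => n _.
    by rewrite -e mulr0 ltxx (min_idPr _)// ler01.
  rewrite mt; apply: (@cvg_eventually_cst _ _ _ (Num.truncn (m t)^-1)) => n hn'.
  rewrite (min_idPl _)// -ler_pdivrMr// div1r (le_trans (ltW (truncnS_gt _)))//.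
  by rewrite ler_nat.
have [bi ci] := Ex_dominated (explaw 1)
  (F := fun k (t : measurableTypeR R) => Num.min 1 (k.+1%:R * m t)) (f := ind) (M := 1)
  (fun k => bmf_measurable (bk k)) hk ck.
have i0 : \int[explaw 1]_t ind t <= 0.
  apply: (cvg_le_bound (N := 0%N) ci) => k _.
  rewrite (@le_trans _ _ (k.+1%:R * \int[explaw 1]_t m t))//.
    rewrite -Ex_Z//; apply: Ex_le => //; first exact: bmfZ.
    by move=> t; rewrite ge_min lexx orbT.
  by rewrite pmulr_rle0.
have : 1 - \int[explaw 1]_t (dl <= `|t|)%R%:R <= \int[explaw 1]_t ind t.
  rewrite -[X in X - _](Ex_cst (explaw (1 : R))) -Ex_B; [|exact: bmf_cst|exact: bmf_ge].
  apply: Ex_le => //; first by apply: bmfB; [exact: bmf_cst|exact: bmf_ge].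
  move=> t; rewrite /ind; case: (leP dl `|t|) => h; first by rewrite subrr.
  by rewrite subr0 mpos.
rewrite explaw_tail ?(ltW dl0)// mul1r => h.
have := le_trans h i0; rewrite subr_le0 -expR0 ler_expR lerNr oppr0.
by rewrite leNgt dl0.
Qed.

End never_at_infinity.

(** * Paths of X stay in compact sets while alive *)

Section staying_in_compacts.
Context {R : realType} {I : set R}.
Hypothesis I_half_line : I = `[0, +oo[%classic \/ I = `]0, +oo[%classic.
Context d (Omega : measurableType d) (X : process_data Omega R I).
Variable cem : set_system (option I).
Hypothesis X_standard : standard_process X cem.
Local Notation v := (set_val : I -> R).
Local Notation iota := (@to_I_infty R I).
Local Notation oo := (point_infty I).
Let mX : markov_process X := standard_markov X_standard.
Let hI : hausdorff_space I := @half_line_hausdorff R I.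

(** Complements of an exhaustion of I by compact sets: [0, n+1] if 0 is in I, and [1/(n+1), n+1]
    otherwise. *)
Definition far_set (n : nat) : set I := [set y | n.+1%:R < v y] `|`
  (if `[< I 0 >] then set0 else [set y | v y < n.+1%:R^-1]).

Lemma open_far_set n : open (far_set n).
Proof.
apply: openU.
  by apply: open_gt; [exact: continuous_fcst|exact: set_val_continuous].
case: asboolP => _; first exact: open0.
by apply: open_sublevel; exact: set_val_continuous.
Qed.

Lemma far_set_decreasing m n : (m <= n)%N -> far_set n `<=` far_set m.
Proof.
move=> mn y [/= h|h]; first by left; rewrite /= (le_lt_trans _ h)// ler_nat ltnS.
right; move: h; case: asboolP => // _ /= /lt_le_trans; apply.
by rewrite lef_pV2 ?posrE// ler_nat ltnS.
Qed.

Lemma closure_far_set y : ~ (forall n, closure (far_set n) y).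
Proof.
move=> hy.
have {}hy n : n.+1%:R <= v y \/ (~ I 0 /\ v y <= n.+1%:R^-1).
  have := hy n; rewrite /far_set closureU => -[h|]; [left|case: asboolP => I0].
  - have cm : continuous (fun y : I => 0 - v y).
      by apply: continuous_fB; [exact: continuous_fcst|exact: set_val_continuous].
    have : closure [set y | 0 - v y < - n.+1%:R] y.
      by move: h; apply: closure_subset => z /=; rewrite sub0r ltrN2.
    by move=> /(closure_sublevel cm) /=; rewrite sub0r lerN2.
  - by rewrite closure0.
  - by move=> /(closure_sublevel (@set_val_continuous R I)); right.
pose n := Num.truncn (Num.max (v y) (v y)^-1).
have : Num.max (v y) (v y)^-1 < n.+1%:R by exact: truncnS_gt.
rewrite gt_max => /andP[h1 h2]; case: (hy n) => [|[I0 h]]; first by rewrite leNgt h1.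
have v0 := half_line_gt0 I_half_line y I0.
by move: h2; rewrite invf_plt ?posrE// ltNge h.
Qed.

Definition alive (E : topologicalType) : cem_space E -> R := cem_ext (fun=> 1).

Lemma bmf_alive (E : topologicalType) : bmf (@alive E).
Proof.
apply: cbf_bmf; apply: cbf_cem_ext; first exact: continuous_fcst.
by exists 1 => x; rewrite normr1.
Qed.

Variable G : nat -> I_infty I -> R.
Hypotheses (G_C : forall n, C_infty (G n)) (G01 : forall n z, 0 <= G n z <= 1)
  (G1 : forall n x, v x <= n.+1%:R -> (~ I 0 -> n.+1%:R^-1 <= v x) -> G n (iota x) = 1).

Lemma restr01 n z : 0 <= restr (G n) z <= 1.
Proof. by case: z => [x|] /=; [exact: G01|rewrite lexx ler01]. Qed.

Lemma far_setC n y : ~ far_set n y -> G n (iota y) = 1.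
Proof.
move=> h; apply: G1 => [|I0]; rewrite leNgt; apply/negP => h'; apply: h; first by left.
by right; rewrite asboolF.
Qed.

(** Take for r n the probability to be alive at time t and to have entered [far_set n] by then;
    outside this event and a null set, all factors of the grid product are 1 for a path alive at t.
    Entering every [far_set n] by time t < lifetime would, by quasi-left-continuity, put the path in
    the empty intersection of their closures; hence r n tends to 0. The bound does not depend on the
    number K of grid points. *)
Lemma stay_lower_bound x (q : rat) : 0 < ratr q :> R -> exists r : nat -> R,
  r n @[n --> \oo] --> (0 : R) /\ forall n K, (0 < K)%N ->
  transition X (ratr q) (@alive I) (Some x) - r n <=
  grid_mean X (restr (G n)) (ratr q / K%:R) K (Some x).
Proof.
move=> q0; set t := ratr q; have t0 : 0 <= t by exact: ltW.
have [N [mN N0 hN]] := almost_surelyI (almost_surely_right_continuous X_standard)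
  (sup_rational_hitting_closure X_standard open_far_set (lexx 0) far_set_decreasing).
pose bad n := ([set w | position X t w <> None] `&`
  [set w | (rational_hitting X 0 (far_set n) w <= t%:E)%E]) `\` N.
have mbad n : measurable (bad n).
  apply: measurableD => //; apply: measurableI.
    rewrite [X in measurable X](_ : _ = ~` [set w | position X t w = None])//.
    apply: measurableC; rewrite -[X in measurable X]setTI.
    exact: (position_measurable mX t0 measurableT (measurable_cem_set1 hI None)).
  by have [] := stopped_event_le X_standard (stopping_time_rational_hitting X_standard (lexx 0) (open_far_set n)) t0.
exists (fun n => \int[law X (Some x)]_w (w \in bad n)%:R); split.
  have c w : (w \in bad n)%:R @[n --> \oo] --> (0 : R).
    have [n nb] : exists n, ~ bad n w.
      apply: contrapT => /forallNP hb.
      have {}hb n : bad n w by exact: contrapT.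
      have [[tN _] Nw] := hb 0%N; have [rc hD] := hN w Nw.
      case ty : (position X t w) tN => [y|]// _.
      have tl := lifetime_gt X_standard rc t0 ty.
      have [|z _ hz] := hD _; last exact: closure_far_set hz.
      apply: le_lt_trans tl; apply: ge_ereal_sup => _ [n _ <-].
      by have [[_ +] _] := hb n.
    apply: (@cvg_eventually_cst _ _ _ n) => m nm.
    rewrite (_ : w \in bad m = false)//; apply/negP => /set_mem [[h1 h2] h3].
    apply: nb; split=> //; split=> //=; apply: le_trans h2.
    by apply: rational_hitting_mono; exact: far_set_decreasing.
  have b1 n w : `|(w \in bad n)%:R : R| <= 1.
    by case: (_ \in _); rewrite ?normr1 ?normr0.
  have [_] := Ex_dominated (law X (Some x)) (F := fun n w => (w \in bad n)%:R)
    (f := fun=> 0) (M := 1) (fun n => bmf_measurable (bmf_indic R (mbad n))) b1 c.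
  by rewrite Ex_cst.
move=> n K K0; set h := t / K%:R.
have h0 : 0 <= h by rewrite divr_ge0.
have bG := bmf_restr I_half_line (G_C n).
rewrite -[leRHS](transition0 mX (standard_normal X_standard) hI _ (bmf_grid_mean mX bG h0 K)).
rewrite -(mean_grid_product mX bG h0)//.
have bgp := bmf_grid_product mX bG h0 K (lexx 0).
have bal := bmf_position mX t0 (@bmf_alive I).
rewrite /transition -Ex_B//; last exact: bmf_indic.
rewrite -[leRHS]addr0 -[X in _ + X](_ : fine (law X (Some x) N) = 0); last by rewrite N0.
rewrite -Ex_indic// -Ex_D//; last exact: bmf_indic.
apply: Ex_le; [by apply: bmfB => //; exact: bmf_indic|by apply: bmfD => //; exact: bmf_indic|].
move=> w; have /andP[p0 p1] := grid_product01 X h (restr01 n) K 0 w.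
have al1 (z : cem_space I) : alive z <= 1 :> R by case: z => [z|] /=; rewrite ?lexx ?ler01.
have ind0 (A : set Omega) : 0 <= (w \in A)%:R :> R by [].
have [Nw|Nw] := boolP (w \in N).
  by rewrite (@le_trans _ _ 1) ?lerDr//; rewrite lerBlDr (le_trans (al1 _))// lerDl ind0.
rewrite /= addr0.
case ty : (position X t w) => [y|] /=; last by rewrite (le_trans _ p0)// sub0r oppr_le0.
have [wb|wb] := boolP (w \in bad n); first by rewrite subrr.
rewrite subr0 /grid_product big1// => j _; rewrite add0r.
(* Here the rationality of q matters: the grid times are rational, so [rational_hitting] registers
   what happens at them. *)
have [r rE] : exists r : rat, j.+1%:R * h = ratr r.
  by exists (j.+1%:R * (q / K%:R)); rewrite rmorphM/= fmorph_div/= !ratr_nat.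
have rt : ratr r <= t.
  rewrite -rE /h mulrA ler_pdivrMr ?ltr0n// mulrC ler_wpM2l// ler_nat; exact: ltn_ord.
have r0 : 0 <= ratr r :> R by rewrite -rE mulr_ge0.
rewrite rE; case ry : (position X (ratr r) w) => [y'|] /=; last first.
  by have := coord_absorbed mX r0 rt ry; rewrite ty.
apply: far_setC => fy; move/negP: wb; apply; apply/mem_set; split; last first.
  by rewrite -notin_setE.
split; first by rewrite /= ty.
apply: (@le_trans _ _ (ratr r)%:E); last by rewrite lee_fin.
apply: ereal_inf_lbound; exists (ratr r) => //.
by split; [exact: r0|exists r|rewrite ry; exists y'].
Qed.

End staying_in_compacts.

Lemma cvg_ge_bound (R : realType) (u : nat -> R) (l a : R) :
  u n @[n --> \oo] --> l -> (forall n, a <= u n) -> a <= l.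
Proof.
move=> ul ua; rewrite -(cvg_lim _ ul)//; apply: limr_ge; first exact: cvgP ul.
by near=> n; exact: ua.
Unshelve. all: by end_near. Qed.

(** * Y does not visit infinity after time 0 *)

Section leaving_infinity.
Context {R : realType} {I : set R}.
Hypothesis I_half_line : I = `[0, +oo[%classic \/ I = `]0, +oo[%classic.
Context d (Omega : measurableType d) (X : process_data Omega R I).
Hypothesis X_standard : standard_process X (@infinity_cem I).
Context d' (Omega' : measurableType d') (Y : process_data Omega' R (I_infty I)).
Variable cem : set_system (option (I_infty I)).
Hypothesis Y_standard : standard_process Y cem.
Local Notation v := (set_val : I -> R).
Local Notation iota := (@to_I_infty R I).
Local Notation oo := (point_infty I).
Let mX : markov_process X := standard_markov X_standard.
Let mY : markov_process Y := standard_markov Y_standard.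
Let hI : hausdorff_space I := @half_line_hausdorff R I.
Let hI' : hausdorff_space (I_infty I) := @I_infty_hausdorff R I.
Implicit Types (f g : I_infty I -> R) (s t : R) (q : rat) (x : I).

Hypothesis transition_C : forall t f, 0 <= t -> C_infty f ->
  C_infty (fun z => transition Y t (cem_ext f) (Some z)).
Hypothesis transition_iota : forall t f x, 0 <= t -> C_infty f ->
  transition Y t (cem_ext f) (Some (iota x)) = transition X t (restr f) (Some x).

(** [transition_iota] speaks of functions of C_infty(I') only, to which the constant 1 need not
    belong; the factor g brings every iterate into this class. *)
Lemma grid_mean_ext g (h : R) K : 0 <= h -> C_infty g -> exists f, [/\ C_infty f,
  (fun z => cem_ext g z * grid_mean Y (cem_ext g) h K z) = cem_ext f &
  (fun z => restr g z * grid_mean X (restr g) h K z) = restr f].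
Proof.
move=> h0 Cg; elim: K => [|K [f [Cf fY fX]]].
  by exists g; split=> //; apply/funext => z; rewrite mulr1.
exists (fun z => g z * transition Y h (cem_ext f) (Some z)); split.
- by apply: C_inftyM => //; exact: transition_C.
- apply/funext => -[z|] /=; last by rewrite mul0r.
  by rewrite fY.
- apply/funext => -[x|] /=; last by rewrite mul0r.
  by rewrite fX transition_iota.
Qed.

Lemma grid_mean_iota g (h : R) K x : 0 <= h -> C_infty g ->
  grid_mean Y (cem_ext g) h K (Some (iota x)) = grid_mean X (restr g) h K (Some x).
Proof.
move=> h0 Cg; case: K => [//|K] /=.
have [f [Cf fY fX]] := grid_mean_ext K h0 Cg.
by rewrite fY fX transition_iota.
Qed.

Lemma grid_mean_None g (h : R) K : 0 <= h -> C_infty g ->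
  grid_mean Y (cem_ext g) h K.+1 None = 0.
Proof.
move=> h0 Cg; have [f [Cf fY _]] := grid_mean_ext K h0 Cg.
by rewrite /= fY (transition_None mY (standard_normal Y_standard) hI')//; exact: bmf_ext.
Qed.

(** Constants need not be in C_infty(I'), so 1 is approached boundedly and pointwise by G n + F
    (n+1). The first term is 1 on a growing part of I and 0 at infinity; the second vanishes up to
    n+1, hence the shifted index, and is 1 at infinity. *)
Lemma transition_alive_iota t x : 0 <= t ->
  transition Y t (@alive R (I_infty I)) (Some (iota x)) = transition X t (@alive R I) (Some x).
Proof.
move=> t0; have [F hF] := near_infinity_functions I_half_line.
have [G hG] := exhausting_functions I_half_line.
pose e n z := G n z + F n.+1 z.
have Ce n : C_infty (e n).
  by apply: C_inftyD; [case: (hG n)|case: (hF n.+1)].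
have e2 n z : `|e n z| <= 2.
  have [_ /(_ z)/andP[g0 g1] _ _] := hG n; have [_ /(_ z)/andP[f0 f1] _ _] := hF n.+1.
  by rewrite ger0_norm ?addr_ge0// -[2]/(1 + 1) lerD.
have eI y : exists N, forall n, (N <= n)%N -> e n (iota y) = 1.
  pose N := Num.truncn (Num.max (v y) (v y)^-1).
  exists N => n Nn; have : Num.max (v y) (v y)^-1 < n.+1%:R.
    by apply: lt_le_trans (truncnS_gt _) _; rewrite ler_nat.
  rewrite gt_max => /andP[h1 h2]; rewrite /e.
  have [_ _ _ ->//] := hG n; last 2 first.
  - exact: ltW.
  - by move=> /(half_line_gt0 I_half_line y) y0; rewrite invf_ple ?posrE// ltW.
  by have [_ _ _ ->] := hF n.+1; rewrite ?addr0// ltW.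
have eoo n : e n oo = 1.
  rewrite /e; have [_ _ -> _] := hF n.+1.
  by have [_ _ /nbhs_singleton -> _] := hG n; rewrite add0r.
have cY (z : cem_space (I_infty I)) : cem_ext (e n) z @[n --> \oo] --> (alive z : R).
  case: z => [z|] /=; last by apply: (@cvg_eventually_cst _ _ _ 0%N).
  case: (I_infty_cases z) => [[y ->]|->].
    by have [N hN] := eI y; exact: (@cvg_eventually_cst _ _ _ N).
  by apply: (@cvg_eventually_cst _ _ _ 0%N) => n _; exact: eoo.
have cX (z : cem_space I) : restr (e n) z @[n --> \oo] --> (alive z : R).
  case: z => [y|] /=; last by apply: (@cvg_eventually_cst _ _ _ 0%N).
  by have [N hN] := eI y; exact: (@cvg_eventually_cst _ _ _ N).
have [_ dY] := Ex_dominated (law Y (Some (iota x)))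
  (fun n => bmf_measurable (bmf_position mY t0 (bmf_ext (Ce n))))
  (fun n w => @cem_ext_le _ _ (e n) 2 (ler0n _ _) (e2 n) _) (fun w => cY (position Y t w)).
have [_ dX] := Ex_dominated (law X (Some x))
  (fun n => bmf_measurable (bmf_position mX t0 (bmf_restr I_half_line (Ce n))))
  (fun n w => restr_le (ler0n _ 2) (e2 n) _) (fun w => cX (position X t w)).
apply: (cvg_unique _ dY); first exact: Rhausdorff.
apply: cvg_trans dX; apply: near_eq_cvg; near=> n.
exact/esym/transition_iota.
Unshelve. all: by end_near. Qed.

Variable G : nat -> I_infty I -> R.
Hypothesis hG : forall n, [/\ C_infty (G n), forall z, 0 <= G n z <= 1,
    \forall z \near oo, G n z = 0 &
    forall x, v x <= n.+1%:R -> (~ I 0 -> n.+1%:R^-1 <= v x) -> G n (iota x) = 1].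

Definition grid_value s t n K w :=
  grid_product Y (cem_ext (G n)) (t / K.+1%:R) K.+1 s w.

(* A countable stand-in for the visits of infinity between s and s + t: by right
   continuity all fine grids of such a path meet the neighbourhood of infinity
   where G n vanishes. *)
Definition grids_vanish s t : set Omega' :=
  \bigcap_n \bigcup_K [set w | forall K', (K <= K')%N -> grid_value s t n K' w = 0].

(* After time s the path moves like X, which stays in compacts of I up to time t if
   it is alive at t, so that the grid products of G n do not vanish. *)
Lemma grids_vanish_null s q : 0 <= s -> 0 < ratr q :> R ->
  transition Y s (@at_infinity R I) (Some oo) = 0 ->
  let A := grids_vanish s (ratr q) `&` [set w | position Y (s + ratr q) w <> None] in
  measurable A /\ law Y (Some oo) A = 0%E.
Proof.
move=> s0; set t := ratr q => q0 soo; have t0 : 0 <= t by exact: ltW.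
have CG n : C_infty (G n) by have [] := hG n.
have G01 n z : 0 <= G n z <= 1 by have [_ /(_ z)] := hG n.
have E01 n (z : cem_space (I_infty I)) : 0 <= cem_ext (G n) z <= 1.
  by case: z => [z|] /=; [exact: G01|rewrite lexx ler01].
have bG n := bmf_ext (CG n).
have h0 K : 0 <= t / K.+1%:R by rewrite divr_ge0.
have st0 : 0 <= s + t by exact: addr_ge0.
have bV n K : bmf (grid_value s t n K) by exact: bmf_grid_product.
pose C n K := [set w | forall K', (K <= K')%N -> grid_value s t n K' w = 0].
have mC n K : measurable (C n K).
  rewrite (_ : C n K = \bigcap_(K' in [set K' | (K <= K')%N])
    (grid_value s t n K' @^-1` [set 0])); last by apply/seteqP; split=> w h K' /h.
  apply: bigcap_measurable => [|K' _]; first by exists K => /=.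
  have m1 : measurable ([set 0] : set R) by exact: measurable_set1.
  by have := bmf_measurable (bV n K') measurableT m1; rewrite setTI.
pose S := [set w | position Y (s + t) w <> None].
have mS : measurable S.
  rewrite [X in measurable X](_ : _ = ~` [set w | position Y (s + t) w = None])//.
  apply: measurableC; rewrite -[X in measurable X]setTI.
  exact: (position_measurable mY st0 measurableT (measurable_cem_set1 hI' None)).
have mA n : measurable (\bigcup_K C n K) by exact: bigcupT_measurable.
have mA' : measurable (grids_vanish s t `&` S).
  by apply: measurableI => //; apply: bigcapT_measurable => n; exact: mA.
split=> //; set P := law Y (Some oo).
pose al w : R := (w \in S)%:R.
have alE w : al w = alive (position Y (s + t) w).
  rewrite /al; case e : (position Y (s + t) w) => [z|] /=.
    by rewrite mem_set// /S /= e.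
  by rewrite (_ : w \in S = false)//; apply/negP => /set_mem; rewrite /S /= e.
have bal : bmf al by exact: bmf_indic.
have V01 n K w : 0 <= grid_value s t n K w <= 1 by exact: grid_product01.
(* The last grid point is s + t itself, where the cut-off vanishes on dead paths. *)
have V0 n K w : ~ S w -> grid_value s t n K w = 0.
  move=> Sw; apply: (@grid_product_eq0 _ _ _ _ _ _ _ _ _ _ K.+1); first by rewrite ltnSn.
  by rewrite mulrC divfK ?pnatr_eq0// (contrapT Sw).
pose phi := transition Y t (@alive R (I_infty I)).
pose psi n K := grid_mean Y (cem_ext (G n)) (t / K.+1%:R) K.+1.
have bphi : bmf (phi : cem_space (I_infty I) -> R).
  by apply: bmf_transition => //; exact: bmf_alive.
have bpsi n K : bmf (psi n K) by exact: bmf_grid_mean.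
(* The difference of [al] and the grid product is nonnegative, and equals [al] on [C n K]. Its mean
   is computed by the Markov property at time s. *)
have step1 n K : \int[P]_w ((w \in C n K)%:R * al w) <=
    \int[P]_w (phi (position Y s w) - psi n K (position Y s w)).
  rewrite Ex_B; [|exact: (bmf_position mY s0)..].
  have -> : \int[P]_w phi (position Y s w) = \int[P]_w al w.
    transitivity (transition Y (s + t) (@alive R (I_infty I)) (Some oo)).
      by rewrite (transition_add mY)//; exact: bmf_alive.
    by apply: eq_Rintegral => w _; rewrite alE.
  have -> : \int[P]_w psi n K (position Y s w) = \int[P]_w grid_value s t n K w.
    by rewrite /grid_value mean_grid_product.
  rewrite -Ex_B//; apply: Ex_le.
  - by apply: bmfM => //; exact: bmf_indic.
  - exact: bmfB.
  move=> w; have /andP[v0 v1] := V01 n K w.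
  have [Cw|Cw] := boolP (w \in C n K).
    by rewrite mul1r (set_mem Cw)// subr0.
  rewrite mul0r subr_ge0 /al; have [Sw|Sw] := boolP (w \in S) => //.
  by rewrite V0// => /mem_set; exact/negP.
(* The sets [C n K] increase with K, so a large K loses at most 1/(n+1). *)
have step2 n : exists K, \int[P]_w ((w \in \bigcup_K C n K)%:R * al w) <=
    \int[P]_w (phi (position Y s w) - psi n K (position Y s w)) + n.+1%:R^-1.
  have cw w : (w \in C n K)%:R * al w @[K --> \oo] --> (w \in \bigcup_K C n K)%:R * al w.
    have [wU|wU] := boolP (w \in \bigcup_K C n K).
      have [K _ CK] := set_mem wU; apply: (@cvg_eventually_cst _ _ _ K) => K' KK'.
      by rewrite mem_set// => L K'L; apply: CK; exact: leq_trans K'L.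
    apply: (@cvg_eventually_cst _ _ _ 0%N) => K _.
    rewrite (_ : w \in C n K = false)//; apply/negP => /set_mem CK.
    by move/negP: wU; apply; apply/mem_set; exists K.
  have b1 K w : `|(w \in C n K)%:R * al w| <= 1.
    by rewrite /al; case: (_ \in _); case: (_ \in _); rewrite ?mulr1 ?mul0r ?normr0 ?normr1 ?mulr0 ?normr0.
  have [_ /cvgrPdist_le] := Ex_dominated P
    (fun K => bmf_measurable (bmfM (bmf_indic R (mC n K)) bal)) b1 cw.
  have n0 : 0 < n.+1%:R^-1 :> R by rewrite invr_gt0.
  move=> /(_ _ n0)[K _ /(_ K (leqnn K))]; rewrite ler_norml => /andP[_ h].
  exists K; rewrite -lerBlDr; apply: le_trans (step1 n K).
  by rewrite lerBlDl -lerBlDr.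
have [K hK] := choice step2.
pose D n z := phi z - psi n (K n) z.
have bD n : bmf (D n : cem_space (I_infty I) -> R) by exact: bmfB.
(* The first factor removes the value infinity, which Y_s avoids almost surely. The positive part is
   taken because [stay_lower_bound] bounds [D n] from above only; at the cemetery [D n] is 0. *)
pose p n w : R := (1 - at_infinity (position Y s w)) * Num.max 0 (D n (position Y s w)).
have psi01 n L z : 0 <= psi n L z <= 1.
  have := @mean_grid_product _ _ _ _ _ mY _ _ (bG n) (h0 L) L.+1 z _ (lexx 0).
  rewrite (transition0 mY (standard_normal Y_standard) hI' _ (bpsi n L)) => <-.
  have bg := bmf_grid_product mY (bG n) (h0 L) L.+1 (lexx 0).
  rewrite Ex_ge_cst ?Ex_le_cst// => w; first by have /andP[] := grid_product01 Y (t / L.+1%:R) (E01 n) L.+1 0 w.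
  by have /andP[] := grid_product01 Y (t / L.+1%:R) (E01 n) L.+1 0 w.
have alive01 (z : cem_space (I_infty I)) : 0 <= (alive z : R) <= 1.
  by case: z => [z|] /=; rewrite ?lexx ler01.
have phi1 z : phi z <= 1.
  rewrite -[leRHS](transition_cst Y t 1 z); apply: (transition_le mY) => //.
  - exact: bmf_alive.
  - exact: bmf_cst.
  - by move=> y; have /andP[] := alive01 y.
have bai := bmf_position mY s0 (@bmf_at_infinity R I).
have ai01 (z : cem_space (I_infty I)) : 0 <= (1 - at_infinity z : R) <= 1.
  by rewrite /at_infinity; case: (_ \in _); rewrite ?subrr ?subr0 ?lexx ?ler01.
have p1 n w : `|p n w| <= 1.
  have /andP[a0 a1] := ai01 (position Y s w).
  have /andP[g0 g1] := psi01 n (K n) (position Y s w).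
  have m0 : 0 <= Num.max 0 (D n (position Y s w)) by rewrite le_max lexx.
  rewrite ger0_norm ?mulr_ge0// mulr_ile1// ge_max ler01/= /D.
  by rewrite lerBlDr (le_trans (phi1 _))// lerDl.
have bp n : bmf (p n).
  split; last by exists 1 => w; exact: p1.
  apply: measurable_funM.
    apply: measurable_funB => //.
    exact: bmf_measurable bai.
  apply: (@measurable_maxr _ _ _ _ (fun=> 0) (fun w => D n (position Y s w))) => //.
  exact: bmf_measurable (bmf_position mY s0 (bD n)).
have cp w : p n w @[n --> \oo] --> (0 : R).
  rewrite /p; case e : (position Y s w) => [z|]; last first.
    apply: (@cvg_eventually_cst _ _ _ 0%N) => n _; rewrite /D /psi grid_mean_None// subr0.
    rewrite /phi (transition_None mY (standard_normal Y_standard) hI')//=.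
      by rewrite (max_idPl _) ?mulr0.
    exact: bmf_alive.
  case: (I_infty_cases z) => [[x ->]|->]; last first.
    apply: (@cvg_eventually_cst _ _ _ 0%N) => n _.
    by rewrite /at_infinity mem_set// subrr mul0r.
  have [r [r0 hr]] := stay_lower_bound I_half_line X_standard CG G01
    (fun n => let: And4 _ _ _ h := hG n in h) x q0.
  apply/cvgrPdist_le => e' e'0; move/cvgrPdist_le: r0 => /(_ _ e'0)[N _ hN].
  exists N => // n /hN; rewrite /= !sub0r !normrN => rn.
  have /andP[a0 a1] := ai01 (Some (iota x)).
  have m0 : 0 <= Num.max 0 (D n (Some (iota x))) by rewrite le_max lexx.
  rewrite ger0_norm ?mulr_ge0// (le_trans (ler_piMl m0 a1))//.
  rewrite ge_max (ltW e'0)/= (le_trans _ rn)// (le_trans _ (ler_norm _))//.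
  rewrite /D /phi /psi transition_alive_iota// grid_mean_iota// lerBlDr -lerBlDl.
  exact: hr.
have [_ cint] := Ex_dominated P (fun n => bmf_measurable (bp n)) p1 cp.
rewrite Ex_cst in cint.
have moo : measurable [set w | position Y s w = Some oo].
  rewrite -[X in measurable X]setTI.
  exact: (position_measurable mY s0 measurableT (measurable_cem_set1 hI' (Some oo))).
have oo0 : P [set w | position Y s w = Some oo] = 0%E.
  rewrite -[LHS]fineK ?fin_num_measure//; congr EFin; rewrite -[RHS]soo.
  by rewrite transition_indic//; exact: measurable_cem_set1.
have bI := bmf_indic R mA'.
have le_int n : \int[P]_w (w \in grids_vanish s t `&` S)%:R <=
    \int[P]_w p n w + n.+1%:R^-1.
  have bin := bmfM (bmf_indic R (mA n)) bal.
  apply: le_trans (le_trans _ (hK n)) _.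
    apply: Ex_le => // w; rewrite /al in_setI; case: (boolP (w \in S)) => Sw; last first.
      by rewrite andbF mulr0.
    rewrite andbT mulr1; case: (boolP (w \in grids_vanish s t)) => Aw //.
    have Cw : (\bigcup_K C n K) w by exact: (set_mem Aw n Logic.I).
    by rewrite (mem_set Cw).
  have b1 := bmf_position mY s0 (bD n).
  rewrite lerD2r [leLHS](_ : _ = \int[P]_w ((1 - at_infinity (position Y s w)) * D n (position Y s w))).
    apply: Ex_le => //.
      by apply: bmfM => //; apply: bmfB; [exact: bmf_cst|exact: bai].
    move=> w; have /andP[a0 _] := ai01 (position Y s w).
    by rewrite ler_wpM2l// le_max lexx orbT.
  apply: (Ex_ae moo oo0).
  - exact: bmf_measurable b1.
  - apply: bmf_measurable; apply: bmfM => //.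
    by apply: bmfB; [exact: bmf_cst|exact: bai].
  - move=> w /= hw; rewrite /at_infinity (_ : _ \in _ = false) ?subr0 ?mul1r//.
    by apply/negP => /set_mem.
have cz : \int[P]_w p n w + n.+1%:R^-1 @[n --> \oo] --> (0 : R).
  by rewrite -[X in _ --> X]addr0; apply: cvgD => //; exact: cvg_harmonic.
have := cvg_ge_bound cz le_int; rewrite Ex_indic// => h.
rewrite -[LHS]fineK ?fin_num_measure//; congr EFin; apply/eqP; rewrite eq_le h /=.
exact: fine_ge0.
Qed.

Lemma grids_vanish_visit s t u w : right_continuous_at Y cem w -> 0 <= s -> s < u ->
  u < s + t -> position Y u w = Some oo -> grids_vanish s t w.
Proof.
move=> rc s0 su ust uoo n _; have u0 : 0 <= u by rewrite (le_trans s0)// ltW.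
have [_ _ Gn0 _] := hG n; have [e e0 he] := right_continuous_nbhs rc u0 uoo Gn0.
have us : 0 < u - s by rewrite subr_gt0.
have t0 : 0 < t by lra.
exists (Num.truncn (t / e)) => // K hK; set h := t / K.+1%:R.
have h0 : 0 < h by rewrite divr_gt0.
have te : t < e * K.+1%:R.
  rewrite mulrC -ltr_pdivrMr//; apply: lt_le_trans (truncnS_gt _) _.
  by rewrite ler_nat.
have hlt : h < e by rewrite /h ltr_pdivrMr.
(* The grid point of index j + 1 is the first one strictly after u. *)
pose j := Num.truncn ((u - s) / h).
have us0 : 0 <= (u - s) / h by rewrite divr_ge0// ltW.
have j1 : (u - s) / h < j.+1%:R := truncnS_gt _.
have j2 : j%:R <= (u - s) / h by rewrite truncn_le.
rewrite ltr_pdivrMr// in j1; rewrite ler_pdivlMr// in j2.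
have jK : (j < K.+1)%N.
  rewrite -(ltr_nat R) -(ltr_pM2r h0) (le_lt_trans j2)//.
  rewrite [ltRHS]mulrC /h divfK ?pnatr_eq0//; lra.
apply: (@grid_product_eq0 _ _ _ _ _ _ _ _ _ _ j.+1); first by rewrite ltnS.
have [] := he (s + j.+1%:R * h).
  by apply/andP; split; [lra|rewrite -natr1 mulrDl mul1r; lra].
by move=> z z0 <-.
Qed.

Hypothesis avoiding_times : forall e : R, 0 < e ->
  exists2 s, 0 < s < e & transition Y s (@at_infinity R I) (Some oo) = 0.

(** The event of never being at infinity involves uncountably many times; it is measurable because
    it says that this hitting time is +oo. *)
Lemma measurable_hitting_infinity : measurable_fun [set: Omega'] (hitting_time Y [set oo]).
Proof.
have cv := @initial_continuous (I_infty I) (\bar R) set_val.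
apply: (measurable_hitting_time Y_standard
  (U := fun n => [set z : I_infty I | (n%:R%:E < set_val z)%E])).
- move=> n; apply: (@open_comp _ _ (set_val : I_infty I -> \bar R) [set y | (n%:R%:E < y)%E]).
    by move=> z _; exact: cv.
  exact: open_ereal_gt_ereal.
- move=> m n mn z /=; apply: le_lt_trans; by rewrite lee_fin ler_nat.
- by move=> n z /= ->; rewrite /= ltry.
- move=> z hz /=; case: (I_infty_cases z) => [[x zx]|->//].
  pose n := (Num.truncn (v x)).+1.
  have : closure [set z : I_infty I | (n%:R%:E <= set_val z)%E] z.
    by have := hz n Logic.I; apply: closure_subset => y /= /ltW.
  rewrite -(closure_id _).1; last first.
    apply: (@closed_comp _ _ (set_val : I_infty I -> \bar R) [set y | (n%:R%:E <= y)%E]).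
      by move=> y _; exact: cv.
    exact: closed_ereal_le_ereal.
  by rewrite /= zx /= lee_fin leNgt truncnS_gt.
Qed.

(** A visit to infinity at u > 0 lies in one of countably many null events: some avoiding time s m
    is below u, and for some rational q the time s m + q is so little beyond u that the path is
    still alive. *)
Lemma never_at_infinity : law Y (Some oo) [set w | forall t, 0 < t ->
  (exists x : I, position Y t w = Some (iota x)) \/ position Y t w = None] = 1%E.
Proof.
set T := [set w | _]; set P := law Y (Some oo).
have mT : measurable T.
  have -> : T = hitting_time Y [set oo] @^-1` [set +oo%E].
    apply/seteqP; split=> w /= hw.
      apply/eqP; rewrite -leye_eq; apply: le_ereal_inf_tmp => _ [t [t0 [z /= -> zt]] <-].
      have [[x]|] := hw t t0; rewrite -zt// => -[].
    move=> t t0; case e : (position Y t w) => [z|]; last by right.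
    left; case: (I_infty_cases z) => [[x ->]|zoo]; first by exists x.
    have : (hitting_time Y [set oo] w <= t%:E)%E.
      by apply: ereal_inf_lbound; exists t => //; split=> //; exists z.
    by rewrite hw.
  have m1 : measurable ([set +oo%E] : set (\bar R)) by exact: emeasurable_set1.
  by have := measurable_hitting_infinity measurableT m1; rewrite setTI.
have pos (m : nat) : 0 < m.+1%:R^-1 :> R by rewrite invr_gt0.
have /choice[s hs] : forall m : nat, exists s, 0 < s < m.+1%:R^-1 /\
    transition Y s (@at_infinity R I) (Some oo) = 0.
  by move=> m; have [s ? ?] := avoiding_times (pos m); exists s.
have [N [mN N0 rc]] := right_continuous_null Y_standard.
pose A (c : nat * rat) := if 0 < ratr c.2 :> R then
  grids_vanish (s c.1) (ratr c.2) `&` [set w | position Y (s c.1 + ratr c.2) w <> None]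
  else set0.
have nA c : P.-negligible (A c).
  rewrite /A; case: ifPn => [c0|_]; last exact: negligible_set0.
  have [/andP[s0 _] soo] := hs c.1.
  have [mA A0] := grids_vanish_null (ltW s0) c0 soo.
  by apply/negligibleP.
have nT : P.-negligible (~` T).
  apply: (@negligibleS _ _ _ _ (N `|` \bigcup_c A c)); last first.
    apply: negligibleU; last exact: negligible_bigcup_countable.
    by apply/negligibleP => //; exact: N0.
  move=> w nTw; have [Nw|Nw] := pselect (N w); [by left|right].
  have [u u0 uoo] : exists2 u, 0 < u & position Y u w = Some oo.
    apply: contrapT => hu; apply: nTw => t t0.
    case e : (position Y t w) => [z|]; last by right.
    left; case: (I_infty_cases z) => [[x ->]|zoo]; first by exists x.
    by case: hu; exists t => //; rewrite e zoo.
  have rcw := rc w Nw.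
  have [e e0 he] := right_continuous_nbhs rcw (ltW u0) uoo filterT.
  pose m := Num.truncn u^-1.
  have [/andP[sm0 smu] _] := hs m.
  have smu' : s m < u.
    by rewrite (lt_trans smu)// invf_plt ?posrE// truncnS_gt.
  have [q] : exists q : rat, ratr q \in `]u - s m, (u - s m + e)[.
    by apply: rat_in_itvoo; rewrite ltrDl.
  rewrite in_itv/= => /andP[q1 q2].
  have q0 : 0 < ratr q :> R by rewrite (lt_trans _ q1)// subr_gt0.
  exists (m, q) => //; rewrite /A /= q0; split.
    by apply: (grids_vanish_visit rcw (ltW sm0) smu' _ uoo); lra.
  have [] := he (s m + ratr q); first by apply/andP; split; lra.
  by move=> z _ ez; rewrite /= -ez.
have := measure_negligible (measurableC mT) nT => T0.
by rewrite -[T]setCK probability_setC ?T0 ?sube0//; exact: measurableC.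
Qed.

End leaving_infinity.

Theorem theorem3p4 (R : realType) (I : set R)
    (I_half_line : I = `[0, +oo[%classic \/ I = `]0, +oo[%classic)
    (d : measure_display) (Omega : measurableType d)
    (X : process_data Omega R I)
    (X_standard : standard_process X (@infinity_cem I))
    (X_no_negative_jumps : no_negative_jumps X)
    (X_comes_down : comes_down_from_infinity X)
    (resolvent_C : forall f, space_C f -> forall q : R, 0 < q ->
       space_C (resolvent X q f))
    (resolvent_cvg : forall f, space_C f -> forall x : I,
       q * resolvent X q f x @[q --> +oo] --> f x) :
  exists pbar : R -> (I_infty I -> R) -> (I_infty I -> R),
    [/\ feller_semigroup pbar,
        forall f, C_infty f -> forall (x : I) (t : R), 0 <= t ->
          (pbar t f (to_I_infty x))%:E =
          'E_(law X (Some x))[fun w =>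
            cem_ext (f \o @to_I_infty R I) (position X t w)]%E
      & forall (d' : measure_display) (Omega' : measurableType d')
          (Y : process_data Omega' R (I_infty I)),
          hunt_process Y (@isolated_cem (I_infty I)) \/
          hunt_process Y (@infinity_cem (I_infty I)) ->
          associated Y pbar ->
          law Y (Some (point_infty I))
            [set w | forall t, 0 < t ->
               (exists x : I, position Y t w = Some (to_I_infty x)) \/
               position Y t w = None] = 1%E].
Proof.
have JP := @ext_resolventP R I I_half_line d Omega X X_standard X_no_negative_jumps
  X_comes_down resolvent_C.
set J := ext_resolvent I_half_line _ _ _ _ in JP.
have J_C q f q0 Cf := (JP q f q0 Cf).1.
have JE q f x q0 Cf := (JP q f q0 Cf).2 x.
have J_cvg := @ext_resolvent_cvg R I I_half_line d Omega X X_standard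
  X_no_negative_jumps X_comes_down resolvent_C resolvent_cvg.
have PP := @ext_semigroupP R I I_half_line d Omega X X_standard J J_C JE J_cvg.
have feller := @ext_semigroup_feller R I I_half_line d Omega X X_standard J J_C JE J_cvg.
set pbar := ext_semigroup I_half_line _ _ _ _ in PP feller.
have mX := standard_markov X_standard.
exists pbar; split => // [f Cf x t t0|d' Omega' Y Y_hunt Y_associated].
  have [_ ->] := PP t f t0 Cf.
  by rewrite (expectation_Ex _ (bmf_position mX t0 (bmf_restr I_half_line Cf))).
(* Both conventions for the cemetery are handled together, the preceding results having [cem] as a
   parameter. *)
have [cem Y_standard] : exists cem, standard_process Y cem.
  by case: Y_hunt => -[sY _]; [exists (@isolated_cem (I_infty I))|exists (@infinity_cem (I_infty I))].
have mY := standard_markov Y_standard.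
have pE t f z : 0 <= t -> C_infty f -> transition Y t (cem_ext f) (Some z) = pbar t f z.
  move=> t0 Cf; apply/EFin_inj; rewrite (Y_associated t f z t0 Cf).
  by rewrite (expectation_Ex _ (bmf_position mY t0 (bmf_ext Cf))).
have transition_C t f : 0 <= t -> C_infty f ->
    C_infty (fun z => transition Y t (cem_ext f) (Some z)).
  move=> t0 Cf; have [+ _] := PP t f t0 Cf; congr C_infty.
  by apply/funext => z; rewrite pE.
have transition_iota t f x : 0 <= t -> C_infty f ->
    transition Y t (cem_ext f) (Some (to_I_infty x)) = transition X t (restr f) (Some x).
  by move=> t0 Cf; rewrite pE//; have [_ ->] := PP t f t0 Cf.
have [G hG] := exhausting_functions I_half_line.
apply: (never_at_infinity I_half_line X_standard Y_standard transition_C transition_iota hG).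
exact: (avoid_infinity_time I_half_line X_standard X_no_negative_jumps X_comes_down
  Y_standard transition_C transition_iota).
Qed.
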